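(* Let $k\in\mathbb{N}$ be fixed and let $c$ be a real constant. The bound $$\int_0^T|\zeta(\tfrac12+it)|^{2k}\,dt \ll_\varepsilon T^{c+\varepsilon}\qquad(\text{for every }\varepsilon>0,\ T\ge 1)$$ holds if and only if $\mathcal{Z}_k(s)$ is regular for $\operatorname{Re}s>c$ and, for any given $\varepsilon>0$, $$\mathcal{Z}_k(c+\varepsilon+it)\ll_\varepsilon 1\qquad(t\in\mathbb{R}).$$
   Context: $\zeta$ is the Riemann zeta-function and $\mathbb{N}=\{1,2,\dots\}$. For $k\in\mathbb{N}$ the modified Mellin transform is $$\mathcal{Z}_k(s)=\int_1^\infty|\zeta(\tfrac12+ix)|^{2k}x^{-s}\,dx$$ for $\operatorname{Re}s$ so large that the integral converges absolutely, and it is defined elsewhere by analytic continuation. ''$\mathcal{Z}_k(s)$ is regular for $\operatorname{Re}s>c$'' means that it has a holomorphic continuation to (or is holomorphic in) that half-plane. $f\ll_\varepsilon g$ means $|f|\le C g$ with a constant $C$ depending only on $\varepsilon$ (and on the fixed $k$, $c$). *)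

(* Defs.v *)
From Stdlib Require Import Reals.
From Coquelicot Require Import Coquelicot.

Open Scope R_scope.

(* For x > 0 only: [Rpower] and [ln] take junk values elsewhere. *)
Definition cpow (x : R) (s : C) : C :=
  (Rpower x (Re s) * cos (Im s * ln x), Rpower x (Re s) * sin (Im s * ln x)).

(* Complex differentiability at every point of D, which is meant to be open.
   The scalar field has to be given: over [R_AbsRing], [ex_derive] would not be
   complex differentiability. *)
Definition holomorphic_on (D : C -> Prop) (f : C -> C) : Prop :=
  forall s : C, D s -> ex_derive (K := C_AbsRing) (V := C_NormedModule) f s.

(* The analytic continuation of the Dirichlet series to the plane without the
   point 1; by the identity theorem these two clauses determine zeta s for all
   s <> 1, and the value at the pole is left arbitrary. *)
Definition is_riemann_zeta (zeta : C -> C) : Prop :=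
  (forall s : C, 1 < Re s ->
     is_series (K := C_AbsRing) (V := C_NormedModule)
       (fun n : nat => cpow (INR (S n)) (- s)%C) (zeta s)) /\
  holomorphic_on (fun s : C => s <> RtoC 1) zeta.

Definition zeta_moment_density (zeta : C -> C) (k : nat) (t : R) : R :=
  Cmod (zeta (1 / 2, t)) ^ (2 * k).

Definition mellin_integrand (zeta : C -> C) (k : nat) (s : C) (x : R) : C :=
  (RtoC (zeta_moment_density zeta k x) * cpow x (- s))%C.

Definition mellin_abs_cv (zeta : C -> C) (k : nat) (s : C) : Prop :=
  ex_RInt_gen (fun x : R => Cmod (mellin_integrand zeta k s x))
    (at_point 1) (Rbar_locally p_infty).

(* "Z is the modified Mellin transform, and it is regular for Re s > c": Z is
   holomorphic there and is given by the integral wherever in that half-plane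
   the integral converges absolutely.  Since zeta (1/2 + i x) grows at most
   polynomially, absolute convergence holds for all s with Re s large, so Z is
   determined on the whole half-plane by the identity theorem.  Values of Z
   outside the half-plane are irrelevant. *)
Definition is_regular_mellin (zeta : C -> C) (k : nat) (c : R) (Z : C -> C)
  : Prop :=
  holomorphic_on (fun s : C => c < Re s) Z /\
  forall s : C, c < Re s -> mellin_abs_cv zeta k s ->
    is_RInt_gen (V := C_R_NormedModule) (mellin_integrand zeta k s)
      (at_point 1) (Rbar_locally p_infty) (Z s).

(* Main.v *)
Require Import Defs.
From Stdlib Require Import Reals Lra Lia Psatz Factorial.
From Coquelicot Require Import Coquelicot.
Open Scope R_scope.

(** Write f for the nonnegative density and say that the transform converges at
    a real sigma when the integrals of f(x) x^(-sigma) over [1, X] stay bounded.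

    From moments to the transform.  A moment bound with exponent below sigma
    gives convergence at sigma by partial summation ([moment_mellin_bounded]).
    Where it converges, the transform is holomorphic, because
    |e^w - 1 - w| <= |w|^2 e^|w| and powers of ln x cost only an epsilon in the
    exponent ([mellin_transform_derive]); on a vertical line it is dominated by
    its value on the real axis ([mellin_transform_spec]).

    From the transform to moments.  The point is Landau's theorem
    ([landau_mellin]): since f >= 0, a holomorphic continuation to Re s > c
    forces convergence at every sigma > c.  Up to sign, the Taylor coefficients
    of the transform at a point a far to the right are the integrals of
    f(x) x^(-a) (ln x)^n / n!; Cauchy's estimate bounds them by M r^(-n) for
    every r < a - c ([log_moment_bound]), and by nonnegativity they may be summed
    against y^n, y < r, which gives convergence at a - y
    ([mellin_bounded_of_log_moments]).  For c >= 0 convergence at c + eps is the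
    moment bound, because (T/x)^(c + eps) >= 1 on [1, T].

    For c < 0 the moment bound fails, since it would make the moments tend to 0,
    and regularity fails too.  It would give convergence at 0, that is, integrability of
    f, whereas the first moment of zeta over [1, 1 + H] is at least H/4 - 290
    ([zeta_first_moment_lower]): integrate zeta(s)(s - s2) around a rectangle
    with left side on the critical line, s2 being its upper left corner.  The
    factor vanishes at s2 and so tames the upper side, where zeta is only known
    to be O(|s|), and on the right side zeta is close to 1 ([zeta_near_1]).

    Two things have to be built first.  Cauchy's theory is reduced to Goursat's
    theorem for rectangles ([goursat_rectangle]): in the coordinate w with
    s = a + e^w a circle becomes a vertical segment and the two horizontal sides
    cancel by periodicity, so r^(-n) times the n-th Fourier coefficient on the
    circle of radius r does not depend on r ([circle_coef_scaling]).  And the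
    transform must converge somewhere, for which |zeta(s)| <= 4|s| for
    Re s >= 1/2, Im s >= 1 suffices ([zeta_growth]).  The sums
    n^(-s), n <= N, completed by (N+1)^(1-s)/(s-1), satisfy this bound for Re s > 1/2
    and converge to zeta for Re s > 1; that they also converge to zeta further
    left is shown by a two-constants estimate ([two_constants]) on a circle that
    reaches into Re s > 1. *)


(** * Complex derivatives, paths and the exponential *)

(** Complex differentiability is stated with [C_NormedModule] in the definition
    of [holomorphic_on], but the product and chain rules are available for the
    ring [C_AbsRing] as a module over itself; the two notions agree because they
    use the same norm. *)
Notation Cderiv f z l :=
  (is_derive (K := C_AbsRing) (V := AbsRing_NormedModule C_AbsRing) f z l).

Notation Cdiff f z :=
  (ex_derive (K := C_AbsRing) (V := AbsRing_NormedModule C_AbsRing) f z).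

Lemma Cderiv_C_NormedModule (f : C -> C) (z l : C) :
  is_derive (K := C_AbsRing) (V := C_NormedModule) f z l <-> Cderiv f z l.
Proof.
  split; intros [[H1 H2 H3] H]; split; try (exact H); split; try assumption.
Qed.

Lemma Cderiv_eps (f : C -> C) (z l : C) :
  Cderiv f z l <->
  forall eps, 0 < eps -> exists delta, 0 < delta /\
    forall h, Cmod h < delta ->
    Cmod (f (z + h) - f z - l * h)%C <= eps * Cmod h.
Proof.
  split.
  - intros [_ H] eps He.
    destruct (H z (fun P HP => HP) (mkposreal eps He)) as [d Hd].
    exists d. split; [apply d|].
    intros h Hh. specialize (Hd (z + h)%C).
    assert (E : minus (G := C_AbsRing) (z + h)%C z = h).
    { unfold minus, plus, opp; simpl. ring. }
    change (Cmod (minus (G := C_AbsRing) (z + h)%C z) < d ->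
      Cmod (minus (G := C_AbsRing)
       (minus (G := C_AbsRing) (f (z + h)%C) (f z)) (scal (V := AbsRing_NormedModule C_AbsRing)
           (minus (G := C_AbsRing) (z + h)%C z) l))
      <= eps * Cmod (minus (G := C_AbsRing) (z + h)%C z)) in Hd.
    rewrite E in Hd.
    assert (E2 : (f (z + h) - f z - l * h)%C = minus (G := C_AbsRing)
       (minus (G := C_AbsRing) (f (z + h)%C) (f z)) (scal (V := AbsRing_NormedModule C_AbsRing) h
           l)).
    { unfold minus, plus, opp, scal; simpl. unfold mult; simpl. ring. }
    rewrite E2. apply Hd.
    exact Hh.
  - intros H. split; [apply is_linear_scal_l|].
    intros x Hx. apply (is_filter_lim_locally_unique (V := AbsRing_NormedModule C_AbsRing)) in
        Hx. subst x.
    intros eps. destruct (H eps (cond_pos eps)) as [d [Hd H']].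
    exists (mkposreal d Hd). intros y Hy.
    change (Cmod (minus (G := C_AbsRing) y z) < d) in Hy.
    change (Cmod (minus (G := C_AbsRing)
       (minus (G := C_AbsRing) (f y) (f z)) (scal (V := AbsRing_NormedModule C_AbsRing) (minus (G
           := C_AbsRing) y z) l))
      <= eps * Cmod (minus (G := C_AbsRing) y z)).
    change C in y.
    specialize (H' _ Hy).
    assert (E : (z + minus (G := C_AbsRing) y z)%C = y :> C).
    { unfold minus, plus, opp; simpl. change C in y. ring. }
    rewrite E in H'.
    match goal with |- Cmod ?a <= _ =>
      assert (E2 : a = (f y - f z - l * minus (G := C_AbsRing) y z)%C) end.
    { unfold minus, plus, opp, scal; simpl. unfold mult; simpl. ring. }
    rewrite E2. exact H'.
Qed.

Lemma Cderiv_mult f g z df dg : Cderiv f z df -> Cderiv g z dg ->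
  Cderiv (fun w => f w * g w)%C z (df * g z + f z * dg)%C.
Proof.
  intros Hf Hg. apply (is_derive_mult (K := C_AbsRing) f g z df dg Hf Hg).
  intros; apply Cmult_comm.
Qed.

Lemma Cderiv_plus f g z df dg : Cderiv f z df -> Cderiv g z dg ->
  Cderiv (fun w => f w + g w)%C z (df + dg)%C.
Proof. apply (is_derive_plus (K := C_AbsRing) f g). Qed.

Lemma Cderiv_comp f g z df dg : Cderiv f (g z) df -> Cderiv g z dg ->
  Cderiv (fun w => f (g w))%C z (dg * df)%C.
Proof. intros Hf Hg. apply (is_derive_comp (K := C_AbsRing) f g z df dg Hf Hg). Qed.

Lemma Cderiv_id z : Cderiv (fun w => w) z (RtoC 1).
Proof. apply (is_derive_id (K := C_AbsRing)). Qed.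

Lemma Cderiv_const (a z : C) : Cderiv (fun _ => a) z (RtoC 0).
Proof. apply (is_derive_const (K := C_AbsRing) (V := AbsRing_NormedModule C_AbsRing)). Qed.

Lemma Cderiv_minus f g z df dg : Cderiv f z df -> Cderiv g z dg ->
  Cderiv (fun w => f w - g w)%C z (df - dg)%C.
Proof. apply (is_derive_minus (K := C_AbsRing) f g). Qed.

Lemma Cderiv_eq (f : C -> C) (z l l' : C) : Cderiv f z l -> l = l' -> Cderiv f z l'.
Proof. intros H E. now rewrite <- E. Qed.

(** Reads the derivative off the syntax of the function; the value found is to be
    compared with the expected one by [Cderiv_eq]. *)
Ltac cderiv :=
  lazymatch goal with
  | |- is_derive (fun w => w) _ _ => apply Cderiv_id
  | |- is_derive (fun _ => ?a) ?z _ => exact (Cderiv_const a z)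
  | |- is_derive (fun w => Cplus (@?f w) (@?g w)) ?z _ =>
      refine (Cderiv_plus f g z _ _ _ _); cderiv
  | |- is_derive (fun w => Cminus (@?f w) (@?g w)) ?z _ =>
      refine (Cderiv_minus f g z _ _ _ _); cderiv
  | |- is_derive (fun w => Cmult (@?f w) (@?g w)) ?z _ =>
      refine (Cderiv_mult f g z _ _ _ _); cderiv
  | _ => idtac
  end.

Lemma Cdiff_mult f g z : Cdiff f z -> Cdiff g z -> Cdiff (fun w => f w * g w)%C z.
Proof. intros [l Hl] [m Hm]. eexists. exact (Cderiv_mult f g z l m Hl Hm). Qed.

Lemma Cdiff_comp f g z : Cdiff f (g z) -> Cdiff g z -> Cdiff (fun w => f (g w)) z.
Proof. intros [l Hl] [m Hm]. eexists. exact (Cderiv_comp f g z l m Hl Hm). Qed.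

Lemma Cdiff_plus f g z : Cdiff f z -> Cdiff g z -> Cdiff (fun w => f w + g w)%C z.
Proof. intros [l Hl] [m Hm]. eexists. exact (Cderiv_plus f g z l m Hl Hm). Qed.

Lemma Cdiff_minus f g z : Cdiff f z -> Cdiff g z -> Cdiff (fun w => f w - g w)%C z.
Proof. intros [l Hl] [m Hm]. eexists. exact (Cderiv_minus f g z l m Hl Hm). Qed.

Lemma Rderiv_eps (f : R -> R) (t l : R) :
  is_derive f t l <->
  forall eps, 0 < eps -> exists delta, 0 < delta /\
    forall h, Rabs h < delta -> Rabs (f (t + h) - f t - l * h) <= eps * Rabs h.
Proof.
  rewrite is_derive_Reals. split.
  - intros H eps He. destruct (H eps He) as [d Hd].
    exists d. split; [apply d|]. intros h Hh.
    destruct (Req_dec h 0) as [->|Hn].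
    + rewrite Rplus_0_r, Rabs_R0. replace (f t - f t - l * 0) with 0 by ring.
      rewrite Rabs_R0. lra.
    + specialize (Hd h Hn Hh).
      replace (f (t + h) - f t - l * h) with (((f (t + h) - f t) / h - l) * h) by (field;
        exact Hn).
      rewrite Rabs_mult. apply Rmult_le_compat_r; [apply Rabs_pos|lra].
  - intros H eps He. destruct (H (eps / 2)) as [d [Hd H']]; [lra|].
    exists (mkposreal d Hd). intros h Hn Hh. specialize (H' h Hh).
    replace ((f (t + h) - f t) / h - l) with ((f (t + h) - f t - l * h) / h) by (field; exact Hn).
    assert (0 < Rabs h) by now apply Rabs_pos_lt.
    unfold Rdiv. rewrite Rabs_mult, Rabs_inv.
    apply Rle_lt_trans with (eps / 2 * Rabs h * / Rabs h).
    + apply Rmult_le_compat_r; [left; now apply Rinv_0_lt_compat|exact H'].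
    + field_simplify; lra.
Qed.

Definition path_deriv (phi : R -> C) (t : R) (l : C) : Prop :=
  is_derive (fun u => Re (phi u)) t (Re l) /\ is_derive (fun u => Im (phi u)) t (Im l).

Lemma Re_le_Cmod (z : C) : Rabs (Re z) <= Cmod z.
Proof. apply re_le_Cmod. Qed.

Lemma Im_le_Cmod (z : C) : Rabs (Im z) <= Cmod z.
Proof.
  eapply Rle_trans; [|apply Rmax_Cmod]. apply Rmax_r.
Qed.

Lemma Cmod_le_Re_Im (z : C) : Cmod z <= Rabs (Re z) + Rabs (Im z).
Proof.
  replace z with (RtoC (Re z) + Ci * RtoC (Im z))%C at 1.
  - eapply Rle_trans; [apply Cmod_triangle|].
    rewrite Cmod_mult, Cmod_Ci, !Cmod_R. lra.
  - destruct z; unfold Ci, RtoC, Cmult, Cplus; simpl; f_equal; ring.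
Qed.

Lemma path_deriv_eps (phi : R -> C) (t : R) (l : C) :
  path_deriv phi t l <->
  forall eps, 0 < eps -> exists delta, 0 < delta /\
    forall h, Rabs h < delta ->
    Cmod (phi (t + h)%R - phi t - l * RtoC h)%C <= eps * Rabs h.
Proof.
  assert (ER : forall h, Re (phi (t + h)%R - phi t - l * RtoC h)%C
      = Re (phi (t + h)%R) - Re (phi t) - Re l * h).
  { intros h. unfold Re, Cminus, Copp, Cplus, Cmult, RtoC; simpl; ring. }
  assert (EI : forall h, Im (phi (t + h)%R - phi t - l * RtoC h)%C
      = Im (phi (t + h)%R) - Im (phi t) - Im l * h).
  { intros h. unfold Im, Cminus, Copp, Cplus, Cmult, RtoC; simpl; ring. }
  split.
  - intros [H1 H2] eps He.
    rewrite Rderiv_eps in H1, H2.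
    destruct (H1 (eps / 2)) as [d1 [Hd1 H1']]; [lra|].
    destruct (H2 (eps / 2)) as [d2 [Hd2 H2']]; [lra|].
    exists (Rmin d1 d2). split; [now apply Rmin_pos|].
    intros h Hh.
    eapply Rle_trans; [apply Cmod_le_Re_Im|].
    rewrite ER, EI.
    specialize (H1' h (Rlt_le_trans _ _ _ Hh (Rmin_l _ _))).
    specialize (H2' h (Rlt_le_trans _ _ _ Hh (Rmin_r _ _))). lra.
  - intros H. split; rewrite Rderiv_eps; intros eps He;
      destruct (H eps He) as [d [Hd H']]; exists d; split; try assumption;
      intros h Hh; specialize (H' h Hh).
    + rewrite <- ER. eapply Rle_trans; [apply Re_le_Cmod|exact H'].
    + rewrite <- EI. eapply Rle_trans; [apply Im_le_Cmod|exact H'].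
Qed.

Lemma path_deriv_comp (f : C -> C) (phi : R -> C) (t : R) (df dp : C) :
  Cderiv f (phi t) df -> path_deriv phi t dp ->
  path_deriv (fun u => f (phi u)) t (df * dp)%C.
Proof.
  intros Hf Hp. rewrite path_deriv_eps in *. rewrite Cderiv_eps in Hf.
  intros eps He.
  assert (Hdp := Cmod_ge_0 dp). assert (Hdf := Cmod_ge_0 df).
  set (e1 := eps / 2 / (Cmod dp + 1)).
  assert (He1 : 0 < e1) by (unfold e1; apply Rdiv_lt_0_compat; lra).
  set (e2 := eps / 2 / (Cmod df + 1)).
  assert (He2 : 0 < e2) by (unfold e2; apply Rdiv_lt_0_compat; lra).
  destruct (Hf e1 He1) as [d1 [Hd1 H1]].
  destruct (Hp (Rmin e2 1)) as [d2 [Hd2 H2]]; [apply Rmin_pos; lra|].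
  exists (Rmin d2 (d1 / (Cmod dp + 1))). split.
  { apply Rmin_pos; [assumption|]. apply Rdiv_lt_0_compat; lra. }
  intros h Hh.
  specialize (H2 h (Rlt_le_trans _ _ _ Hh (Rmin_l _ _))).
  assert (Hh2 := Rlt_le_trans _ _ _ Hh (Rmin_r _ _)).
  set (k := (phi (t + h)%R - phi t)%C).
  assert (Hk : Cmod k <= (Cmod dp + 1) * Rabs h).
  { replace k with ((k - dp * RtoC h) + dp * RtoC h)%C by ring.
    eapply Rle_trans; [apply Cmod_triangle|]. rewrite Cmod_mult, Cmod_R.
    assert (Rmin e2 1 * Rabs h <= 1 * Rabs h).
    { apply Rmult_le_compat_r; [apply Rabs_pos|apply Rmin_r]. }
    unfold k. lra. }
  assert (Hk1 : Cmod k < d1).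
  { eapply Rle_lt_trans; [exact Hk|].
    apply Rlt_le_trans with ((Cmod dp + 1) * (d1 / (Cmod dp + 1))).
    - apply Rmult_lt_compat_l; lra.
    - right. field. lra. }
  specialize (H1 k Hk1).
  replace (phi t + k)%C with (phi (t + h)%R) in H1 by (unfold k; ring).
  replace (f (phi (t + h)%R) - f (phi t) - df * dp * RtoC h)%C with
    ((f (phi (t + h)%R) - f (phi t) - df * k) + df * (k - dp * RtoC h))%C by ring.
  eapply Rle_trans; [apply Cmod_triangle|]. rewrite Cmod_mult.
  assert (Hh0 := Rabs_pos h).
  assert (e1 * Cmod k <= eps / 2 * Rabs h).
  { apply Rle_trans with (e1 * ((Cmod dp + 1) * Rabs h)).
    - apply Rmult_le_compat_l; lra.
    - right. unfold e1. field. lra. }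
  assert (Cmod df * Cmod (k - dp * RtoC h)%C <= eps / 2 * Rabs h).
  { apply Rle_trans with ((Cmod df + 1) * (e2 * Rabs h)).
    - apply Rmult_le_compat; try apply Cmod_ge_0; try lra.
      eapply Rle_trans; [exact H2|]. apply Rmult_le_compat_r; [lra|apply Rmin_l].
    - right. unfold e2. field. lra. }
  lra.
Qed.

Lemma Rderiv_lin (f g : R -> R) (a b t df dg : R) : is_derive f t df -> is_derive g t dg ->
  is_derive (fun u => a * f u + b * g u) t (a * df + b * dg).
Proof.
  intros Hf Hg.
  apply (is_derive_plus (K := R_AbsRing) (fun u => a * f u) (fun u => b * g u));
  now apply is_derive_scal.
Qed.

(** The mean value theorem fails for complex values, but its inequality follows by
    applying it to the real function t |-> Re (conj d * phi t), where d is the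
    increment to be bounded. *)
Lemma path_deriv_bound (phi dphi : R -> C) (a b M : R) : a <= b ->
  (forall t, a <= t <= b -> path_deriv phi t (dphi t)) ->
  (forall t, a <= t <= b -> Cmod (dphi t) <= M) ->
  Cmod (phi b - phi a)%C <= M * (b - a).
Proof.
  intros Hab Hd HM.
  set (d := (phi b - phi a)%C).
  set (g := fun t => Re d * Re (phi t) + Im d * Im (phi t)).
  set (dg := fun t => Re d * Re (dphi t) + Im d * Im (dphi t)).
  destruct (MVT_gen g a b dg) as [c [Hc E]].
  - rewrite Rmin_left, Rmax_right by lra. intros t Ht. destruct (Hd t) as [H1 H2]; [lra|].
    now apply Rderiv_lin.
  - rewrite Rmin_left, Rmax_right by lra. intros t Ht. destruct (Hd t) as [H1 H2]; [lra|].
    apply derivable_continuous_pt. exists (dg t). rewrite <- is_derive_Reals.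
    now apply Rderiv_lin.
  - rewrite Rmin_left, Rmax_right in Hc by lra.
    assert (E1 : g b - g a = Cmod d ^ 2).
    { rewrite Cmod2_alt. unfold g.
      replace (Re d) with (Re (phi b) - Re (phi a)) by (unfold d; reflexivity).
      replace (Im d) with (Im (phi b) - Im (phi a)) by (unfold d; reflexivity). ring. }
    assert (E2 : dg c <= Cmod d * Cmod (dphi c)).
    { rewrite <- (Cmod_conj d), <- Cmod_mult.
      eapply Rle_trans; [|apply Re_le_Cmod]. eapply Rle_trans; [|apply Rle_abs].
      right. unfold dg, Re, Im, Cconj, Cmult; simpl. ring. }
    specialize (HM c Hc). assert (Hd0 := Cmod_ge_0 d).
    destruct (Req_dec (Cmod d) 0) as [E0|E0].
    + rewrite E0. apply Rmult_le_pos; [|lra]. eapply Rle_trans; [apply Cmod_ge_0|exact HM].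
    + apply Rmult_le_reg_l with (Cmod d); [lra|].
      replace (Cmod d * Cmod d) with (Cmod d ^ 2) by ring.
      rewrite <- E1, E, <- Rmult_assoc. apply Rmult_le_compat_r; [lra|].
      eapply Rle_trans; [exact E2|]. apply Rmult_le_compat_l; lra.
Qed.

Lemma path_deriv_minus (f g : R -> C) (t : R) (df dg : C) :
  path_deriv f t df -> path_deriv g t dg -> path_deriv (fun u => f u - g u)%C t (df - dg)%C.
Proof.
  intros [H1 H2] [H3 H4]. split.
  - apply (is_derive_minus (K := R_AbsRing) (fun u => Re (f u)) (fun u => Re (g u))); assumption.
  - apply (is_derive_minus (K := R_AbsRing) (fun u => Im (f u)) (fun u => Im (g u))); assumption.
Qed.

Lemma path_deriv_line (w : C) (t : R) : path_deriv (fun u => RtoC u * w)%C t w.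
Proof.
  destruct w as [a b].
  split; unfold Re, Im, Cmult, RtoC; simpl; auto_derive; auto; ring.
Qed.

Lemma path_deriv_mult (f g : R -> C) t df dg : path_deriv f t df -> path_deriv g t dg ->
  path_deriv (fun u => f u * g u)%C t (df * g t + f t * dg)%C.
Proof.
  intros [H1 H2] [H3 H4]. split.
  - eapply is_derive_ext; [intros u; symmetry; reflexivity|].
    replace (Re (df * g t + f t * dg)%C) with
      ((Re df * Re (g t) + Re (f t) * Re dg) - (Im df * Im (g t) + Im (f t) * Im dg))
      by (unfold Re, Im, Cplus, Cmult; simpl; ring).
    apply (is_derive_minus (V := R_NormedModule) (fun u => Re (f u) * Re (g u)) (fun u => Im (f
        u) * Im (g u)));
      apply (is_derive_mult (K := R_AbsRing)); try assumption; intros; apply Rmult_comm.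
  - replace (Im (df * g t + f t * dg)%C) with
      ((Re df * Im (g t) + Re (f t) * Im dg) + (Im df * Re (g t) + Im (f t) * Re dg))
      by (unfold Re, Im, Cplus, Cmult; simpl; ring).
    apply (is_derive_plus (V := R_NormedModule) (fun u => Re (f u) * Im (g u)) (fun u => Im (f u)
        * Re (g u)));
      apply (is_derive_mult (K := R_AbsRing)); try assumption; intros; apply Rmult_comm.
Qed.

Lemma path_deriv_const (a : C) t : path_deriv (fun _ => a) t (RtoC 0).
Proof. split; apply (is_derive_const (K := R_AbsRing) (V := R_NormedModule)). Qed.

Lemma path_deriv_eq (f : R -> C) t l l' : path_deriv f t l -> l = l' -> path_deriv f t l'.
Proof. now intros H <-. Qed.

Lemma exp_le_compat (x y : R) : x <= y -> exp x <= exp y.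
Proof. intros [H|H]; [left; now apply exp_increasing|right; now rewrite H]. Qed.

Definition Cexp (z : C) : C := (exp (Re z) * cos (Im z), exp (Re z) * sin (Im z)).

Lemma Cexp_plus (z w : C) : Cexp (z + w)%C = (Cexp z * Cexp w)%C.
Proof.
  destruct z as [a b], w as [c d]. unfold Cexp, Cmult; simpl.
  rewrite exp_plus, cos_plus, sin_plus. f_equal; ring.
Qed.

Lemma Cexp_0 : Cexp 0 = RtoC 1.
Proof. unfold Cexp; simpl. rewrite exp_0, cos_0, sin_0. unfold RtoC. f_equal; ring. Qed.

Lemma Cmod_Cexp (z : C) : Cmod (Cexp z) = exp (Re z).
Proof.
  unfold Cmod, Cexp; simpl fst; simpl snd.
  replace ((exp (Re z) * cos (Im z)) ^ 2 + (exp (Re z) * sin (Im z)) ^ 2)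
    with (Rsqr (exp (Re z)) * (Rsqr (sin (Im z)) + Rsqr (cos (Im z)))) by (unfold Rsqr; ring).
  rewrite sin2_cos2, Rmult_1_r. apply sqrt_Rsqr. left; apply exp_pos.
Qed.

Lemma path_deriv_Cexp_line (w : C) (t : R) :
  path_deriv (fun u => Cexp (RtoC u * w)%C) t (w * Cexp (RtoC t * w))%C.
Proof.
  destruct w as [a b].
  assert (E : forall u, Cexp (RtoC u * (a, b)) = (exp (u * a) * cos (u * b),
      exp (u * a) * sin (u * b))).
  { intros u. unfold Cexp, Cmult, RtoC, Re, Im; simpl.
    replace (u * a - 0 * b) with (u * a) by ring.
    now replace (u * b + 0 * a) with (u * b) by ring. }
  split.
  - apply (is_derive_ext (fun u => exp (u * a) * cos (u * b))); [intros u; now rewrite E|].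
    rewrite E. unfold Re, Cmult; simpl. auto_derive; auto; ring.
  - apply (is_derive_ext (fun u => exp (u * a) * sin (u * b))); [intros u; now rewrite E|].
    rewrite E. unfold Im, Cmult; simpl. auto_derive; auto; ring.
Qed.

Lemma Cexp_sub_1_le (w : C) : Cmod (Cexp w - 1)%C <= Cmod w * exp (Cmod w).
Proof.
  assert (H := path_deriv_bound (fun u => Cexp (RtoC u * w)%C) (fun t => w * Cexp (RtoC t * w))%C
    0 1 (Cmod w * exp (Cmod w))).
  cbv beta in H. replace (RtoC 1 * w)%C with w in H by ring.
  replace (RtoC 0 * w)%C with (RtoC 0) in H by ring. rewrite Cexp_0, Rminus_0_r, Rmult_1_r in H.
  apply H; [lra| |].
  - intros t _. apply path_deriv_Cexp_line.
  - intros t Ht. rewrite Cmod_mult, Cmod_Cexp.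
    apply Rmult_le_compat_l; [apply Cmod_ge_0|].
    apply exp_le_compat. eapply Rle_trans; [apply Rle_abs|].
    eapply Rle_trans; [apply Re_le_Cmod|]. rewrite Cmod_mult, Cmod_R.
    rewrite Rabs_right by lra. assert (H0 := Cmod_ge_0 w). nra.
Qed.

(** The previous bound, integrated once more along the segment from 0 to w. *)
Lemma Cexp_taylor1 (w : C) : Cmod (Cexp w - 1 - w)%C <= Cmod w ^ 2 * exp (Cmod w).
Proof.
  assert (H := path_deriv_bound (fun u => Cexp (RtoC u * w) - RtoC u * w)%C
    (fun t => w * (Cexp (RtoC t * w) - 1))%C
    0 1 (Cmod w ^ 2 * exp (Cmod w))).
  cbv beta in H. replace (RtoC 1 * w)%C with w in H by ring.
  replace (RtoC 0 * w)%C with (RtoC 0) in H by ring. rewrite Cexp_0, Rminus_0_r, Rmult_1_r in H.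
  replace (Cexp w - 1 - w)%C with (Cexp w - w - (1 - 0))%C by ring.
  apply H; [lra| |].
  - intros t _. replace (w * (Cexp (RtoC t * w) - 1))%C with (w * Cexp (RtoC t * w) - w)%C
      by ring.
    apply path_deriv_minus; [apply path_deriv_Cexp_line|apply path_deriv_line].
  - intros t Ht. rewrite Cmod_mult.
    replace (Cmod w ^ 2 * exp (Cmod w)) with (Cmod w * (Cmod w * exp (Cmod w))) by ring.
    apply Rmult_le_compat_l; [apply Cmod_ge_0|].
    eapply Rle_trans; [apply Cexp_sub_1_le|].
    assert (H0 := Cmod_ge_0 w).
    assert (Cmod (RtoC t * w)%C <= Cmod w).
    { rewrite Cmod_mult, Cmod_R. rewrite Rabs_right by lra. nra. }
    apply Rmult_le_compat; try apply Cmod_ge_0; try assumption.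
    + left; apply exp_pos.
    + now apply exp_le_compat.
Qed.

Lemma Cderiv_Cexp (z : C) : Cderiv Cexp z (Cexp z).
Proof.
  apply Cderiv_eps. intros eps He.
  set (M := exp (Re z) * exp 1).
  assert (HM : 0 < M) by (unfold M; apply Rmult_lt_0_compat; apply exp_pos).
  exists (Rmin 1 (eps / M)). split; [apply Rmin_pos; [lra|now apply Rdiv_lt_0_compat]|].
  intros h Hh.
  assert (H1 := Rlt_le_trans _ _ _ Hh (Rmin_l _ _)).
  assert (H2 := Rlt_le_trans _ _ _ Hh (Rmin_r _ _)).
  rewrite Cexp_plus.
  replace (Cexp z * Cexp h - Cexp z - Cexp z * h)%C with (Cexp z * (Cexp h - 1 - h))%C by ring.
  rewrite Cmod_mult, Cmod_Cexp.
  assert (H0 := Cmod_ge_0 h).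
  apply Rle_trans with (exp (Re z) * (Cmod h ^ 2 * exp 1)).
  - apply Rmult_le_compat_l; [left; apply exp_pos|].
    eapply Rle_trans; [apply Cexp_taylor1|]. apply Rmult_le_compat_l; [nra|].
    apply exp_le_compat; lra.
  - replace (exp (Re z) * (Cmod h ^ 2 * exp 1)) with (M * Cmod h * Cmod h) by (unfold M; ring).
    apply Rmult_le_compat_r; [assumption|].
    apply Rle_trans with (M * (eps / M)); [apply Rmult_le_compat_l; lra|].
    right. field. lra.
Qed.

Lemma Cderiv_inv (z : C) : z <> RtoC 0 -> Cderiv Cinv z (- / (z * z))%C.
Proof.
  intros Hz. apply Cderiv_eps. intros eps He.
  assert (H0 : 0 < Cmod z) by now apply Cmod_gt_0.
  set (m := Cmod z) in *.
  exists (Rmin (m / 2) (eps * (m ^ 3 / 2))). split.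
  { apply Rmin_pos; [lra|]. apply Rmult_lt_0_compat; [lra|].
    apply Rdiv_lt_0_compat; [apply pow_lt; lra|lra]. }
  intros h Hh.
  assert (H1 := Rlt_le_trans _ _ _ Hh (Rmin_l _ _)).
  assert (H2 := Rlt_le_trans _ _ _ Hh (Rmin_r _ _)).
  assert (H3 : m / 2 <= Cmod (z + h)%C).
  { assert (T := Cmod_triangle (z + h) (- h)).
    replace (z + h + - h)%C with z in T by ring. rewrite Cmod_opp in T. fold m in T. lra. }
  assert (Hzh : (z + h)%C <> RtoC 0) by (apply Cmod_gt_0; lra).
  replace (/ (z + h) - / z - - / (z * z) * h)%C with (h * h * / (z * z * (z + h)))%C.
  2: { field. split; assumption. }
  assert (Hp : (z * z * (z + h))%C <> RtoC 0) by (repeat apply Cmult_neq_0; assumption).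
  rewrite Cmod_mult, Cmod_inv, !Cmod_mult by assumption. fold m.
  assert (H4 := Cmod_ge_0 h).
  rewrite Rmult_comm, <- Rmult_assoc.
  apply Rmult_le_compat_r; [assumption|].
  assert (H5 : 0 < m * m * Cmod (z + h)) by (repeat apply Rmult_lt_0_compat; lra).
  apply Rmult_le_reg_l with (m * m * Cmod (z + h)); [assumption|].
  rewrite <- Rmult_assoc, Rinv_r, Rmult_1_l by lra.
  apply Rle_trans with (eps * (m ^ 3 / 2)); [lra|].
  replace (m * m * Cmod (z + h) * eps) with (eps * (m * m * Cmod (z + h))) by ring.
  apply Rmult_le_compat_l; [lra|].
  replace (m ^ 3 / 2) with (m * m * (m / 2)) by field.
  apply Rmult_le_compat_l; [nra|assumption].
Qed.

Lemma cpow_Cexp (x : R) (s : C) : cpow x s = Cexp (RtoC (ln x) * s)%C.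
Proof.
  destruct s as [a b]. unfold cpow, Cexp, Rpower, Cmult, RtoC; simpl.
  f_equal; f_equal; f_equal; ring.
Qed.

Lemma Cmod_cpow (x : R) (s : C) : Cmod (cpow x s) = Rpower x (Re s).
Proof.
  rewrite cpow_Cexp, Cmod_Cexp. unfold Rpower. f_equal. unfold Re, Cmult, RtoC; simpl. ring.
Qed.

Lemma cpow_plus x s t : cpow x (s + t)%C = (cpow x s * cpow x t)%C.
Proof. rewrite !cpow_Cexp, <- Cexp_plus. f_equal. ring. Qed.

Lemma cpow_RtoC x r : cpow x (RtoC r) = RtoC (Rpower x r).
Proof.
  unfold cpow, RtoC; cbn [Re Im fst snd]. rewrite Rmult_0_l, cos_0, sin_0. f_equal; ring.
Qed.

Lemma path_deriv_cpow (s : C) (u : R) : 0 < u ->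
  path_deriv (fun v => cpow v s) u (s * cpow u (s - 1))%C.
Proof.
  intros Hu.
  assert (E : (s * cpow u (s - 1) = Cexp (RtoC (ln u) * s) * (RtoC (/ u) * s))%C).
  { unfold Cminus. rewrite cpow_plus, cpow_Cexp.
    replace (- (1))%C with (RtoC (- (1))) by (unfold RtoC, Copp; simpl; f_equal; ring).
    rewrite cpow_RtoC, Rpower_Ropp, Rpower_1 by assumption. ring. }
  rewrite E.
  assert (D : path_deriv (fun v => Cexp (RtoC (ln v) * s)%C) u (Cexp (RtoC (ln u) * s) * (RtoC (/
      u) * s))%C).
  { apply (path_deriv_comp Cexp (fun v => RtoC (ln v) * s)%C); [apply Cderiv_Cexp|].
    destruct s as [a b]. split; unfold Re, Im, Cmult, RtoC; simpl; auto_derive; auto; ring. }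
  destruct D as [D1 D2]. split; eapply is_derive_ext; [|exact D1| |exact D2]; intros t; cbv beta;
    now rewrite cpow_Cexp.
Qed.

Lemma Csub_neq (s t : C) : s <> t -> (s - t)%C <> RtoC 0.
Proof. intros H E. apply H. replace s with (s - t + t)%C by ring. rewrite E. ring. Qed.

Lemma Cdiff_cpow (x : R) (phi : C -> C) (s : C) : Cdiff phi s ->
    Cdiff (fun w => cpow x (phi w)) s.
Proof.
  intros [l Hl].
  exists (RtoC (ln x) * l * Cexp (RtoC (ln x) * phi s))%C.
  apply (is_derive_ext (K := C_AbsRing) (V := AbsRing_NormedModule C_AbsRing) (fun w => Cexp
      (RtoC (ln x) * phi w)%C)).
  { intros t. symmetry. apply cpow_Cexp. }
  assert (D := Cderiv_mult (fun _ => RtoC (ln x)) phi s _ _ (Cderiv_const _ _) Hl).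
  eapply Cderiv_eq; [exact (Cderiv_comp Cexp _ s _ _ (Cderiv_Cexp _) D)|]. cbv beta. ring.
Qed.

(** * Continuity and integrals of complex-valued functions *)

Definition Ccontinuous {U : UniformSpace} (f : U -> C) (t : U) : Prop :=
  continuous (fun u => Re (f u)) t /\ continuous (fun u => Im (f u)) t.

Lemma Rcont_eps (f : R -> R) (t : R) :
  continuous f t <-> forall eps, 0 < eps -> exists delta, 0 < delta /\
    forall u, Rabs (u - t) < delta -> Rabs (f u - f t) < eps.
Proof.
  split.
  - intros H eps He.
    destruct (proj1 (filterlim_locally f (f t)) H (mkposreal eps He)) as [d Hd].
    exists d. split; [apply d|]. intros u Hu. apply (Hd u Hu).
  - intros H. apply filterlim_locally. intros eps. destruct (H eps (cond_pos eps)) as [d [Hd H']].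
    exists (mkposreal d Hd). intros u Hu. apply H'. exact Hu.
Qed.

Lemma Ccontinuous_eps (f : R -> C) (t : R) :
  Ccontinuous f t <-> forall eps, 0 < eps -> exists delta, 0 < delta /\
    forall u, Rabs (u - t) < delta -> Cmod (f u - f t)%C < eps.
Proof.
  split.
  - intros [H1 H2] eps He. rewrite Rcont_eps in H1, H2.
    destruct (H1 (eps / 2)) as [d1 [Hd1 H1']]; [lra|].
    destruct (H2 (eps / 2)) as [d2 [Hd2 H2']]; [lra|].
    exists (Rmin d1 d2). split; [now apply Rmin_pos|]. intros u Hu.
    specialize (H1' u (Rlt_le_trans _ _ _ Hu (Rmin_l _ _))).
    specialize (H2' u (Rlt_le_trans _ _ _ Hu (Rmin_r _ _))).
    eapply Rle_lt_trans; [apply Cmod_le_Re_Im|].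
    change (Rabs (Re (f u) - Re (f t)) + Rabs (Im (f u) - Im (f t)) < eps). lra.
  - intros H. split; apply Rcont_eps; intros eps He; destruct (H eps He) as [d [Hd H']];
      exists d; split; try assumption; intros u Hu; specialize (H' u Hu).
    + eapply Rle_lt_trans; [apply (Re_le_Cmod (f u - f t)%C)|exact H'].
    + eapply Rle_lt_trans; [apply (Im_le_Cmod (f u - f t)%C)|exact H'].
Qed.

Lemma Cdiff_continuous (f : C -> C) (z : C) : Cdiff f z ->
  forall eps, 0 < eps -> exists delta, 0 < delta /\
    forall w, Cmod (w - z)%C < delta -> Cmod (f w - f z)%C < eps.
Proof.
  intros [l H] eps He. rewrite Cderiv_eps in H.
  destruct (H 1 Rlt_0_1) as [d [Hd H']].
  assert (H0 := Cmod_ge_0 l).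
  exists (Rmin d (eps / (Cmod l + 1))). split.
  { apply Rmin_pos; [assumption|apply Rdiv_lt_0_compat; lra]. }
  intros w Hw. specialize (H' _ (Rlt_le_trans _ _ _ Hw (Rmin_l _ _))).
  assert (H2 := Rlt_le_trans _ _ _ Hw (Rmin_r _ _)).
  replace (z + (w - z))%C with w in H' by ring.
  replace (f w - f z)%C with ((f w - f z - l * (w - z)) + l * (w - z))%C by ring.
  eapply Rle_lt_trans; [apply Cmod_triangle|]. rewrite Cmod_mult.
  apply Rle_lt_trans with ((Cmod l + 1) * Cmod (w - z)%C); [lra|].
  apply Rlt_le_trans with ((Cmod l + 1) * (eps / (Cmod l + 1))).
  - apply Rmult_lt_compat_l; lra.
  - right; field; lra.
Qed.

Lemma Ccontinuous_comp (f : C -> C) (phi : R -> C) (t : R) :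
  Cdiff f (phi t) -> Ccontinuous phi t -> Ccontinuous (fun u => f (phi u)) t.
Proof.
  intros Hf Hp. rewrite Ccontinuous_eps in *. intros eps He.
  destruct (Cdiff_continuous f _ Hf eps He) as [d [Hd H]].
  destruct (Hp d Hd) as [d' [Hd' H']]. exists d'. split; [assumption|].
  intros u Hu. apply H, H', Hu.
Qed.

Lemma Ccontinuous_const {U : UniformSpace} (a : C) (t : U) : Ccontinuous (fun _ => a) t.
Proof. split; apply continuous_const. Qed.

Lemma Ccontinuous_RtoC {U : UniformSpace} (f : U -> R) (t : U) : continuous f t ->
    Ccontinuous (fun u => RtoC (f u)) t.
Proof. intros H. split; [exact H|apply continuous_const]. Qed.

Lemma Ccontinuous_plus {U : UniformSpace} (f g : U -> C) (t : U) : Ccontinuous f t ->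
    Ccontinuous g t -> Ccontinuous (fun u => f u + g u)%C t.
Proof.
  intros [H1 H2] [H3 H4]. split.
  - now apply (continuous_plus (fun u => Re (f u)) (fun u => Re (g u))).
  - now apply (continuous_plus (fun u => Im (f u)) (fun u => Im (g u))).
Qed.

Lemma Ccontinuous_opp {U : UniformSpace} (f : U -> C) (t : U) : Ccontinuous f t ->
    Ccontinuous (fun u => - f u)%C t.
Proof.
  intros [H1 H2]. split.
  - now apply (continuous_opp (fun u => Re (f u))).
  - now apply (continuous_opp (fun u => Im (f u))).
Qed.

Lemma Ccontinuous_minus {U : UniformSpace} (f g : U -> C) (t : U) : Ccontinuous f t ->
    Ccontinuous g t -> Ccontinuous (fun u => f u - g u)%C t.
Proof. intros Hf Hg. apply Ccontinuous_plus; [assumption|now apply Ccontinuous_opp]. Qed.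

Lemma Ccontinuous_mult {U : UniformSpace} (f g : U -> C) (t : U) : Ccontinuous f t ->
    Ccontinuous g t -> Ccontinuous (fun u => f u * g u)%C t.
Proof.
  intros [H1 H2] [H3 H4]. split.
  - apply (continuous_minus (fun u => Re (f u) * Re (g u)) (fun u => Im (f u) * Im (g u)));
    now apply (continuous_mult (K := R_AbsRing)).
  - apply (continuous_plus (fun u => Re (f u) * Im (g u)) (fun u => Im (f u) * Re (g u)));
    now apply (continuous_mult (K := R_AbsRing)).
Qed.

Lemma Ccontinuous_pair {U : UniformSpace} (f g : U -> R) (t : U) : continuous f t ->
    continuous g t -> Ccontinuous (fun u => (f u, g u)) t.
Proof. intros Hf Hg. now split. Qed.

Lemma Ccontinuous_comp_R {U : UniformSpace} (h : R -> C) (phi : U -> R) (p : U) :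
  Ccontinuous h (phi p) -> continuous phi p -> Ccontinuous (fun q => h (phi q)) p.
Proof.
  intros [H1 H2] Hp. split.
  - now apply (continuous_comp phi (fun u => Re (h u))).
  - now apply (continuous_comp phi (fun u => Im (h u))).
Qed.

Lemma path_deriv_Ccont (f : R -> C) t l : path_deriv f t l -> Ccontinuous f t.
Proof.
  intros [H1 H2]. split.
  - apply (ex_derive_continuous (fun u => Re (f u))). now exists (Re l).
  - apply (ex_derive_continuous (fun u => Im (f u))). now exists (Im l).
Qed.

Lemma continuous_Cmod (f : R -> C) t : Ccontinuous f t -> continuous (fun u => Cmod (f u)) t.
Proof.
  intros H. rewrite Ccontinuous_eps in H. apply Rcont_eps. intros eps He.
  destruct (H eps He) as [d [Hd H']]. exists d. split; [assumption|].
  intros u Hu. eapply Rle_lt_trans; [|apply (H' u Hu)].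
  assert (T1 := Cmod_triangle (f u - f t) (f t)). assert (T2 := Cmod_triangle (f t - f u) (f u)).
  replace (f u - f t + f t)%C with (f u) in T1 by ring.
  replace (f t - f u + f u)%C with (f t) in T2 by ring.
  replace (f t - f u)%C with (- (f u - f t))%C in T2 by ring. rewrite Cmod_opp in T2.
  apply Rabs_le. lra.
Qed.

Lemma Ccontinuous_Cexp {U : UniformSpace} (f : U -> C) (t : U) :
  Ccontinuous f t -> Ccontinuous (fun u => Cexp (f u)) t.
Proof.
  intros [H1 H2].
  assert (He : forall x, continuous exp x) by (intros x; apply (ex_derive_continuous exp);
    auto_derive; auto).
  assert (Hc : forall x, continuous cos x) by (intros x; apply (ex_derive_continuous cos);
    auto_derive; auto).
  assert (Hs : forall x, continuous sin x) by (intros x; apply (ex_derive_continuous sin);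
    auto_derive; auto).
  split; apply (continuous_mult (K := R_AbsRing));
    (apply (continuous_comp (fun u => Re (f u))) || apply (continuous_comp (fun u => Im (f u))));
      auto.
Qed.

Lemma continuous_Rmult (f g : R -> R) x : continuous f x -> continuous g x ->
    continuous (fun u => f u * g u) x.
Proof. intros; now apply (continuous_mult (K := R_AbsRing) f g). Qed.

Definition Ccontinuous_on (f : R -> C) (a b : R) : Prop := forall t, a <= t <= b ->
    Ccontinuous f t.

(** Componentwise, so that real integration lemmas apply directly to [Re] and [Im];
    [is_RInt_CInt] identifies it with the vector-valued integral. *)
Definition CInt (f : R -> C) (a b : R) : C :=
  (RInt (fun t => Re (f t)) a b, RInt (fun t => Im (f t)) a b).

Lemma ex_RInt_cont (f : R -> R) (a b : R) : a <= b ->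
  (forall t, a <= t <= b -> continuous f t) -> ex_RInt f a b.
Proof.
  intros H Hc. apply (ex_RInt_continuous (V := R_CompleteNormedModule)).
  rewrite Rmin_left, Rmax_right by assumption. exact Hc.
Qed.

Lemma ex_CInt_Re f a b : a <= b -> Ccontinuous_on f a b -> ex_RInt (fun t => Re (f t)) a b.
Proof. intros H Hf. apply ex_RInt_cont; [assumption|]. intros t Ht. apply (Hf t Ht). Qed.

Lemma ex_CInt_Im f a b : a <= b -> Ccontinuous_on f a b -> ex_RInt (fun t => Im (f t)) a b.
Proof. intros H Hf. apply ex_RInt_cont; [assumption|]. intros t Ht. apply (Hf t Ht). Qed.

Lemma is_RInt_CInt f a b : a <= b -> Ccontinuous_on f a b ->
  is_RInt (V := C_R_NormedModule) f a b (CInt f a b).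
Proof.
  intros H Hf. apply (is_RInt_fct_extend_pair (U := R_NormedModule) (V := R_NormedModule)).
  - apply (RInt_correct (V := R_CompleteNormedModule)). now apply ex_CInt_Re.
  - apply (RInt_correct (V := R_CompleteNormedModule)). now apply ex_CInt_Im.
Qed.

Lemma is_RInt_CInt_unique (f : R -> C) a b (l : C) :
  is_RInt (V := C_R_NormedModule) f a b l -> CInt f a b = l.
Proof.
  intros H. unfold CInt. destruct l as [l1 l2]. f_equal.
  - apply is_RInt_unique. apply (is_RInt_fct_extend_fst (U := R_NormedModule) (V :=
        R_NormedModule) f a b _ H).
  - apply is_RInt_unique. apply (is_RInt_fct_extend_snd (U := R_NormedModule) (V :=
        R_NormedModule) f a b _ H).
Qed.

Lemma CInt_ext f g a b : a <= b -> (forall t, a <= t <= b -> f t = g t) ->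
    CInt f a b = CInt g a b.
Proof.
  intros H E. unfold CInt. f_equal; apply RInt_ext; rewrite Rmin_left, Rmax_right by assumption;
    intros t Ht; rewrite E; auto; lra.
Qed.

Lemma RInt_lin (f g : R -> R) (c d a b : R) : ex_RInt f a b -> ex_RInt g a b ->
  RInt (fun t => c * f t + d * g t) a b = c * RInt f a b + d * RInt g a b.
Proof.
  intros Hf Hg.
  assert (H1 := is_RInt_scal (V := R_NormedModule) f a b c _ (RInt_correct (V :=
      R_CompleteNormedModule) f a b Hf)).
  assert (H2 := is_RInt_scal (V := R_NormedModule) g a b d _ (RInt_correct (V :=
      R_CompleteNormedModule) g a b Hg)).
  apply is_RInt_unique, (is_RInt_plus (V := R_NormedModule) _ _ a b _ _ H1 H2).
Qed.

Lemma CInt_Cmult c f a b : a <= b -> Ccontinuous_on f a b ->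
  CInt (fun t => c * f t)%C a b = (c * CInt f a b)%C.
Proof.
  intros H Hf. destruct c as [c d].
  assert (H1 := ex_CInt_Re f a b H Hf). assert (H2 := ex_CInt_Im f a b H Hf).
  unfold CInt, Cmult; simpl. f_equal.
  - replace (c * RInt (fun t => Re (f t)) a b - d * RInt (fun t => Im (f t)) a b)
      with (c * RInt (fun t => Re (f t)) a b + (- d) * RInt (fun t => Im (f t)) a b) by ring.
    rewrite <- RInt_lin by assumption. apply RInt_ext. intros t _.
    match goal with |- ?x = ?y => change (x = y :> R) end. unfold Re, Im; simpl. ring.
  - rewrite <- RInt_lin by assumption. apply RInt_ext. intros t _.
    match goal with |- ?x = ?y => change (x = y :> R) end. unfold Re, Im; simpl. ring.
Qed.

Lemma CInt_minus f g a b : a <= b -> Ccontinuous_on f a b -> Ccontinuous_on g a b ->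
  CInt (fun t => f t - g t)%C a b = (CInt f a b - CInt g a b)%C.
Proof.
  intros H Hf Hg. unfold CInt, Cminus, Copp, Cplus; simpl. f_equal.
  - apply (RInt_minus (V := R_CompleteNormedModule) (fun t => Re (f t)) (fun t => Re (g t)));
      now apply ex_CInt_Re.
  - apply (RInt_minus (V := R_CompleteNormedModule) (fun t => Im (f t)) (fun t => Im (g t)));
      now apply ex_CInt_Im.
Qed.

Lemma CInt_Chasles f a b c : a <= b -> b <= c -> Ccontinuous_on f a c ->
  (CInt f a b + CInt f b c)%C = CInt f a c.
Proof.
  intros H1 H2 Hf. unfold CInt, Cplus; simpl. f_equal.
  - apply (RInt_Chasles (V := R_CompleteNormedModule) (fun t => Re (f t)));
      apply ex_CInt_Re; try assumption; intros t Ht; apply Hf; lra.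
  - apply (RInt_Chasles (V := R_CompleteNormedModule) (fun t => Im (f t)));
      apply ex_CInt_Im; try assumption; intros t Ht; apply Hf; lra.
Qed.

Lemma CInt_norm_le f (g : R -> R) a b : a <= b -> Ccontinuous_on f a b -> ex_RInt g a b ->
  (forall t, a <= t <= b -> Cmod (f t) <= g t) -> Cmod (CInt f a b) <= RInt g a b.
Proof.
  intros H Hf Hg Hle.
  assert (Hle' : forall t, a <= t <= b -> norm (V := C_R_NormedModule) (f t) <= g t).
  { intros t Ht. rewrite <- Cmod_norm. now apply Hle. }
  assert (N := norm_RInt_le (V := C_R_NormedModule) f g a b (CInt f a b) (RInt g a b) H Hle'
    (is_RInt_CInt f a b H Hf) (RInt_correct (V := R_CompleteNormedModule) g a b Hg)).
  now rewrite Cmod_norm.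
Qed.

Lemma CInt_bound f a b M : a <= b -> Ccontinuous_on f a b ->
  (forall t, a <= t <= b -> Cmod (f t) <= M) -> Cmod (CInt f a b) <= M * (b - a).
Proof.
  intros H Hf HM. rewrite Rmult_comm.
  rewrite <- (RInt_const (V := R_CompleteNormedModule) a b M : RInt (fun _ => M) a b
      = (b - a) * M).
  apply CInt_norm_le; auto. apply ex_RInt_const.
Qed.

Lemma CInt_FTC (phi dphi : R -> C) a b : a <= b ->
  (forall t, a <= t <= b -> path_deriv phi t (dphi t)) -> Ccontinuous_on dphi a b ->
  CInt dphi a b = (phi b - phi a)%C.
Proof.
  intros H Hd Hc. unfold CInt, Cminus, Cplus, Copp; simpl. f_equal; apply is_RInt_unique.
  - apply (is_RInt_derive (fun t => Re (phi t)));
      rewrite Rmin_left, Rmax_right by assumption; intros t Ht; [apply Hd|apply Hc]; assumption.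
  - apply (is_RInt_derive (fun t => Im (phi t)));
      rewrite Rmin_left, Rmax_right by assumption; intros t Ht; [apply Hd|apply Hc]; assumption.
Qed.

Lemma CInt_const (c : C) a b : CInt (fun _ => c) a b = (RtoC (b - a) * c)%C.
Proof.
  unfold CInt. rewrite !RInt_const. unfold scal, Cmult, RtoC; simpl. unfold mult; simpl.
  unfold Re, Im. f_equal; ring.
Qed.

Lemma CInt_RtoC (g : R -> R) a b : CInt (fun x => RtoC (g x)) a b = RtoC (RInt g a b).
Proof.
  unfold CInt, RtoC, Re, Im; cbn [fst snd]. f_equal. rewrite RInt_const.
  unfold scal; simpl; unfold mult; simpl. ring.
Qed.

Lemma RInt_split (g : R -> R) (a b c : R) : a <= b -> b <= c ->
  (forall x, a <= x <= c -> continuous g x) -> RInt g a b + RInt g b c = RInt g a c.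
Proof.
  intros H1 H2 Hc. apply (RInt_Chasles (V := R_CompleteNormedModule));
    (apply ex_RInt_cont; [assumption|]; intros; apply Hc; lra).
Qed.

Lemma RInt_nonneg_le (g : R -> R) (a b c : R) : a <= b -> b <= c ->
  (forall x, a <= x <= c -> continuous g x) -> (forall x, a <= x <= c -> 0 <= g x) ->
  RInt g a b <= RInt g a c.
Proof.
  intros H1 H2 Hc Hp.
  rewrite <- (RInt_split g a b c) by assumption.
  assert (0 <= RInt g b c); [|lra].
  apply RInt_ge_0; [assumption| |].
  - apply ex_RInt_cont; [assumption|]. intros; apply Hc; lra.
  - intros; apply Hp; lra.
Qed.

Lemma RInt_bound (f : R -> R) (a b M : R) : a <= b -> (forall t, a <= t <= b -> continuous f t) ->
  (forall t, a <= t <= b -> Rabs (f t) <= M) -> Rabs (RInt f a b) <= M * (b - a).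
Proof.
  intros H Hc HM. rewrite Rmult_comm.
  apply abs_RInt_le_const; [assumption|now apply ex_RInt_cont|assumption].
Qed.

(** * Goursat's theorem for rectangles *)

Lemma Cplus_sub (z w : C) : (z + (w - z))%C = w.
Proof. ring. Qed.

Definition rect_int (f : C -> C) (x0 x1 y0 y1 : R) : C :=
  (CInt (fun x => f (x, y0)) x0 x1 + Ci * CInt (fun y => f (x1, y)) y0 y1
   - CInt (fun x => f (x, y1)) x0 x1 - Ci * CInt (fun y => f (x0, y)) y0 y1)%C.

Lemma path_deriv_horizontal (y t : R) : path_deriv (fun x => (x, y) : C) t (RtoC 1).
Proof. split; unfold Re, Im; simpl; auto_derive; auto. Qed.

Lemma path_deriv_vertical (x t : R) : path_deriv (fun y => (x, y) : C) t Ci.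
Proof. split; unfold Re, Im; simpl; auto_derive; auto. Qed.

Lemma Ccontinuous_horizontal (f : C -> C) (y t : R) : Cdiff f (t, y) ->
    Ccontinuous (fun x => f (x, y)) t.
Proof.
  intros H. apply (Ccontinuous_comp f (fun x => (x, y))); [assumption|].
  eapply path_deriv_Ccont, path_deriv_horizontal.
Qed.

Lemma Ccontinuous_vertical (f : C -> C) (x t : R) : Cdiff f (x, t) ->
    Ccontinuous (fun y => f (x, y)) t.
Proof.
  intros H. apply (Ccontinuous_comp f (fun y => (x, y))); [assumption|].
  eapply path_deriv_Ccont, path_deriv_vertical.
Qed.

Definition Cdiff_rect (f : C -> C) (x0 x1 y0 y1 : R) : Prop :=
  forall x y, x0 <= x <= x1 -> y0 <= y <= y1 -> Cdiff f (x, y).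

Lemma Cdiff_rect_sub f x0 x1 y0 y1 x0' x1' y0' y1' : Cdiff_rect f x0 x1 y0 y1 ->
  x0 <= x0' -> x1' <= x1 -> y0 <= y0' -> y1' <= y1 -> Cdiff_rect f x0' x1' y0' y1'.
Proof. intros H ? ? ? ? x y Hx Hy. apply H; lra. Qed.

Lemma Cdiff_rect_h f x0 x1 y0 y1 y : Cdiff_rect f x0 x1 y0 y1 -> y0 <= y <= y1 ->
  Ccontinuous_on (fun x => f (x, y)) x0 x1.
Proof. intros H Hy t Ht. apply Ccontinuous_horizontal, H; assumption. Qed.

Lemma Cdiff_rect_v f x0 x1 y0 y1 x : Cdiff_rect f x0 x1 y0 y1 -> x0 <= x <= x1 ->
  Ccontinuous_on (fun y => f (x, y)) y0 y1.
Proof. intros H Hx t Ht. apply Ccontinuous_vertical, H; assumption. Qed.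

Lemma rect_int_minus f g x0 x1 y0 y1 : x0 <= x1 -> y0 <= y1 ->
  Cdiff_rect f x0 x1 y0 y1 -> Cdiff_rect g x0 x1 y0 y1 ->
  rect_int (fun z => f z - g z)%C x0 x1 y0 y1
      = (rect_int f x0 x1 y0 y1 - rect_int g x0 x1 y0 y1)%C.
Proof.
  intros Hx Hy Hf Hg. unfold rect_int.
  rewrite !CInt_minus; try assumption.
  - ring.
  - apply (Cdiff_rect_v _ _ _ _ _ x0 Hf); lra.
  - apply (Cdiff_rect_v _ _ _ _ _ x0 Hg); lra.
  - apply (Cdiff_rect_h _ _ _ _ _ y1 Hf); lra.
  - apply (Cdiff_rect_h _ _ _ _ _ y1 Hg); lra.
  - apply (Cdiff_rect_v _ _ _ _ _ x1 Hf); lra.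
  - apply (Cdiff_rect_v _ _ _ _ _ x1 Hg); lra.
  - apply (Cdiff_rect_h _ _ _ _ _ y0 Hf); lra.
  - apply (Cdiff_rect_h _ _ _ _ _ y0 Hg); lra.
Qed.

Lemma rect_int_split f x0 xm x1 y0 ym y1 : x0 <= xm <= x1 -> y0 <= ym <= y1 ->
  Cdiff_rect f x0 x1 y0 y1 ->
  rect_int f x0 x1 y0 y1 =
    (rect_int f x0 xm y0 ym + rect_int f xm x1 y0 ym
     + rect_int f x0 xm ym y1 + rect_int f xm x1 ym y1)%C.
Proof.
  intros Hx Hy H. unfold rect_int.
  rewrite <- (CInt_Chasles (fun x => f (x, y0)) x0 xm x1), <- (CInt_Chasles (fun x => f (x,
      y1)) x0 xm x1),
    <- (CInt_Chasles (fun y => f (x0, y)) y0 ym y1), <- (CInt_Chasles (fun y => f (x1,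
        y)) y0 ym y1);
    try lra; try (apply (Cdiff_rect_h _ _ _ _ _ _ H); lra);
      try (apply (Cdiff_rect_v _ _ _ _ _ _ H); lra).
  ring.
Qed.

Lemma rect_int_primitive (G f : C -> C) x0 x1 y0 y1 : x0 <= x1 -> y0 <= y1 ->
  (forall z, Cderiv G z (f z)) -> (forall z, Cdiff f z) -> rect_int f x0 x1 y0 y1 = RtoC 0.
Proof.
  intros Hx Hy HG Hf.
  assert (Hh : forall y, CInt (fun x => f (x, y)) x0 x1 = (G (x1, y) - G (x0, y))%C).
  { intros y. apply (CInt_FTC (fun x => G (x, y))); [assumption| |].
    - intros t _. replace (f (t, y)) with (f (t, y) * 1)%C by ring.
      apply (path_deriv_comp G (fun x => (x, y))); [apply HG|apply path_deriv_horizontal].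
    - intros t _. now apply Ccontinuous_horizontal. }
  assert (Hv : forall x, (Ci * CInt (fun y => f (x, y)) y0 y1 = G (x, y1) - G (x, y0))%C).
  { intros x. rewrite <- CInt_Cmult; [|assumption|].
    - apply (CInt_FTC (fun y => G (x, y))); [assumption| |].
      + intros t _. rewrite Cmult_comm.
        apply (path_deriv_comp G (fun y => (x, y))); [apply HG|apply path_deriv_vertical].
      + intros t _. apply Ccontinuous_mult;
          [apply Ccontinuous_const|now apply Ccontinuous_vertical].
    - intros t _. now apply Ccontinuous_vertical. }
  unfold rect_int. rewrite !Hh, !Hv. ring.
Qed.

Lemma rect_int_affine (a b : C) x0 x1 y0 y1 : x0 <= x1 -> y0 <= y1 ->
  rect_int (fun z => a + b * z)%C x0 x1 y0 y1 = RtoC 0.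
Proof.
  intros Hx Hy. apply (rect_int_primitive (fun z => a * z + b / 2 * (z * z))%C); try assumption.
  - intros z. eapply Cderiv_eq.
    + cderiv.
    + cbv beta. field.
  - intros z. eexists. cderiv.
Qed.

Lemma rect_int_bound f x0 x1 y0 y1 M : x0 <= x1 -> y0 <= y1 -> Cdiff_rect f x0 x1 y0 y1 ->
  (forall x y, x0 <= x <= x1 -> y0 <= y <= y1 -> Cmod (f (x, y)) <= M) ->
  Cmod (rect_int f x0 x1 y0 y1) <= 2 * M * ((x1 - x0) + (y1 - y0)).
Proof.
  intros Hx Hy Hf HM. unfold rect_int, Cminus.
  assert (Hh : forall y, y0 <= y <= y1 -> Cmod (CInt (fun x => f (x, y)) x0 x1) <= M * (x1 - x0)).
  { intros y Hy'. apply CInt_bound; [assumption|apply (Cdiff_rect_h _ _ _ _ _ _ Hf); lra|].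
    intros; now apply HM. }
  assert (Hv : forall x, x0 <= x <= x1 ->
      Cmod (Ci * CInt (fun y => f (x, y)) y0 y1) <= M * (y1 - y0)).
  { intros x Hx'. rewrite Cmod_mult, Cmod_Ci, Rmult_1_l.
    apply CInt_bound; [assumption|apply (Cdiff_rect_v _ _ _ _ _ _ Hf); lra|].
    intros; now apply HM. }
  eapply Rle_trans; [apply Cmod_triangle|]. rewrite Cmod_opp.
  assert (H1 := Hv x0 ltac:(lra)).
  eapply Rle_trans; [apply Rplus_le_compat; [apply Cmod_triangle|exact H1]|]. rewrite Cmod_opp.
  assert (H2 := Hh y1 ltac:(lra)).
  assert (H3 := Hh y0 ltac:(lra)).
  assert (H4 := Hv x1 ltac:(lra)).
  assert (H5 := Cmod_triangle (CInt (fun x => f (x, y0)) x0 x1) (Ci * CInt (fun y => f (x1,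
      y)) y0 y1)).
  lra.
Qed.

Lemma half_pow (a : R) n : a / 2 ^ n = a / 2 ^ S n + a / 2 ^ S n.
Proof. simpl. field. apply pow_nonzero. lra. Qed.

Lemma div_pow_pos (a : R) n : 0 <= a -> 0 <= a / 2 ^ n.
Proof.
  intros H. apply Rmult_le_pos; [assumption|]. left. apply Rinv_0_lt_compat, pow_lt. lra.
Qed.

Lemma nested_intervals_point (u l : nat -> R) :
  (forall n m, u n <= u (n + m)%nat /\ u (n + m)%nat + l (n + m)%nat <= u n + l n) ->
  (forall n, 0 <= l n) -> exists x, forall n, u n <= x <= u n + l n.
Proof.
  intros H Hl.
  assert (K : forall n m, u n <= u m + l m).
  { intros n m. destruct (Nat.le_ge_cases n m) as [L|L].
    - replace m with (n + (m - n))%nat by lia. assert (A := H n (m - n)%nat).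
      assert (B := Hl (n + (m - n))%nat). lra.
    - replace n with (m + (n - m))%nat by lia. assert (A := H m (n - m)%nat).
      assert (B := Hl (m + (n - m))%nat). lra. }
  destruct (completeness (fun x => exists n, x = u n)) as [x [Hx1 Hx2]].
  - exists (u 0%nat + l 0%nat). intros x [n ->]. apply K.
  - exists (u 0%nat). now exists 0%nat.
  - exists x. intros n. split.
    + apply Hx1. now exists n.
    + apply Hx2. intros y [m ->]. apply K.
Qed.

Lemma pow2_unbounded (a d : R) : 0 <= a -> 0 < d -> exists n, a / 2 ^ n < d.
Proof.
  intros Ha Hd. destruct (pow_lt_1_zero (/ 2)) with (y := d / (a + 1)) as [N HN].
  - rewrite Rabs_right; lra.
  - apply Rdiv_lt_0_compat; lra.
  - exists N. specialize (HN N (le_n N)). rewrite pow_inv in HN.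
    rewrite Rabs_right in HN.
    2:{ apply Rle_ge. left. apply Rinv_0_lt_compat, pow_lt. lra. }
    apply Rle_lt_trans with ((a + 1) * / 2 ^ N).
    + apply Rmult_le_compat_r; [left; apply Rinv_0_lt_compat, pow_lt|]; lra.
    + apply Rlt_le_trans with ((a + 1) * (d / (a + 1))); [apply Rmult_lt_compat_l; lra|].
      right; field; lra.
Qed.

Section Goursat.
Variables (f : C -> C) (x0 y0 w h : R).
Hypothesis Hw : 0 <= w.
Hypothesis Hh : 0 <= h.
Hypothesis Hf : Cdiff_rect f x0 (x0 + w) y0 (y0 + h).

Definition dyadic_norm (n : nat) (x y : R) : R :=
  Cmod (rect_int f x (x + w / 2 ^ n) y (y + h / 2 ^ n)).

(** Passes to a quarter whose boundary integral is at least a quarter of the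
    given one; the last branch needs no test, by [rect_int_split]. *)
Definition bisect (n : nat) (p : R * R) : R * R :=
  let (x, y) := p in
  let x' := x + w / 2 ^ S n in
  let y' := y + h / 2 ^ S n in
  let good u v := Rle_dec (dyadic_norm n x y / 4) (dyadic_norm (S n) u v) in
  if good x y then (x, y) else if good x' y then (x', y)
  else if good x y' then (x, y') else (x', y').

Fixpoint corner (n : nat) : R * R :=
  match n with O => (x0, y0) | S m => bisect m (corner m) end.

Definition inside (n : nat) (p : R * R) : Prop :=
  x0 <= fst p /\ fst p + w / 2 ^ n <= x0 + w /\ y0 <= snd p /\ snd p + h / 2 ^ n <= y0 + h.

Lemma bisect_spec n p : inside n p ->
  let q := bisect n p in
  inside (S n) q /\
  fst p <= fst q /\ fst q + w / 2 ^ S n <= fst p + w / 2 ^ n /\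
  snd p <= snd q /\ snd q + h / 2 ^ S n <= snd p + h / 2 ^ n /\
  dyadic_norm n (fst p) (snd p) / 4 <= dyadic_norm (S n) (fst q) (snd q).
Proof.
  destruct p as [x y]. unfold inside. cbn [fst snd]. intros (I1 & I2 & I3 & I4).
  assert (Ew := half_pow w n). assert (Eh := half_pow h n).
  assert (Pw := div_pow_pos w (S n) Hw). assert (Ph := div_pow_pos h (S n) Hh).
  assert (S4 : dyadic_norm n x y <= dyadic_norm (S n) x y + dyadic_norm (S n) (x + w / 2 ^ S n) y
     + dyadic_norm (S n) x (y + h / 2 ^ S n) + dyadic_norm (S n) (x + w / 2 ^ S n) (y + h / 2 ^ S
           n)).
  { unfold dyadic_norm.
    rewrite (rect_int_split f x (x + w / 2 ^ S n) _ y (y + h / 2 ^ S n)); try lra.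
    2: apply (Cdiff_rect_sub _ _ _ _ _ _ _ _ _ Hf); lra.
    replace (x + w / 2 ^ n) with (x + w / 2 ^ S n + w / 2 ^ S n) by lra.
    replace (y + h / 2 ^ n) with (y + h / 2 ^ S n + h / 2 ^ S n) by lra.
    repeat (eapply Rle_trans; [apply Cmod_triangle|apply Rplus_le_compat_r]). apply Rle_refl. }
  unfold bisect.
  destruct (Rle_dec _ _); [|destruct (Rle_dec _ _); [|destruct (Rle_dec _ _)]];
    cbn [fst snd]; repeat split; try lra.
Qed.

Lemma corner_inside n : inside n (corner n).
Proof.
  induction n as [|n IH].
  - unfold inside; simpl. lra.
  - apply (bisect_spec n (corner n) IH).
Qed.

Lemma corner_nested n m :
  fst (corner n) <= fst (corner (n + m)) /\
  fst (corner (n + m)) + w / 2 ^ (n + m) <= fst (corner n) + w / 2 ^ n /\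
  snd (corner n) <= snd (corner (n + m)) /\
  snd (corner (n + m)) + h / 2 ^ (n + m) <= snd (corner n) + h / 2 ^ n.
Proof.
  induction m as [|m IH].
  - rewrite Nat.add_0_r. lra.
  - rewrite Nat.add_succ_r.
    assert (B := bisect_spec (n + m) (corner (n + m)) (corner_inside _)).
    change (bisect (n + m) (corner (n + m))) with (corner (S (n + m))) in B. cbv zeta in B. lra.
Qed.

Lemma corner_large n : dyadic_norm 0 x0 y0 / 4 ^ n
    <= dyadic_norm n (fst (corner n)) (snd (corner n)).
Proof.
  induction n as [|n IH].
  - simpl. lra.
  - assert (B := bisect_spec n (corner n) (corner_inside _)).
    change (bisect n (corner n)) with (corner (S n)) in B. cbv zeta in B.
    eapply Rle_trans; [|apply B].
    replace (dyadic_norm 0 x0 y0 / 4 ^ S n) with (dyadic_norm 0 x0 y0 / 4 ^ n / 4); [lra|].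
    simpl. field. apply pow_nonzero. lra.
Qed.

(** At the common point of the nested rectangles f is affine up to eps |z - p|,
    and affine functions have boundary integral 0; so the n-th integral is at most a
    constant times eps 4^(-n), while it is at least 4^(-n)
    times the first. *)
Lemma dyadic_norm_le (eps : R) : 0 < eps -> dyadic_norm 0 x0 y0 <= eps * (2 * (w + h) ^ 2).
Proof.
  intros He.
  destruct (nested_intervals_point (fun n => fst (corner n)) (fun n => w / 2 ^ n)) as [X HX].
  { intros n m. split; apply corner_nested. }
  { intros n; now apply div_pow_pos. }
  destruct (nested_intervals_point (fun n => snd (corner n)) (fun n => h / 2 ^ n)) as [Y HY].
  { intros n m. split; apply corner_nested. }
  { intros n; now apply div_pow_pos. }
  destruct (Hf X Y) as [l Hl].
  { specialize (HX 0%nat). simpl in HX. lra. }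
  { specialize (HY 0%nat). simpl in HY. lra. }
  rewrite Cderiv_eps in Hl. destruct (Hl eps He) as [d [Hd Hd']].
  destruct (pow2_unbounded (w + h) d) as [n Hn]; [lra|assumption|].
  assert (HL := corner_large n). specialize (HX n). specialize (HY n).
  assert (I := corner_inside n). destruct (corner n) as [x y]. unfold inside in I.
  cbn [fst snd] in *.
  assert (Pw := div_pow_pos w n Hw). assert (Ph := div_pow_pos h n Hh).
  set (a := (f (X, Y) - l * (X, Y))%C).
  assert (Haff : forall u1 u2 v1 v2, Cdiff_rect (fun z => a + l * z)%C u1 u2 v1 v2).
  { intros u1 u2 v1 v2 u v _ _. eexists. cderiv. }
  assert (Hsub : Cdiff_rect f x (x + w / 2 ^ n) y (y + h / 2 ^ n)).
  { apply (Cdiff_rect_sub _ _ _ _ _ _ _ _ _ Hf); lra. }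
  assert (E : rect_int f x (x + w / 2 ^ n) y (y + h / 2 ^ n) =
     rect_int (fun z => f z - (a + l * z))%C x (x + w / 2 ^ n) y (y + h / 2 ^ n)).
  { rewrite rect_int_minus; try lra; auto. rewrite rect_int_affine; try lra. ring. }
  assert (B : dyadic_norm n x y <= 2 * (eps * ((w + h) / 2 ^ n)) * ((w + h) / 2 ^ n)).
  { unfold dyadic_norm. rewrite E.
    eapply Rle_trans; [apply rect_int_bound with (M := eps * ((w + h) / 2 ^ n)); try lra|].
    - intros u v Hu Hv. destruct (Hsub u v Hu Hv) as [df Hdf]. eexists.
      refine (Cderiv_minus f _ _ _ _ Hdf _). cderiv.
    - intros u v Hu Hv.
      assert (Hk : Cmod ((u, v) - (X, Y))%C <= (w + h) / 2 ^ n).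
      { eapply Rle_trans; [apply Cmod_le_Re_Im|].
        replace ((w + h) / 2 ^ n) with (w / 2 ^ n + h / 2 ^ n) by (unfold Rdiv; ring).
        change (Rabs (u - X) + Rabs (v - Y) <= w / 2 ^ n + h / 2 ^ n).
        apply Rplus_le_compat; apply Rabs_le; lra. }
      specialize (Hd' ((u, v) - (X, Y))%C (Rle_lt_trans _ _ _ Hk Hn)).
      replace ((X, Y) + ((u, v) - (X, Y)))%C with ((u, v) : C) in Hd'
        by (symmetry; apply (Cplus_sub (X, Y) (u, v))).
      replace (f (u, v) - (a + l * (u, v)))%C with (f (u, v) - f (X, Y) - l * ((u, v) - (X, Y)))%C
        by (unfold a; generalize ((u, v) : C) ((X, Y) : C); intros; ring).
      eapply Rle_trans; [exact Hd'|]. apply Rmult_le_compat_l; lra.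
    - right. field. apply pow_nonzero; lra. }
  assert (P4 : 0 < 4 ^ n) by (apply pow_lt; lra).
  assert (P2 : 4 ^ n = 2 ^ n * 2 ^ n) by (rewrite <- Rpow_mult_distr; f_equal; lra).
  assert (P3 : 0 < 2 ^ n) by (apply pow_lt; lra).
  apply Rmult_le_reg_r with (/ 4 ^ n); [now apply Rinv_0_lt_compat|].
  eapply Rle_trans; [exact HL|]. eapply Rle_trans; [exact B|]. right. rewrite P2. field. lra.
Qed.

End Goursat.

Theorem goursat_rectangle (f : C -> C) (x0 x1 y0 y1 : R) : x0 <= x1 -> y0 <= y1 ->
  Cdiff_rect f x0 x1 y0 y1 -> rect_int f x0 x1 y0 y1 = RtoC 0.
Proof.
  intros Hx Hy Hf. apply Cmod_eq_0. apply Rle_antisym; [|apply Cmod_ge_0].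
  set (w := x1 - x0). set (h := y1 - y0).
  replace x1 with (x0 + w) in Hf |- * by (unfold w; ring).
  replace y1 with (y0 + h) in Hf |- * by (unfold h; ring).
  assert (Hw : 0 <= w) by (unfold w; lra). assert (Hh : 0 <= h) by (unfold h; lra).
  apply Rnot_lt_le. intros Hpos.
  set (m := Cmod (rect_int f x0 (x0 + w) y0 (y0 + h))) in *.
  assert (Hk : 0 <= (w + h) ^ 2) by apply pow2_ge_0.
  assert (A := dyadic_norm_le f x0 y0 w h Hw Hh Hf (m / (4 * ((w + h) ^ 2 + 1)))).
  unfold dyadic_norm in A. simpl pow at 1 in A. rewrite !Rdiv_1_r in A. fold m in A.
  assert (B : m <= m / (4 * ((w + h) ^ 2 + 1)) * (2 * (w + h) ^ 2)).
  { apply A. apply Rdiv_lt_0_compat; lra. }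
  assert (D : m / (4 * ((w + h) ^ 2 + 1)) * (2 * (w + h) ^ 2) <= m / 2).
  { apply Rle_trans with (m / (4 * ((w + h) ^ 2 + 1)) * (2 * ((w + h) ^ 2 + 1))).
    - apply Rmult_le_compat_l; [|lra]. apply Rlt_le, Rdiv_lt_0_compat; lra.
    - right. field. lra. }
  lra.
Qed.

(** * Fourier coefficients on circles *)

Definition cis (t : R) : C := Cexp (0, t).

Definition circ (a : C) (rho theta : R) : C := (a + RtoC rho * cis theta)%C.

Definition circle_coef (f : C -> C) (a : C) (n : nat) (rho : R) : C :=
  CInt (fun theta => f (circ a rho theta) * cis (- INR n * theta))%C 0 (2 * PI).

Lemma Cmod_cis (t : R) : Cmod (cis t) = 1.
Proof. unfold cis. rewrite Cmod_Cexp. apply exp_0. Qed.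

Lemma Cmod_circ (a : C) rho theta : 0 <= rho -> Cmod (circ a rho theta - a)%C = rho.
Proof.
  intros H. unfold circ. replace (a + RtoC rho * cis theta - a)%C with (RtoC rho * cis theta)%C
      by ring.
  rewrite Cmod_mult, Cmod_cis, Cmod_R, Rabs_right; lra.
Qed.

Lemma Cexp_2PI (x : R) (n : nat) : Cexp (x, - INR n * (2 * PI)) = Cexp (x, 0).
Proof.
  unfold Cexp; cbn [Re Im fst snd].
  replace (- INR n * (2 * PI)) with (- (0 + 2 * INR n * PI)) by ring.
  rewrite cos_neg, sin_neg, cos_period, sin_period, sin_0. f_equal; ring.
Qed.

Lemma Cexp_ln (rho theta : R) : 0 < rho -> Cexp (ln rho, theta) = (RtoC rho * cis theta)%C.
Proof.
  intros H. unfold cis, Cexp, RtoC, Cmult, Re, Im; simpl. rewrite exp_ln, exp_0 by assumption.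
  f_equal; ring.
Qed.

Lemma Ccontinuous_circ a rho t : Ccontinuous (circ a rho) t.
Proof.
  apply Ccontinuous_plus; [apply Ccontinuous_const|].
  apply Ccontinuous_mult; [apply Ccontinuous_const|].
  unfold cis. apply Ccontinuous_Cexp. eapply path_deriv_Ccont, path_deriv_vertical.
Qed.

Lemma Ccontinuous_cis (k : R) t : Ccontinuous (fun u => cis (k * u)) t.
Proof.
  unfold cis. apply Ccontinuous_Cexp, Ccontinuous_pair; [apply continuous_const|].
  apply (continuous_scal_r (K := R_AbsRing) (V := R_NormedModule) k (fun u => u)), continuous_id.
Qed.

(** In the coordinate w with z = a + e^w this is Goursat's theorem for
    f(a + e^w) e^(-nw) on [ln r1, ln r2] x [0, 2 pi]: the function has period
    2 pi i, so the horizontal sides cancel. *)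
Lemma circle_coef_scaling (f : C -> C) (a : C) (n : nat) (r1 r2 rho : R) :
  0 < r1 -> r1 <= r2 -> r2 < rho ->
  (forall z, Cmod (z - a)%C < rho -> Cdiff f z) ->
  (RtoC (r1 ^ n) * circle_coef f a n r2 = RtoC (r2 ^ n) * circle_coef f a n r1)%C.
Proof.
  intros H1 H2 H3 Hf.
  assert (HP := PI_RGT_0).
  assert (HL : ln r1 <= ln r2). { destruct H2 as [H2|H2]; [left; now apply ln_increasing|right;
    now rewrite H2]. }
  set (g := fun w => (f (a + Cexp w) * Cexp (RtoC (- INR n) * w))%C).
  assert (Hg : Cdiff_rect g (ln r1) (ln r2) 0 (2 * PI)).
  { intros x y Hx Hy. unfold g. apply Cdiff_mult.
    - apply (Cdiff_comp f (fun w => a + Cexp w)%C).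
      + apply Hf. replace (a + Cexp (x, y) - a)%C with (Cexp (x, y)) by ring.
        rewrite Cmod_Cexp. cbn [Re fst]. apply Rle_lt_trans with r2; [|assumption].
        rewrite <- (exp_ln r2) by lra. apply exp_le_compat. lra.
      + eexists. refine (Cderiv_plus (fun _ => a) Cexp _ _ _ (Cderiv_const _ _) (Cderiv_Cexp _)).
    - apply (Cdiff_comp Cexp (fun w => RtoC (- INR n) * w)%C).
      + eexists. apply Cderiv_Cexp.
      + eexists. cderiv. }
  assert (G := goursat_rectangle g (ln r1) (ln r2) 0 (2 * PI) HL ltac:(lra) Hg).
  assert (Eg : forall r t, 0 < r ->
      g (ln r, t) = (RtoC (/ r ^ n) * (f (circ a r t) * cis (- INR n * t)))%C).
  { intros r t Hr. unfold g. rewrite Cexp_ln by assumption. fold (circ a r t).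
    assert (E : Cexp (RtoC (- INR n) * (ln r, t)) = (RtoC (/ r ^ n) * cis (- INR n * t))%C).
    { replace (RtoC (- INR n) * (ln r, t))%C with ((ln (/ r ^ n), (- INR n * t)%R) : C).
      - apply Cexp_ln. apply Rinv_0_lt_compat, pow_lt, Hr.
      - rewrite ln_Rinv by now apply pow_lt. rewrite ln_pow by assumption.
        unfold Cmult, RtoC; simpl. f_equal; ring. }
    rewrite E. ring. }
  assert (Eper : forall x, g (x, 2 * PI) = g (x, 0)).
  { intros x. unfold g. f_equal.
    - f_equal. f_equal. unfold Cexp, Re, Im; simpl. now rewrite cos_2PI, sin_2PI, cos_0, sin_0.
    - replace (RtoC (- INR n) * (x, (2 * PI)%R))%C with ((- INR n * x, - INR n * (2 * PI))%R : C)
        by (unfold Cmult, RtoC; simpl; f_equal; ring).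
      replace (RtoC (- INR n) * (x, 0%R))%C with ((- INR n * x, 0)%R : C)
        by (unfold Cmult, RtoC; simpl; f_equal; ring).
      apply Cexp_2PI. }
  unfold rect_int in G.
  rewrite (CInt_ext (fun x => g (x, 2 * PI)) (fun x => g (x, 0))) in G by (auto; lra).
  assert (Hc : forall r, 0 < r -> r < rho ->
     Ccontinuous_on (fun t => f (circ a r t) * cis (- INR n * t))%C 0 (2 * PI)).
  { intros r Hr Hr' t _. apply Ccontinuous_mult; [|apply Ccontinuous_cis].
    apply Ccontinuous_comp; [|apply Ccontinuous_circ]. apply Hf. rewrite Cmod_circ; lra. }
  assert (EI : forall r, 0 < r -> r < rho ->
      CInt (fun y => g (ln r, y)) 0 (2 * PI) = (RtoC (/ r ^ n) * circle_coef f a n r)%C).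
  { intros r Hr Hr'. unfold circle_coef. rewrite <- CInt_Cmult; [|lra|now apply Hc].
    apply CInt_ext; [lra|]. intros t _. now apply Eg. }
  rewrite !EI in G by lra.
  assert (G2 : (RtoC (/ r2 ^ n) * circle_coef f a n r2
      = RtoC (/ r1 ^ n) * circle_coef f a n r1)%C).
  { set (X := CInt (fun x : R => g (x, 0)) (ln r1) (ln r2)) in G.
    transitivity (- Ci * (X + Ci * (RtoC (/ r2 ^ n) * circle_coef f a n r2) - X -
      Ci * (RtoC (/ r1 ^ n) * circle_coef f a n r1)) + RtoC (/ r1 ^ n) * circle_coef f a n r1)%C.
    - assert (Ci * Ci = - (1))%C by (unfold Ci, RtoC, Cmult, Copp; simpl; f_equal; ring).
      ring_simplify. replace (Ci ^ 2)%C with (- (1))%C by (rewrite <- H; ring). ring.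
    - rewrite G. ring. }
  assert (P1 : 0 < r1 ^ n) by (apply pow_lt; lra).
  assert (P2 : 0 < r2 ^ n) by (apply pow_lt; lra).
  assert (N1 : RtoC (r1 ^ n) <> RtoC 0). { intros E; apply RtoC_inj in E; lra. }
  assert (N2 : RtoC (r2 ^ n) <> RtoC 0). { intros E; apply RtoC_inj in E; lra. }
  rewrite !RtoC_inv in G2 by lra.
  apply (f_equal (fun z => (RtoC (r1 ^ n) * RtoC (r2 ^ n) * z)%C)) in G2.
  transitivity (RtoC (r1 ^ n) * RtoC (r2 ^ n) * (/ RtoC (r2 ^ n) * circle_coef f a n r2))%C.
  - field. exact N2.
  - rewrite G2. field. exact N1.
Qed.

Lemma circle_coef_bound f a n r M : 0 <= r ->
  (forall t, Cdiff f (circ a r t)) ->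
  (forall t, 0 <= t <= 2 * PI -> Cmod (f (circ a r t)) <= M) ->
  Cmod (circle_coef f a n r) <= M * (2 * PI).
Proof.
  intros Hr Hf HM. assert (HP := PI_RGT_0).
  replace (M * (2 * PI)) with (M * (2 * PI - 0)) by ring.
  apply CInt_bound; [lra| |].
  - intros t _. apply Ccontinuous_mult; [|apply Ccontinuous_cis].
    apply Ccontinuous_comp; [apply Hf|apply Ccontinuous_circ].
  - intros t Ht. rewrite Cmod_mult, Cmod_cis, Rmult_1_r. now apply HM.
Qed.

Lemma circle_sup (f : C -> C) (a : C) (r : R) : (forall t, Cdiff f (circ a r t)) ->
  exists M, 0 <= M /\ forall t, 0 <= t <= 2 * PI -> Cmod (f (circ a r t)) <= M.
Proof.
  intros Hf. assert (HP := PI_RGT_0).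
  destruct (continuity_ab_maj (fun t => Cmod (f (circ a r t))) 0 (2 * PI) ltac:(lra))
    as [x [Hx _]].
  { intros t _. apply continuity_pt_filterlim.
    apply continuous_Cmod, Ccontinuous_comp; [apply Hf|apply Ccontinuous_circ]. }
  exists (Cmod (f (circ a r x))). split; [apply Cmod_ge_0|exact Hx].
Qed.

(** By [circle_coef_scaling] with n = 0 the mean does not depend on the radius;
    let the radius tend to 0. *)
Theorem circle_mean_value (f : C -> C) (a : C) (r rho : R) :
  0 < r < rho -> (forall z, Cmod (z - a)%C < rho -> Cdiff f z) ->
  CInt (fun t => f (circ a r t)) 0 (2 * PI) = (RtoC (2 * PI) * f a)%C.
Proof.
  intros Hr Hf. assert (HP := PI_RGT_0).
  assert (E0 : forall s, circle_coef f a 0 s = CInt (fun t => f (circ a s t)) 0 (2 * PI)).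
  { intros s. apply CInt_ext; [lra|]. intros t _. simpl.
    replace (- 0 * t) with 0 by ring. unfold cis. change ((0, 0) : C) with (RtoC 0).
    rewrite Cexp_0. ring. }
  rewrite <- E0.
  set (d := (circle_coef f a 0 r - RtoC (2 * PI) * f a)%C).
  assert (Hd : forall eps, 0 < eps -> Cmod d <= eps * (2 * PI)).
  { intros eps He.
    destruct (Cdiff_continuous f a (Hf a ltac:(replace (a - a)%C with (RtoC 0) by ring;
      rewrite Cmod_0; lra)) eps He) as [dl [Hdl Hc]].
    set (s := Rmin (dl / 2) r).
    assert (Hs : 0 < s) by (apply Rmin_pos; lra).
    assert (Hs1 : s <= dl / 2) by apply Rmin_l. assert (Hs2 : s <= r) by apply Rmin_r.
    assert (S := circle_coef_scaling f a 0 s r rho Hs Hs2 ltac:(lra) Hf).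
    simpl in S. rewrite !Cmult_1_l in S.
    unfold d. rewrite S, E0.
    replace (RtoC (2 * PI) * f a)%C with (CInt (fun _ => f a) 0 (2 * PI)).
    2:{ rewrite CInt_const. now rewrite Rminus_0_r. }
    assert (Cc : Ccontinuous_on (fun t => f (circ a s t)) 0 (2 * PI)).
    { intros t _. apply Ccontinuous_comp; [|apply Ccontinuous_circ]. apply Hf.
      rewrite Cmod_circ; lra. }
    assert (Ck : Ccontinuous_on (fun _ => f a) 0 (2 * PI)) by (intros t _;
      apply Ccontinuous_const).
    rewrite <- CInt_minus by (assumption || lra).
    replace (2 * PI) with (2 * PI - 0) at 2 by ring.
    apply CInt_bound; [lra| |].
    - intros t Ht. apply Ccontinuous_minus; [now apply Cc|apply Ccontinuous_const].
    - intros t _. left. apply Hc. rewrite Cmod_circ; lra. }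
  assert (Z : d = RtoC 0).
  { apply Cmod_eq_0. apply Rle_antisym; [|apply Cmod_ge_0].
    apply Rnot_lt_le. intros Hp.
    assert (B := Hd (Cmod d / (4 * PI)) ltac:(apply Rdiv_lt_0_compat; lra)).
    replace (Cmod d / (4 * PI) * (2 * PI)) with (Cmod d / 2) in B by (field; lra). lra. }
  unfold d in Z. replace (circle_coef f a 0 r)
    with ((circle_coef f a 0 r - RtoC (2 * PI) * f a) + RtoC (2 * PI) * f a)%C by ring.
  rewrite Z. ring.
Qed.

Lemma Re_disc_kernel (x y : R) : (1 - x) ^ 2 + y ^ 2 <> 0 ->
  Re (2 * (x, y) * / (1 - (x, y)))%C = 2 * (x - (x ^ 2 + y ^ 2)) / ((1 - x) ^ 2 + y ^ 2).
Proof.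
  intros H. unfold Re, Cinv, Cminus, Cplus, Copp, Cmult, RtoC; cbn [fst snd].
  field. intros E. apply H. rewrite <- E. ring.
Qed.

(** Apply the mean value property to f e^(m q) with q = 2 v / (1 - v),
    v = eta (s - z) / r.  On the circle Re q + 1 is the Poisson kernel with its peak
    at s = z + r; for eta close to 1 it is at most 1/2 off the arc cos t > kappa, and
    q vanishes at z.  So the values off the arc are damped by e^(-m/2), at the price
    of a factor e^(m Q) on the arc. *)
Lemma two_constants (z : C) (r rho kappa : R) : 0 < r < rho -> 0 <= kappa < 1 ->
  exists Q, forall (f : C -> C) (a K m : R),
    (forall s, Cmod (s - z)%C < rho -> Cdiff f s) ->
    0 <= a -> 0 <= K -> 0 <= m ->
    (forall t, 0 <= t <= 2 * PI -> kappa < cos t -> Cmod (f (circ z r t)) <= a) ->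
    (forall t, 0 <= t <= 2 * PI -> Cmod (f (circ z r t)) <= K) ->
    Cmod (f z) <= a * exp (m * Q) + K * exp (- m / 2).
Proof.
  intros Hr Hk.
  (* Close enough to 1 for Hke, which bounds the Poisson kernel by 1/2 off the
     arc. *)
  set (eta := 1 - (1 - kappa) / 3).
  assert (He : 0 < eta < 1) by (unfold eta; lra).
  assert (Hke : 2 * eta * kappa <= 3 * eta ^ 2 - 1).
  { unfold eta. nra. }
  exists (2 / (1 - eta) ^ 2). intros f a K m Hf Ha HK Hm Harc Hall.
  assert (HP := PI_RGT_0).
  set (q := fun s => (2 * (RtoC (eta / r) * (s - z)) * / (1 - RtoC (eta / r) * (s - z)))%C).
  set (p := fun s => (f s * Cexp (RtoC m * q s))%C).
  assert (Hp0 : p z = f z).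
  { unfold p, q. replace (z - z)%C with (RtoC 0) by ring.
    rewrite !Cmult_0_r, Cmult_0_l, Cmult_0_r.
    rewrite Cexp_0. ring. }
  assert (Hqc : forall t, q (circ z r t) = (2 * (eta * cos t,
      eta * sin t)%R * / (1 - (eta * cos t, eta * sin t)%R))%C).
  { intros t. unfold q.
    assert (E : (RtoC (eta / r) * (circ z r t - z))%C = ((eta * cos t, eta * sin t)%R : C)).
    { unfold circ. replace (z + RtoC r * cis t - z)%C with (RtoC r * cis t)%C by ring.
      unfold cis, Cexp, Cmult, RtoC, Re, Im; cbn [fst snd]. rewrite exp_0. f_equal; field; lra. }
    now rewrite E. }
  assert (Hden : forall t, (1 - eta) ^ 2 <= (1 - eta * cos t) ^ 2 + (eta * sin t) ^ 2).
  { intros t. assert (S := sin2_cos2 t). unfold Rsqr in S. assert (C1 := COS_bound t).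
    replace ((1 - eta * cos t) ^ 2 + (eta * sin t) ^ 2)
      with (1 - 2 * eta * cos t + eta ^ 2 * (sin t * sin t + cos t * cos t)) by ring.
    rewrite S. nra. }
  assert (Hd0 : 0 < (1 - eta) ^ 2) by (apply pow_lt; lra).
  assert (HRe : forall t, Re (q (circ z r t))
      = 2 * (eta * cos t - eta ^ 2) / ((1 - eta * cos t) ^ 2 + (eta * sin t) ^ 2)).
  { intros t. rewrite Hqc. specialize (Hden t). rewrite Re_disc_kernel by lra.
    f_equal. f_equal. assert (S := sin2_cos2 t). unfold Rsqr in S.
    replace ((eta * cos t) ^ 2 + (eta * sin t) ^ 2)
      with (eta ^ 2 * (sin t * sin t + cos t * cos t)) by ring.
    rewrite S. ring. }
  assert (HQ : forall t, Re (q (circ z r t)) <= 2 / (1 - eta) ^ 2).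
  { intros t. rewrite HRe. specialize (Hden t). assert (C1 := COS_bound t).
    apply Rle_trans with (2 / ((1 - eta * cos t) ^ 2 + (eta * sin t) ^ 2)).
    - apply Rmult_le_compat_r; [left; apply Rinv_0_lt_compat; lra|nra].
    - apply Rmult_le_compat_l; [lra|]. apply Rinv_le_contravar; lra. }
  assert (HN : forall t, cos t <= kappa -> Re (q (circ z r t)) <= - / 2).
  { intros t Ht. rewrite HRe. specialize (Hden t).
    set (D := (1 - eta * cos t) ^ 2 + (eta * sin t) ^ 2) in *.
    assert (ED : D = 1 - 2 * eta * cos t + eta ^ 2).
    { assert (S := sin2_cos2 t). unfold Rsqr in S. unfold D.
      replace ((1 - eta * cos t) ^ 2 + (eta * sin t) ^ 2)
      with (1 - 2 * eta * cos t + eta ^ 2 * (sin t * sin t + cos t * cos t)) by ring. rewrite S.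
      ring. }
    apply Rmult_le_reg_r with D; [lra|]. unfold Rdiv. rewrite Rmult_assoc, Rinv_l by lra.
    rewrite ED. nra. }
  (* q has its pole at distance r / eta > r from z. *)
  set (rho' := Rmin rho (r / eta)).
  assert (Hrho : r < rho').
  { apply Rmin_glb_lt; [lra|]. apply Rmult_lt_reg_r with eta; [lra|].
    unfold Rdiv. rewrite Rmult_assoc, Rinv_l by lra. nra. }
  assert (Hp : forall s, Cmod (s - z)%C < rho' -> Cdiff p s).
  { intros s Hs. apply Cdiff_mult.
    - apply Hf. eapply Rlt_le_trans; [exact Hs|apply Rmin_l].
    - apply (Cdiff_comp Cexp (fun s => RtoC m * q s)%C); [eexists; apply Cderiv_Cexp|].
      apply Cdiff_mult; [eexists; apply Cderiv_const|]. unfold q.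
      apply Cdiff_mult; [eexists; cderiv|].
      apply (Cdiff_comp Cinv (fun s => 1 - RtoC (eta / r) * (s - z))%C); [|eexists; cderiv].
      eexists. apply Cderiv_inv. intros E.
      assert (E2 : Cmod (RtoC (eta / r) * (s - z))%C = 1).
      { replace (RtoC (eta / r) * (s - z))%C with (1 - (1 - RtoC (eta / r) * (s - z)))%C by ring.
        rewrite E. replace (1 - 0)%C with (RtoC 1) by ring. apply Cmod_1. }
      assert (Her : 0 < eta / r) by (apply Rdiv_lt_0_compat; lra).
      rewrite Cmod_mult, Cmod_R, Rabs_right in E2 by lra.
      assert (H1 := Rlt_le_trans _ _ _ Hs (Rmin_r _ _)).
      assert (eta / r * Cmod (s - z) < eta / r * (r / eta)) by (apply Rmult_lt_compat_l; lra).
      replace (eta / r * (r / eta)) with 1 in H by (field; lra). lra. }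
  assert (MV := circle_mean_value p z r rho' ltac:(lra) Hp). rewrite Hp0 in MV.
  set (B := a * exp (m * (2 / (1 - eta) ^ 2)) + K * exp (- m / 2)).
  assert (HB : Cmod (CInt (fun t => p (circ z r t)) 0 (2 * PI)) <= B * (2 * PI - 0)).
  { apply CInt_bound; [lra| |].
    - intros t _. apply Ccontinuous_comp; [|apply Ccontinuous_circ]. apply Hp.
      rewrite Cmod_circ; lra.
    - intros t Ht. unfold p. rewrite Cmod_mult, Cmod_Cexp.
      replace (Re (RtoC m * q (circ z r t))%C) with (m * Re (q (circ z r t)))
        by (unfold Re, RtoC, Cmult; simpl; ring).
      assert (Q1 := exp_pos (m * (2 / (1 - eta) ^ 2))). assert (Q2 := exp_pos (- m / 2)).
      destruct (Rlt_le_dec kappa (cos t)) as [Hc|Hc].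
      + apply Rle_trans with (a * exp (m * (2 / (1 - eta) ^ 2))); [|unfold B; nra].
        apply Rmult_le_compat; [apply Cmod_ge_0|left; apply exp_pos|now apply Harc|].
        apply exp_le_compat. apply Rmult_le_compat_l; [lra|apply HQ].
      + apply Rle_trans with (K * exp (- m / 2)); [|unfold B; nra].
        apply Rmult_le_compat; [apply Cmod_ge_0|left; apply exp_pos|now apply Hall|].
        apply exp_le_compat. specialize (HN t Hc). nra. }
  rewrite MV, Cmod_mult, Cmod_R, Rabs_right in HB by lra.
  apply Rmult_le_reg_l with (2 * PI); [lra|]. lra.
Qed.

(** * Growth of the zeta function *)

Lemma Rpower_pos x y : 0 < Rpower x y.
Proof. apply exp_pos. Qed.

Lemma Rpower_le_base_neg (x y a : R) : 0 < x -> x <= y -> 0 <= a ->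
    Rpower y (- a) <= Rpower x (- a).
Proof.
  intros Hx Hxy Ha. rewrite !Rpower_Ropp. apply Rinv_le_contravar; [apply Rpower_pos|].
  apply Rle_Rpower_l; lra.
Qed.

Lemma Rpower_le_exp (x a b : R) : 1 <= x -> a <= b -> Rpower x a <= Rpower x b.
Proof. intros Hx Hab. now apply Rle_Rpower. Qed.

Lemma Rpower_INR_small (a eta : R) : 0 < a -> 0 < eta ->
  exists N, forall n, (N <= n)%nat -> Rpower (INR (S n)) (- a) < eta.
Proof.
  intros Ha He. destruct (INR_unbounded (exp (- ln eta / a))) as [N HN].
  exists N. intros n Hn.
  assert (H1 : exp (- ln eta / a) < INR (S n)).
  { eapply Rlt_le_trans; [exact HN|]. apply le_INR. lia. }
  assert (H2 : - ln eta / a < ln (INR (S n))).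
  { rewrite <- (ln_exp (- ln eta / a)). apply ln_increasing; [apply exp_pos|assumption]. }
  unfold Rpower. rewrite <- (exp_ln eta) by assumption. apply exp_increasing.
  assert (a * (- ln eta / a) < a * ln (INR (S n))) by (apply Rmult_lt_compat_l; assumption).
  replace (a * (- ln eta / a)) with (- ln eta) in H by (field; lra). lra.
Qed.

Lemma Rpower_telescope (x a : R) : 1 <= x -> 0 < a ->
  a * Rpower (x + 1) (- (a + 1)) <= Rpower x (- a) - Rpower (x + 1) (- a).
Proof.
  intros Hx Ha.
  destruct (MVT_gen (fun u => Rpower u (- a)) x (x + 1) (fun u => - a * Rpower u (- a - 1))) as
      [c [Hc E]].
  - rewrite Rmin_left, Rmax_right by lra. intros u Hu. apply is_derive_Reals.
    apply derivable_pt_lim_power. lra.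
  - rewrite Rmin_left, Rmax_right by lra. intros u Hu. apply derivable_continuous_pt.
    exists (- a * Rpower u (- a - 1)). apply derivable_pt_lim_power. lra.
  - rewrite Rmin_left, Rmax_right in Hc by lra.
    replace (x + 1 - x) with 1 in E by ring.
    assert (L := Rpower_le_base_neg c (x + 1) (a + 1) ltac:(lra) ltac:(lra) ltac:(lra)).
    replace (- a - 1) with (- (a + 1)) in E by ring. nra.
Qed.

(** The expression is the error in replacing the integral of u^(-s) over
    [x, x + 1] by x^(-s). *)
Lemma euler_step (s : C) (x : R) : 1 <= x -> 0 < Re s -> s <> RtoC 1 ->
  Cmod (cpow x (- s) - (cpow x (1 - s) - cpow (x + 1)%R (1 - s)) / (s - 1))%C
  <= Cmod s * Rpower x (- (Re s + 1)).
Proof.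
  intros Hx Hs Hs1.
  assert (N1 : (s - 1)%C <> RtoC 0).
  { intros E. apply Hs1. replace s with (s - 1 + 1)%C by ring. rewrite E. ring. }
  assert (N2 : (1 - s)%C <> RtoC 0).
  { intros E. apply N1. replace (s - 1)%C with (- (1 - s))%C by ring. rewrite E. ring. }
  set (M := Cmod s * Rpower x (- (Re s + 1))).
  assert (H1 : forall u, x <= u <= x + 1 -> Cmod (cpow u (- s) - cpow x (- s))%C <= M).
  { intros u Hu. apply Rle_trans with (M * (u - x)).
    - apply (path_deriv_bound (fun v => cpow v (- s)%C) (fun v => - s * cpow v (- s - 1))%C);
        [lra| |].
      + intros t Ht. apply path_deriv_cpow. lra.
      + intros t Ht. rewrite Cmod_mult, Cmod_opp, Cmod_cpow. unfold M.
        apply Rmult_le_compat_l; [apply Cmod_ge_0|].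
        replace (Re (- s - 1)%C) with (- (Re s + 1)) by (unfold Re, Cminus, Copp, Cplus, RtoC;
          simpl; ring).
        apply Rpower_le_base_neg; lra.
    - assert (0 <= M) by (apply Rmult_le_pos; [apply Cmod_ge_0|left; apply Rpower_pos]). nra. }
  set (psi := fun u => (/ (1 - s) * cpow u (1 - s) - RtoC u * cpow x (- s))%C).
  assert (H2 := path_deriv_bound psi (fun u => cpow u (- s) - cpow x (- s))%C x (x + 1) M
      ltac:(lra)).
  replace (M * (x + 1 - x)) with M in H2 by ring.
  replace (cpow x (- s) - (cpow x (1 - s) - cpow (x + 1)%R (1 - s)) / (s - 1))%C
    with (- (psi (x + 1)%R - psi x))%C.
  2:{ unfold psi. rewrite RtoC_plus. field. split; assumption. }
  rewrite Cmod_opp. apply H2.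
  - intros t Ht. unfold psi. apply path_deriv_minus.
    + assert (D := path_deriv_cpow (1 - s)%C t ltac:(lra)).
      assert (D2 := path_deriv_comp (fun w => / (1 - s) * w)%C (fun v => cpow v (1 - s)%C) t (/
          (1 - s))%C _
        ltac:(eapply Cderiv_eq; [cderiv|cbv beta; ring]) D).
      replace (cpow t (- s)) with (/ (1 - s) * ((1 - s) * cpow t (1 - s - 1)))%C; [exact D2|].
      replace (1 - s - 1)%C with (- s)%C by ring. field. exact N2.
    + apply path_deriv_line.
  - exact H1.
Qed.

(** Euler's summation formula without the remainder: the correction term is the
    integral of u^(-s) from the first omitted integer on, continued to all s <> 1. *)
Definition zeta_partial (N : nat) (s : C) : C :=
  (sum_n (G := C_AbelianMonoid) (fun j => cpow (INR (S j)) (- s)%C) N + cpow (INR (S (S N))) (1 -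
      s) / (s - 1))%C.

Lemma zeta_partial_step N s : s <> RtoC 1 ->
  (zeta_partial (S N) s - zeta_partial N s =
   cpow (INR (S (S N))) (- s) - (cpow (INR (S (S N))) (1 - s) - cpow (INR (S (S N)) + 1)%R (1 -
       s)) / (s - 1))%C.
Proof.
  intros Hs. unfold zeta_partial. rewrite sum_Sn. rewrite <- (S_INR (S (S N))).
  change (plus (G := C_AbelianMonoid)) with Cplus.
  field. intros E. apply Hs. replace s with (s - 1 + 1)%C by ring. rewrite E. ring.
Qed.

Lemma zeta_partial_cauchy (tau : R) (s : C) (N m : nat) : 0 < tau -> tau <= Re s -> s <> RtoC 1 ->
  Cmod (zeta_partial (N + m) s - zeta_partial N s)%C
  <= Cmod s / tau * (Rpower (INR (S N)) (- tau) - Rpower (INR (S (N + m))) (- tau)).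
Proof.
  intros Ht Hs H1. induction m as [|m IH].
  - rewrite Nat.add_0_r. replace (zeta_partial N s - zeta_partial N s)%C with (RtoC 0) by ring.
    rewrite Cmod_0. right. ring.
  - rewrite Nat.add_succ_r.
    replace (zeta_partial (S (N + m)) s - zeta_partial N s)%C with
      ((zeta_partial (S (N + m)) s - zeta_partial (N + m) s) + (zeta_partial (N + m) s -
          zeta_partial N s))%C by ring.
    eapply Rle_trans; [apply Cmod_triangle|].
    assert (Hx : 1 <= INR (S (N + m))).
    { rewrite S_INR. assert (P := pos_INR (N + m)). lra. }
    assert (St : Cmod (zeta_partial (S (N + m)) s - zeta_partial (N + m) s)%C <=
      Cmod s / tau * (Rpower (INR (S (N + m))) (- tau) - Rpower (INR (S (S (N + m)))) (- tau))).
    { rewrite zeta_partial_step by assumption.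
      assert (Hx2 : INR (S (S (N + m))) = INR (S (N + m)) + 1) by apply (S_INR (S (N + m))).
      eapply Rle_trans; [apply euler_step; [rewrite Hx2; lra|lra|assumption]|].
      rewrite Hx2. unfold Rdiv. rewrite Rmult_assoc. apply Rmult_le_compat_l; [apply Cmod_ge_0|].
      apply Rle_trans with (Rpower (INR (S (N + m)) + 1) (- (tau + 1))).
      - apply Rpower_le_exp; lra.
      - apply Rmult_le_reg_l with tau; [assumption|].
        rewrite <- Rmult_assoc, Rinv_r, Rmult_1_l by lra.
        now apply Rpower_telescope. }
    lra.
Qed.

Lemma zeta_partial_bound (tau : R) (s : C) (N : nat) : 0 < tau -> tau <= Re s -> s <> RtoC 1 ->
  Cmod (zeta_partial N s) <= / Cmod (s - 1)%C + Cmod s * (1 + / tau).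
Proof.
  intros Ht Hs H1.
  assert (A := zeta_partial_cauchy tau s 0 N Ht Hs H1). simpl (0 + N)%nat in A.
  assert (N1 : (s - 1)%C <> RtoC 0).
  { intros E. apply H1. replace s with (s - 1 + 1)%C by ring. rewrite E. ring. }
  assert (B : Cmod (zeta_partial 0 s) <= / Cmod (s - 1)%C + Cmod s).
  { assert (S1 := euler_step s 1 ltac:(lra) ltac:(lra) H1).
    assert (E1 : forall t, cpow 1 t = RtoC 1).
    { intros t. rewrite cpow_Cexp, ln_1, Cmult_0_l. apply Cexp_0. }
    rewrite !E1 in S1. unfold Rpower in S1. rewrite ln_1, Rmult_0_r, exp_0, Rmult_1_r in S1.
    unfold zeta_partial. rewrite sum_O.
    change (INR 1) with 1. change (INR 2) with (1 + 1). rewrite E1.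
    replace (1 + cpow (1 + 1)%R (1 - s) / (s - 1))%C
      with (/ (s - 1) + (1 - (1 - cpow (1 + 1)%R (1 - s)) / (s - 1)))%C by (field; assumption).
    eapply Rle_trans; [apply Cmod_triangle|]. rewrite Cmod_inv by assumption. lra. }
  replace (zeta_partial N s) with ((zeta_partial N s - zeta_partial 0 s) + zeta_partial 0 s)%C
    by ring.
  eapply Rle_trans; [apply Cmod_triangle|].
  assert (Cmod s / tau * (Rpower (INR 1) (- tau) - Rpower (INR (S N)) (- tau)) <= Cmod s * / tau).
  { unfold Rdiv. rewrite <- (Rmult_1_r (Cmod s * / tau)) at 2. apply Rmult_le_compat_l.
    - apply Rmult_le_pos; [apply Cmod_ge_0|]. left; now apply Rinv_0_lt_compat.
    - unfold Rpower at 1. change (INR 1) with 1. rewrite ln_1, Rmult_0_r, exp_0.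
      assert (P := Rpower_pos (INR (S N)) (- tau)). lra. }
  lra.
Qed.

Lemma Cdiff_zeta_partial N s : s <> RtoC 1 -> Cdiff (zeta_partial N) s.
Proof.
  intros Hs. unfold zeta_partial. apply Cdiff_plus.
  - induction N as [|N IH].
    + apply (ex_derive_ext (K := C_AbsRing) (V := AbsRing_NormedModule C_AbsRing) (fun s => cpow
          (INR 1) (- s)%C)).
      { intros t. now rewrite sum_O. }
      apply Cdiff_cpow. eexists.
      apply (is_derive_opp (K := C_AbsRing) (V := AbsRing_NormedModule C_AbsRing) (fun x => x)),
          Cderiv_id.
    + apply (ex_derive_ext (K := C_AbsRing) (V := AbsRing_NormedModule C_AbsRing)
        (fun s => sum_n (G := C_AbelianMonoid) (fun j => cpow (INR (S j)) (- s)%C) N + cpow (INR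
            (S (S N))) (- s))%C).
      { intros t. now rewrite sum_Sn. }
      apply Cdiff_plus; [exact IH|]. apply Cdiff_cpow. eexists.
      apply (is_derive_opp (K := C_AbsRing) (V := AbsRing_NormedModule C_AbsRing) (fun x => x)),
          Cderiv_id.
  - apply Cdiff_mult.
    + apply (Cdiff_cpow _ (fun s => 1 - s)%C). eexists. cderiv.
    + apply (Cdiff_comp Cinv (fun s => s - 1)%C); [|eexists; cderiv].
      eexists. apply Cderiv_inv. now apply Csub_neq.
Qed.

Lemma Cdiff_zeta zeta s : is_riemann_zeta zeta -> s <> RtoC 1 -> Cdiff zeta s.
Proof.
  intros [_ H] Hs. destruct (H s Hs) as [l Hl]. exists l. now apply Cderiv_C_NormedModule.
Qed.

Lemma zeta_series_limit zeta s : is_riemann_zeta zeta -> 1 < Re s ->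
  forall eta, 0 < eta -> exists N, forall n, (N <= n)%nat ->
    Cmod (zeta s - sum_n (G := C_AbelianMonoid) (fun j => cpow (INR (S j)) (- s)%C) n)%C <= eta.
Proof.
  intros [Hs _] H1 eta He. specialize (Hs s H1).
  destruct (proj1 (filterlim_locally (F := eventually) _ _) Hs (mkposreal (eta / 2) ltac:(lra)))
      as [N1 HN1].
  exists N1. intros n Hn. specialize (HN1 n Hn). destruct HN1 as [B1 B2].
  set (X := sum_n (fun j => cpow (INR (S j)) (- s)%C) n) in B1, B2.
  eapply Rle_trans; [apply Cmod_le_Re_Im|].
  change (Rabs (fst X - fst (zeta s)) < eta / 2) in B1.
  change (Rabs (snd X - snd (zeta s)) < eta / 2) in B2.
  change (Rabs (fst (zeta s) - fst X) + Rabs (snd (zeta s) - snd X) <= eta).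
  rewrite Rabs_minus_sym in B1. rewrite Rabs_minus_sym in B2. lra.
Qed.

Lemma zeta_partial_limit zeta s : is_riemann_zeta zeta -> 1 < Re s ->
  forall eta, 0 < eta -> exists N, forall n, (N <= n)%nat ->
    Cmod (zeta s - zeta_partial n s)%C <= eta.
Proof.
  intros Hz H1 eta He.
  assert (Hs1 : s <> RtoC 1) by (intros ->; simpl in H1; lra).
  assert (Hm : 0 < Cmod (s - 1)%C) by now apply Cmod_gt_0, Csub_neq.
  destruct (zeta_series_limit zeta s Hz H1 (eta / 2)) as [N1 HN1]; [lra|].
  destruct (Rpower_INR_small (Re s - 1) (eta / 2 * Cmod (s - 1)%C)) as [N2 HN2]; [lra|nra|].
  exists (max N1 N2). intros n Hn.
  specialize (HN1 n ltac:(lia)). specialize (HN2 (S n) ltac:(lia)).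
  unfold zeta_partial.
  set (X := sum_n (G := C_AbelianMonoid) (fun j => cpow (INR (S j)) (- s)%C) n) in *.
  replace (zeta s - (X + cpow (INR (S (S n))) (1 - s) / (s - 1)))%C
    with ((zeta s - X) + - (cpow (INR (S (S n))) (1 - s) / (s - 1)))%C by (field;
      now apply Csub_neq).
  eapply Rle_trans; [apply Cmod_triangle|]. rewrite Cmod_opp, Cmod_div by now apply Csub_neq.
  rewrite Cmod_cpow. replace (Re (1 - s)%C)
    with (- (Re s - 1)) by (unfold Re, Cminus, Cplus, Copp, RtoC; simpl; ring).
  assert (Rpower (INR (S (S n))) (- (Re s - 1)) / Cmod (s - 1)%C <= eta / 2).
  { apply Rmult_le_reg_r with (Cmod (s - 1)%C); [assumption|].
    unfold Rdiv at 1. rewrite Rmult_assoc, Rinv_l by lra. lra. }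
  lra.
Qed.

Lemma zeta_sub_partial_le zeta s N : is_riemann_zeta zeta -> 1 < Re s ->
  Cmod (zeta s - zeta_partial N s)%C <= Cmod s * / INR (S N).
Proof.
  intros Hz H1. apply Rnot_lt_le. intros Hlt.
  assert (Hs1 : s <> RtoC 1) by (intros ->; simpl in H1; lra).
  set (e := (Cmod (zeta s - zeta_partial N s)%C - Cmod s * / INR (S N)) / 2).
  destruct (zeta_partial_limit zeta s Hz H1 e) as [M HM]; [unfold e; lra|].
  specialize (HM (N + M)%nat ltac:(lia)).
  assert (A := zeta_partial_cauchy 1 s N M ltac:(lra) ltac:(lra) Hs1).
  assert (P : 0 < INR (S N)) by (apply lt_0_INR; lia).
  rewrite (Rpower_Ropp (INR (S N))), Rpower_1 in A by assumption.
  assert (Q := Rpower_pos (INR (S (N + M))) (- (1))).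
  assert (T := Cmod_triangle (zeta s - zeta_partial (N + M) s) (zeta_partial (N + M) s -
      zeta_partial N s)).
  replace (zeta s - zeta_partial (N + M) s + (zeta_partial (N + M) s - zeta_partial N s))%C
    with (zeta s - zeta_partial N s)%C in T by ring.
  assert (Cmod s / 1 * (/ INR (S N) - Rpower (INR (S (N + M))) (- (1))) <= Cmod s * / INR (S N)).
  { rewrite Rdiv_1_r. apply Rmult_le_compat_l; [apply Cmod_ge_0|lra]. }
  unfold e in HM. lra.
Qed.

(** For 1/2 < Re z <= 1 the circle of radius 1/2 about z meets Re s > 1, where the
    Euler sums tend to zeta, and stays in Re s > 0, where they are bounded
    uniformly in N.  So [two_constants] applied to their difference with zeta shows
    that they tend to zeta at z as well, and zeta inherits their bound. *)
Lemma zeta_growth_strict zeta z : is_riemann_zeta zeta -> 1 / 2 < Re z -> 1 <= Im z ->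
  Cmod (zeta z) <= 4 * Cmod z.
Proof.
  intros Hz Hre Him.
  assert (Hz1 : z <> RtoC 1) by (intros ->; simpl in Him; lra).
  assert (Hd : 1 <= Cmod (z - 1)%C).
  { eapply Rle_trans; [|apply Im_le_Cmod].
    replace (Im (z - 1)%C) with (Im z) by (unfold Im, Cminus, Cplus, Copp, RtoC; simpl; ring).
    rewrite Rabs_right; lra. }
  assert (Hm : 1 <= Cmod z).
  { eapply Rle_trans; [|apply Im_le_Cmod]. rewrite Rabs_right; lra. }
  assert (HE : forall N, Cmod (zeta_partial N z) <= 1 + 3 * Cmod z).
  { intros N. eapply Rle_trans; [apply (zeta_partial_bound (1 / 2)); try assumption; lra|].
    assert (/ Cmod (z - 1)%C <= / 1) by (apply Rinv_le_contravar; lra).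
    replace (/ (1 / 2)) with 2 by field. lra. }
  assert (HA : forall eps, 0 < eps -> exists N, Cmod (zeta z - zeta_partial N z)%C <= eps).
  { intros eps He. destruct (Rlt_le_dec 1 (Re z)) as [H1|H1].
    { destruct (zeta_partial_limit zeta z Hz H1 eps He) as [N HN]. exists N. apply HN. lia. }
    set (delta := Re z - 1 / 2).
    assert (Hdel : 0 < delta <= 1 / 2) by (unfold delta; lra).
    destruct (two_constants z (1 / 2) (3 / 4) (1 - delta)) as [Q HQ]; [lra|lra|].
    assert (Hball : forall s, Cmod (s - z)%C < 3 / 4 -> s <> RtoC 1).
    { intros s Hs ->. replace (1 - z)%C with (- (z - 1))%C in Hs by ring. rewrite Cmod_opp in Hs.
      lra. }
    assert (Hcirc : forall t, Cmod (circ z (1 / 2) t - z)%C = 1 / 2) by (intros t;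
      apply Cmod_circ; lra).
    assert (Hc1 : forall t, circ z (1 / 2) t <> RtoC 1) by (intros t; apply Hball; rewrite Hcirc;
      lra).
    assert (HcR : forall t, Re (circ z (1 / 2) t) = Re z + cos t / 2).
    { intros t. unfold circ, cis, Cexp, Re, Cplus, Cmult, RtoC, Im; cbn [fst snd]. rewrite exp_0.
      field. }
    assert (Hcm : forall t, Cmod (circ z (1 / 2) t) <= Cmod z + 1).
    { intros t. replace (circ z (1 / 2) t) with ((circ z (1 / 2) t - z) + z)%C by ring.
      eapply Rle_trans; [apply Cmod_triangle|]. rewrite Hcirc. lra. }
    assert (Hcd : forall t, 1 / 2 <= Cmod (circ z (1 / 2) t - 1)%C).
    { intros t. assert (T := Cmod_triangle (circ z (1 / 2) t - 1) (- (circ z (1 / 2) t - z))).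
      replace (circ z (1 / 2) t - 1 + - (circ z (1 / 2) t - z))%C with (z - 1)%C in T by ring.
      rewrite Cmod_opp, Hcirc in T. lra. }
    destruct (circle_sup zeta z (1 / 2)) as [Mz [HMz0 HMz]].
    { intros t. now apply Cdiff_zeta. }
    set (L := Cmod z + 1) in *.
    assert (HL : 0 < L) by (unfold L; lra).
    set (K := Mz + (2 + L * (1 + / delta))).
    assert (HK : 0 <= K).
    { unfold K. assert (0 < / delta) by (apply Rinv_0_lt_compat; lra). nra. }
    (* The weight of the part of the circle where only the crude bound K is
       known is made small by m, then the weight of the arc by N. *)
    set (m := Rmax 0 (2 * ln ((K + 1) * 2 / eps))).
    assert (Hm0 : 0 <= m) by apply Rmax_l.
    assert (Hexp : K * exp (- m / 2) <= eps / 2).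
    { assert (Hln : exp (- m / 2) <= eps / (2 * (K + 1))).
      { replace (eps / (2 * (K + 1))) with (/ ((K + 1) * 2 / eps)) by (field; lra).
        rewrite <- (exp_ln ((K + 1) * 2 / eps)) by (apply Rdiv_lt_0_compat; lra).
        rewrite <- exp_Ropp. apply exp_le_compat.
        assert (R1 := Rmax_r 0 (2 * ln ((K + 1) * 2 / eps))). fold m in R1. lra. }
      apply Rle_trans with ((K + 1) * (eps / (2 * (K + 1)))).
      - apply Rmult_le_compat; try lra. left; apply exp_pos.
      - right. field. lra. }
    destruct (INR_unbounded (L * exp (m * Q) / (eps / 2))) as [N HN].
    exists N.
    assert (HN1 : 0 < INR (S N)) by (apply lt_0_INR; lia).
    specialize (HQ (fun s => zeta s - zeta_partial N s)%C (L * / INR (S N)) K m).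
    cbv beta in HQ. eapply Rle_trans; [apply HQ|].
    - intros s Hs. apply Cdiff_minus; [apply Cdiff_zeta|apply Cdiff_zeta_partial]; auto.
    - apply Rmult_le_pos; [lra|]. left; now apply Rinv_0_lt_compat.
    - exact HK.
    - exact Hm0.
    - intros t _ Ht. eapply Rle_trans; [apply zeta_sub_partial_le; [assumption|]|].
      + rewrite HcR. unfold delta in *. lra.
      + apply Rmult_le_compat_r; [left; now apply Rinv_0_lt_compat|apply Hcm].
    - intros t Ht. unfold Cminus. eapply Rle_trans; [apply Cmod_triangle|]. rewrite Cmod_opp.
      unfold K. apply Rplus_le_compat; [now apply HMz|].
      eapply Rle_trans; [apply (zeta_partial_bound delta)|].
      + lra.
      + rewrite HcR. assert (CB := COS_bound t). unfold delta. lra.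
      + apply Hc1.
      + apply Rplus_le_compat.
        * apply Rle_trans with (/ (1 / 2)); [|lra]. apply Rinv_le_contravar; [lra|apply Hcd].
        * apply Rmult_le_compat_r; [|apply Hcm].
          assert (0 < / delta) by (apply Rinv_0_lt_compat; lra). lra.
    - assert (L * / INR (S N) * exp (m * Q) <= eps / 2).
      { apply Rmult_le_reg_r with (INR (S N)); [assumption|].
        replace (L * / INR (S N) * exp (m * Q) * INR (S N)) with (L * exp (m * Q)) by (field;
          lra).
        assert (HN2 : L * exp (m * Q) / (eps / 2) < INR (S N)).
        { eapply Rlt_le_trans; [exact HN|]. apply le_INR. lia. }
        apply Rlt_le. apply (Rmult_lt_compat_r (eps / 2)) in HN2; [|lra].
        replace (L * exp (m * Q) / (eps / 2) * (eps / 2)) with (L * exp (m * Q)) in HN2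
          by (field; lra). lra. }
      lra. }
  apply Rnot_lt_le. intros Hlt.
  destruct (HA ((Cmod (zeta z) - 4 * Cmod z) / 2)) as [N HN]; [lra|].
  specialize (HE N).
  assert (T := Cmod_triangle (zeta z - zeta_partial N z) (zeta_partial N z)).
  replace (zeta z - zeta_partial N z + zeta_partial N z)%C with (zeta z) in T by ring. lra.
Qed.

(** The bound for Re z > 1/2 has a constant that does not depend on z, so it
    extends to the critical line by continuity. *)
Theorem zeta_growth zeta z : is_riemann_zeta zeta -> 1 / 2 <= Re z -> 1 <= Im z ->
  Cmod (zeta z) <= 4 * Cmod z.
Proof.
  intros Hz Hre Him.
  assert (Hz1 : z <> RtoC 1) by (intros ->; simpl in Him; lra).
  apply Rnot_lt_le. intros Hlt.
  set (e := (Cmod (zeta z) - 4 * Cmod z) / 8).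
  assert (He : 0 < e) by (unfold e; lra).
  destruct (Cdiff_continuous zeta z (Cdiff_zeta zeta z Hz Hz1) e He) as [d [Hd Hc]].
  set (h := Rmin (d / 2) e).
  assert (Hh : 0 < h) by (apply Rmin_pos; lra).
  assert (Hh1 : h <= d / 2) by apply Rmin_l. assert (Hh2 : h <= e) by apply Rmin_r.
  assert (Hmod : Cmod (z + RtoC h - z)%C = h).
  { replace (z + RtoC h - z)%C with (RtoC h) by ring. rewrite Cmod_R, Rabs_right; lra. }
  specialize (Hc (z + RtoC h)%C ltac:(rewrite Hmod; lra)).
  assert (G := zeta_growth_strict zeta (z + RtoC h)%C Hz).
  replace (Re (z + RtoC h)%C) with (Re z + h) in G by reflexivity.
  replace (Im (z + RtoC h)%C) with (Im z) in G by (unfold Im, Cplus, RtoC; simpl; ring).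
  specialize (G ltac:(lra) Him).
  assert (T := Cmod_triangle z (RtoC h)). rewrite (Cmod_R h), Rabs_right in T by lra.
  assert (T2 := Cmod_triangle (- (zeta (z + RtoC h)%C - zeta z)) (zeta (z + RtoC h)%C)).
  replace (- (zeta (z + RtoC h)%C - zeta z) + zeta (z + RtoC h)%C)%C with (zeta z) in T2 by ring.
  rewrite Cmod_opp in T2. unfold e in *. lra.
Qed.

(** The Dirichlet series without its first term is dominated by the sum of n^(-3),
    n >= 2, which is at most 1/2 by telescoping. *)
Lemma zeta_near_1 zeta s : is_riemann_zeta zeta -> Re s = 3 -> Cmod (zeta s - 1)%C <= 1 / 2.
Proof.
  intros Hz Hs.
  assert (P : forall n, Cmod (sum_n (G := C_AbelianMonoid) (fun j => cpow (INR (S j)) (- s)%C) n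
      - 1)%C
     <= 1 / 2 * (1 - Rpower (INR (S n)) (- (2)))).
  { induction n as [|n IH].
    - rewrite sum_O. change (INR 1) with 1. rewrite cpow_Cexp, ln_1, Cmult_0_l, Cexp_0.
      replace (1 - 1)%C with (RtoC 0) by ring. rewrite Cmod_0. unfold Rpower.
      rewrite ln_1, Rmult_0_r, exp_0. lra.
    - rewrite sum_Sn. set (X := sum_n (G := C_AbelianMonoid) (fun j => cpow (INR (S j)) (- s)%C)
          n) in *.
      change (plus X (cpow (INR (S (S n))) (- s)%C)) with (X + cpow (INR (S (S n))) (- s))%C.
      replace (X + cpow (INR (S (S n))) (- s) - 1)%C with ((X - 1) + cpow (INR (S (S n))) (-
          s))%C by ring.
      eapply Rle_trans; [apply Cmod_triangle|]. rewrite Cmod_cpow.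
      change (Re (- s)%C) with (- Re s). rewrite Hs.
      assert (Hx : 1 <= INR (S n)) by (rewrite S_INR; assert (Q := pos_INR n); lra).
      assert (T := Rpower_telescope (INR (S n)) 2 Hx ltac:(lra)).
      rewrite <- S_INR in T. replace (2 + 1) with 3 in T by ring. lra. }
  apply Rnot_lt_le. intros Hlt.
  destruct (zeta_series_limit zeta s Hz ltac:(lra) ((Cmod (zeta s - 1)%C - 1 / 2) / 2)) as [N
      HN]; [lra|].
  specialize (HN N (le_n N)). specialize (P N).
  set (X := sum_n (G := C_AbelianMonoid) (fun j => cpow (INR (S j)) (- s)%C) N) in *.
  assert (T := Cmod_triangle (zeta s - X) (X - 1)).
  replace (zeta s - X + (X - 1))%C with (zeta s - 1)%C in T by ring.
  assert (Q := Rpower_pos (INR (S N)) (- (2))). lra.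
Qed.

(** * Improper integrals *)

Notation is_improper f l :=
  (is_RInt_gen (V := C_R_NormedModule) f (at_point 1) (Rbar_locally p_infty) l).

Lemma is_improper_eps (f : R -> C) (l : C) : (forall x, 1 <= x -> Ccontinuous f x) ->
  is_improper f l <->
  forall eps, 0 < eps -> exists M, forall X, M <= X -> 1 <= X -> Cmod (CInt f 1 X - l)%C <= eps.
Proof.
  intros Hc. split.
  - intros H eps He.
    destruct (H (fun z => Cmod (z - l)%C <= eps)) as [Q P HQ [M HP] HQP].
    { exists (mkposreal (eps / 2) ltac:(lra)). intros z [B1 B2].
      change (Rabs (fst z - fst l) < eps / 2) in B1.
      change (Rabs (snd z - snd l) < eps / 2) in B2.
      eapply Rle_trans; [apply Cmod_le_Re_Im|].
      change (Rabs (fst z - fst l) + Rabs (snd z - snd l) <= eps). lra. }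
    exists (M + 1). intros X HX HX1.
    destruct (HQP 1 X HQ (HP X ltac:(lra))) as [y [Hy1 Hy2]].
    cbn [fst snd] in Hy1. apply is_RInt_CInt_unique in Hy1. now rewrite Hy1.
  - intros H P [d Hd]. destruct (H (d / 2)) as [M HM]; [destruct d; simpl; lra|].
    exists (fun a => a = 1) (fun X => M <= X /\ 1 <= X).
    + reflexivity.
    + exists (Rmax M 1). intros X HX.
      split; [apply Rlt_le, (Rle_lt_trans _ _ _ (Rmax_l M 1) HX)|apply Rlt_le,
          (Rle_lt_trans _ _ _ (Rmax_r M 1) HX)].
    + intros a X -> [HX1 HX2]. exists (CInt f 1 X). split.
      * apply is_RInt_CInt; [assumption|]. intros t Ht. apply Hc; lra.
      * apply Hd. specialize (HM X HX1 HX2). destruct d as [d Hd0]. cbn [pos] in *.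
        split; (eapply Rle_lt_trans; [|assert (K : d / 2 < d) by lra; exact K]);
          (eapply Rle_trans; [|exact HM]).
        -- apply (Re_le_Cmod (CInt f 1 X - l)%C).
        -- apply (Im_le_Cmod (CInt f 1 X - l)%C).
Qed.

Lemma bounded_sup (g : R -> R) : (exists B, forall X, 1 <= X -> RInt g 1 X <= B) ->
  exists S, (forall X, 1 <= X -> RInt g 1 X <= S) /\
    forall eta, 0 < eta -> exists X, 1 <= X /\ S - eta < RInt g 1 X.
Proof.
  intros [B HB].
  destruct (completeness (fun y => exists X, 1 <= X /\ y = RInt g 1 X)) as [S [HS1 HS2]].
  { exists B. intros y [X [HX ->]]. now apply HB. }
  { exists (RInt g 1 1). exists 1. split; [lra|reflexivity]. }
  exists S. split.
  - intros X HX. apply HS1. now exists X.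
  - intros eta He.
    destruct (Classical_Prop.classic (exists X0, 1 <= X0 /\ S - eta < RInt g 1 X0)) as [E|E];
      [assumption|].
    exfalso. assert (K : S <= S - eta); [|lra].
    apply HS2. intros y [X [HX ->]]. apply Rnot_lt_le. intros HL. apply E. now exists X.
Qed.

(** Besides convergence this gives a tail bound that is uniform in f, which allows
    a whole circle of integrands with the same majorant to be treated at once. *)
Lemma improper_dominated (f : R -> C) (g : R -> R) (B : R) :
  (forall x, 1 <= x -> Ccontinuous f x) -> (forall x, 1 <= x -> continuous g x) ->
  (forall x, 1 <= x -> Cmod (f x) <= g x) -> (forall X, 1 <= X -> RInt g 1 X <= B) ->
  exists l, is_improper f l /\ forall X, 1 <= X -> Cmod (l - CInt f 1 X)%C <= B - RInt g 1 X.
Proof.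
  intros Hf Hg Hfg HB.
  assert (Hg0 : forall x, 1 <= x -> 0 <= g x).
  { intros x Hx. eapply Rle_trans; [apply Cmod_ge_0|now apply Hfg]. }
  assert (Hdiff : forall X Y, 1 <= X -> X <= Y ->
     Cmod (CInt f 1 Y - CInt f 1 X)%C <= RInt g 1 Y - RInt g 1 X).
  { intros X Y HX HY.
    rewrite <- (CInt_Chasles f 1 X Y) by (assumption || (intros t Ht; apply Hf; lra)).
    replace (CInt f 1 X + CInt f X Y - CInt f 1 X)%C with (CInt f X Y) by ring.
    rewrite <- (RInt_split g 1 X Y) by (assumption || (intros; apply Hg; lra)).
    rewrite Rplus_minus_l.
    apply CInt_norm_le; [assumption| | |].
    - intros t Ht. apply Hf; lra.
    - apply ex_RInt_cont; [assumption|]. intros; apply Hg; lra.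
    - intros; apply Hfg; lra. }
  destruct (bounded_sup g (ex_intro _ B HB)) as [S [HSle HS]].
  assert (Hcau : forall eps, 0 < eps -> exists X0, 1 <= X0 /\ forall X, X0 <= X ->
      Cmod (CInt f 1 X - CInt f 1 X0)%C < eps).
  { intros eps He.
    destruct (HS eps He) as [X0 [H0 H1]]. exists X0. split; [assumption|].
    intros X HX. eapply Rle_lt_trans; [apply Hdiff; assumption|].
    assert (L := HSle X ltac:(lra)). lra. }
  assert (Hseq : forall p : C -> R, (forall z w, Rabs (p z - p w) <= Cmod (z - w)%C) ->
     exists a : R, forall eps, 0 < eps -> exists M, forall X, M <= X -> 1 <= X ->
         Rabs (p (CInt f 1 X) - a) <= eps).
  { intros p Hp.
    destruct (proj2 (ex_lim_seq_cauchy_corr (fun n => p (CInt f 1 (INR n + 1))))) as [a Ha].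
    { intros eps. destruct (Hcau (eps / 2)) as [X0 [H0 H1]]; [destruct eps; simpl; lra|].
      destruct (INR_unbounded X0) as [N HN]. exists N. intros n m Hn Hm.
      apply le_INR in Hn. apply le_INR in Hm.
      assert (A1 := H1 (INR n + 1) ltac:(lra)). assert (A2 := H1 (INR m + 1) ltac:(lra)).
      assert (P1 := Hp (CInt f 1 (INR n + 1)) (CInt f 1 X0)).
      assert (P2 := Hp (CInt f 1 (INR m + 1)) (CInt f 1 X0)).
      assert (T := Rabs_triang (p (CInt f 1 (INR n + 1)) - p (CInt f 1 X0)) (- (p (CInt f 1 (INR
          m + 1)) - p (CInt f 1 X0)))).
      rewrite Rabs_Ropp in T.
      replace (p (CInt f 1 (INR n + 1)) - p (CInt f 1 X0) + - (p (CInt f 1 (INR m + 1)) - p (CInt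
          f 1 X0)))
        with (p (CInt f 1 (INR n + 1)) - p (CInt f 1 (INR m + 1))) in T by ring.
      destruct eps as [eps He]; cbn [pos] in *. lra. }
    exists a. intros eps He.
    destruct (Hcau (eps / 4)) as [X0 [H0 H1]]; [lra|].
    exists X0. intros X HX HX1.
    apply is_lim_seq_spec in Ha. destruct (Ha (mkposreal (eps / 4) ltac:(lra))) as [N HN].
    destruct (INR_unbounded X0) as [N0 HN0].
    specialize (HN (max N N0) ltac:(lia)). cbn [pos] in HN.
    set (n := max N N0) in *.
    assert (Hn : INR N0 <= INR n) by (apply le_INR; lia).
    assert (A1 := H1 (INR n + 1) ltac:(lra)). assert (A2 := H1 X HX).
    assert (P1 := Hp (CInt f 1 (INR n + 1)) (CInt f 1 X0)).
    assert (P2 := Hp (CInt f 1 X) (CInt f 1 X0)).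
    set (u := p (CInt f 1 (INR n + 1))) in *. set (v := p (CInt f 1 X)) in *.
    set (w := p (CInt f 1 X0)) in *.
    assert (T := Rabs_triang (v - w) (- (u - w))). rewrite Rabs_Ropp in T.
    assert (T2 := Rabs_triang (v - w + - (u - w)) (u - a)).
    replace (v - w + - (u - w) + (u - a)) with (v - a) in T2 by ring. lra. }
  destruct (Hseq Re (fun z w => Re_le_Cmod (z - w)%C)) as [a Ha].
  destruct (Hseq Im (fun z w => Im_le_Cmod (z - w)%C)) as [b Hb].
  assert (Hl : forall eps, 0 < eps -> exists M, forall X, M <= X -> 1 <= X ->
      Cmod (CInt f 1 X - (a, b))%C <= eps).
  { intros eps He. destruct (Ha (eps / 2)) as [M1 HM1]; [lra|].
    destruct (Hb (eps / 2)) as [M2 HM2]; [lra|].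
    exists (Rmax M1 M2). intros X HX HX1.
    specialize (HM1 X (Rle_trans _ _ _ (Rmax_l _ _) HX) HX1).
    specialize (HM2 X (Rle_trans _ _ _ (Rmax_r _ _) HX) HX1).
    eapply Rle_trans; [apply Cmod_le_Re_Im|].
    change (Rabs (Re (CInt f 1 X) - a) + Rabs (Im (CInt f 1 X) - b) <= eps). lra. }
  exists (a, b). split.
  - now apply is_improper_eps.
  - intros X HX. apply Rnot_lt_le. intros Hlt.
    set (e := (Cmod ((a, b) - CInt f 1 X)%C - (B - RInt g 1 X)) / 2).
    destruct (Hl e) as [M HM]; [unfold e; lra|].
    set (Y := Rmax M X).
    assert (HY1 : M <= Y) by apply Rmax_l. assert (HY2 : X <= Y) by apply Rmax_r.
    specialize (HM Y HY1 ltac:(lra)).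
    assert (D := Hdiff X Y HX HY2). assert (DB := HB Y ltac:(lra)).
    assert (T := Cmod_triangle (- (CInt f 1 Y - (a, b))) (CInt f 1 Y - CInt f 1 X)).
    rewrite Cmod_opp in T.
    assert (E : (- (CInt f 1 Y - (a, b)) + (CInt f 1 Y - CInt f 1 X) = (a, b) - CInt f 1 X)%C).
    { generalize ((a, b) : C); intros; ring. }
    rewrite E in T. unfold e in HM. lra.
Qed.

Lemma improper_unique (f : R -> C) (l l' : C) : (forall x, 1 <= x -> Ccontinuous f x) ->
  is_improper f l -> is_improper f l' -> l = l'.
Proof.
  intros Hc H H'. rewrite is_improper_eps in H, H' by assumption.
  assert (E : (l - l')%C = RtoC 0).
  { apply Cmod_eq_0. apply Rle_antisym; [|apply Cmod_ge_0]. apply Rnot_lt_le. intros Hp.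
    destruct (H (Cmod (l - l')%C / 4)) as [M HM]; [lra|].
    destruct (H' (Cmod (l - l')%C / 4)) as [M' HM']; [lra|].
    set (X := Rmax 1 (Rmax M M')).
    assert (1 <= X) by apply Rmax_l.
    assert (Rmax M M' <= X) by apply Rmax_r. assert (M <= Rmax M M') by apply Rmax_l.
    assert (M' <= Rmax M M') by apply Rmax_r.
    specialize (HM X ltac:(lra) ltac:(lra)). specialize (HM' X ltac:(lra) ltac:(lra)).
    assert (T := Cmod_triangle (- (CInt f 1 X - l)) (CInt f 1 X - l')). rewrite Cmod_opp in T.
    replace (- (CInt f 1 X - l) + (CInt f 1 X - l'))%C with (l - l')%C in T by ring. lra. }
  replace l with (l - l' + l')%C by ring. rewrite E. ring.
Qed.

Lemma nonneg_improper_bounded (g : R -> R) :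
  (forall x, 1 <= x -> continuous g x) -> (forall x, 1 <= x -> 0 <= g x) ->
  ex_RInt_gen g (at_point 1) (Rbar_locally p_infty) <->
  exists B, forall X, 1 <= X -> RInt g 1 X <= B.
Proof.
  intros Hg Hg0. split.
  - intros [l H].
    destruct (H (fun y => Rabs (y - l) < 1)) as [Q P HQ [M HP] HQP].
    { exists (mkposreal 1 Rlt_0_1). intros y Hy. exact Hy. }
    exists (l + 1). intros X HX.
    set (Y := Rmax X (M + 1)).
    assert (X <= Y) by apply Rmax_l. assert (M + 1 <= Y) by apply Rmax_r.
    destruct (HQP 1 Y HQ (HP Y ltac:(lra))) as [y [Hy1 Hy2]]. cbn [fst snd] in Hy1.
    apply (is_RInt_unique (V := R_CompleteNormedModule)) in Hy1.
    apply Rle_trans with (RInt g 1 Y).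
    + apply RInt_nonneg_le; try lra; intros; [apply Hg|apply Hg0]; lra.
    + rewrite Hy1. apply Rabs_lt_between in Hy2. lra.
  - intros [B HB].
    assert (Hc : forall x, 1 <= x -> Ccontinuous (fun t => RtoC (g t)) x) by (intros;
      now apply Ccontinuous_RtoC, Hg).
    destruct (improper_dominated (fun t => RtoC (g t)) g B) as [l [Hl _]]; try assumption.
    { intros x Hx. rewrite Cmod_R, Rabs_right; [lra|]. apply Rle_ge. now apply Hg0. }
    exists (fst l). rewrite is_improper_eps in Hl by assumption.
    intros P [d Hd]. destruct (Hl (d / 2)) as [M HM]; [destruct d; simpl; lra|].
    exists (fun a => a = 1) (fun X => M <= X /\ 1 <= X).
    + reflexivity.
    + exists (Rmax M 1). intros X HX.
      split; [apply Rlt_le, (Rle_lt_trans _ _ _ (Rmax_l M 1) HX)|apply Rlt_le,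
          (Rle_lt_trans _ _ _ (Rmax_r M 1) HX)].
    + intros a X -> [HX1 HX2]. exists (RInt g 1 X). split.
      * apply (RInt_correct (V := R_CompleteNormedModule)). apply ex_RInt_cont; [assumption|].
        intros; apply Hg; lra.
      * apply Hd. specialize (HM X HX1 HX2). destruct d as [d Hd0]. cbn [pos] in *.
        change (Rabs (RInt g 1 X - fst l) < d).
        apply Rle_lt_trans with (d / 2); [|lra]. eapply Rle_trans; [|exact HM].
        apply (Re_le_Cmod (CInt (fun t => RtoC (g t)) 1 X - l)%C).
Qed.

(** A bound for a combination of partial integrals passes to the limits; used for
    difference quotients of the transform. *)
Lemma improper_comb_le (f1 f2 f3 : R -> C) (l1 l2 l3 h : C) (B : R) :
  (forall x, 1 <= x -> Ccontinuous f1 x) -> (forall x, 1 <= x -> Ccontinuous f2 x) ->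
      (forall x, 1 <= x -> Ccontinuous f3 x) ->
  is_improper f1 l1 -> is_improper f2 l2 -> is_improper f3 l3 ->
  (forall X, 1 <= X -> Cmod (CInt f1 1 X - CInt f2 1 X - CInt f3 1 X * h)%C <= B) ->
  Cmod (l1 - l2 - l3 * h)%C <= B.
Proof.
  intros C1 C2 C3 H1 H2 H3 HB. rewrite is_improper_eps in H1, H2, H3 by assumption.
  apply Rnot_lt_le. intros Hlt.
  assert (Hh := Cmod_ge_0 h).
  set (e := (Cmod (l1 - l2 - l3 * h)%C - B) / (2 * (2 + Cmod h))).
  assert (He : 0 < e) by (unfold e; apply Rdiv_lt_0_compat; lra).
  destruct (H1 e He) as [M1 HM1]. destruct (H2 e He) as [M2 HM2]. destruct (H3 e He) as [M3 HM3].
  set (X := Rmax (Rmax M1 M2) (Rmax M3 1)).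
  assert (X1 : Rmax M1 M2 <= X) by apply Rmax_l. assert (X2 : Rmax M3 1 <= X) by apply Rmax_r.
  assert (Y1 := Rmax_l M1 M2). assert (Y2 := Rmax_r M1 M2). assert (Y3 := Rmax_l M3 1).
  assert (Y4 := Rmax_r M3 1).
  specialize (HM1 X ltac:(lra) ltac:(lra)). specialize (HM2 X ltac:(lra) ltac:(lra)).
  specialize (HM3 X ltac:(lra) ltac:(lra)).
  specialize (HB X ltac:(lra)).
  set (I1 := CInt f1 1 X) in *. set (I2 := CInt f2 1 X) in *. set (I3 := CInt f3 1 X) in *.
  assert (T1 := Cmod_triangle (I1 - I2 - I3 * h) (- (I1 - l1) + ((I2 - l2) + (I3 - l3) * h))).
  assert (T2 := Cmod_triangle (- (I1 - l1)) ((I2 - l2) + (I3 - l3) * h)).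
  assert (T3 := Cmod_triangle (I2 - l2) ((I3 - l3) * h)).
  rewrite Cmod_opp in T2. rewrite Cmod_mult in T3.
  replace (I1 - I2 - I3 * h + (- (I1 - l1) + ((I2 - l2) + (I3 - l3) * h)))%C with (l1 - l2 - l3 *
      h)%C in T1 by ring.
  assert (K : Cmod (I3 - l3)%C * Cmod h <= e * Cmod h) by (apply Rmult_le_compat_r; assumption).
  assert (E : e * (2 + Cmod h) = (Cmod (l1 - l2 - l3 * h)%C - B) / 2) by (unfold e; field; lra).
  lra.
Qed.

(** * Fubini's theorem for continuous functions on a rectangle *)

Section Fubini.
Variable g : R -> R -> R.
Hypothesis Hg : forall x y, continuity_2d_pt g x y.

Lemma section_continuous_l x y : continuous (fun u => g u y) x.
Proof.
  apply Rcont_eps. intros eps He. destruct (Hg x y (mkposreal eps He)) as [d Hd].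
  exists d. split; [apply d|]. intros u Hu. apply Hd; [assumption|].
  rewrite Rminus_eq_0, Rabs_R0. apply d.
Qed.

Lemma RInt_param_continuous a b y : continuous (fun v => RInt (fun x => g x v) a b) y.
Proof.
  assert (K : forall a b, a <= b -> continuous (fun v => RInt (fun x => g x v) a b) y).
  { clear a b. intros a b Hab. apply Rcont_eps. intros eps He.
    destruct (uniform_continuity_2d_1d g a b y (fun x _ => Hg x y) (mkposreal (eps / (b - a + 1))
        ltac:(apply Rdiv_lt_0_compat; lra))) as [d Hd].
    exists d. split; [apply d|]. intros v Hv.
    rewrite <- (RInt_minus (V := R_CompleteNormedModule) (fun x => g x v) (fun x => g x y));
      try (apply ex_RInt_cont; [assumption|]; intros; apply section_continuous_l).
    apply Rle_lt_trans with (eps / (b - a + 1) * (b - a)).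
    - apply RInt_bound; [assumption| |].
      + intros t _. apply (continuous_minus (fun x => g x v) (fun x => g x y));
          apply section_continuous_l.
      + intros t Ht. left. apply (Hd t y t v); try assumption.
        * assert (P := cond_pos d). lra.
        * apply Rabs_lt_between in Hv. lra.
        * rewrite Rminus_eq_0, Rabs_R0. apply d.
    - apply Rlt_le_trans with (eps / (b - a + 1) * (b - a + 1)).
      + apply Rmult_lt_compat_l; [apply Rdiv_lt_0_compat; lra|lra].
      + right. field. lra. }
  destruct (Rle_lt_dec a b) as [H|H]; [now apply K|].
  apply (continuous_ext (fun v => - RInt (fun x => g x v) b a)).
  { intros v. apply (opp_RInt_swap (V := R_CompleteNormedModule)).
    apply ex_RInt_cont; [lra|]. intros; apply section_continuous_l. }
  apply (continuous_opp (fun v => RInt (fun x => g x v) b a)). apply K. lra.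
Qed.

Lemma is_derive_iterated_l a c d t :
  is_derive (fun u => RInt (fun y => RInt (fun x => g x y) a u) c d) t (RInt (fun y => g t y) c
      d).
Proof.
  assert (D : forall u v, is_derive (fun z => RInt (fun x => g x v) a z) u (g u v)).
  { intros u v. apply (is_derive_RInt (V := R_NormedModule) (fun x => g x v) _ a).
    - apply filter_forall. intros z. apply (RInt_correct (V := R_CompleteNormedModule)).
      apply (ex_RInt_continuous (V := R_CompleteNormedModule)).
      intros; apply section_continuous_l.
    - apply section_continuous_l. }
  assert (E : RInt (fun y => g t y) c d
      = RInt (fun y => Derive (fun u => RInt (fun x => g x y) a u) t) c d).
  { apply RInt_ext. intros y _. symmetry. now apply is_derive_unique. }
  rewrite E. apply (is_derive_RInt_param (fun u y => RInt (fun x => g x y) a u)).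
  - apply filter_forall. intros u v _. eexists. apply D.
  - intros y _. apply continuity_2d_pt_ext with g; [|apply Hg].
    intros u v. symmetry. now apply is_derive_unique.
  - apply filter_forall. intros u. apply (ex_RInt_continuous (V := R_CompleteNormedModule)).
    intros z _. apply RInt_param_continuous.
Qed.

End Fubini.

Lemma continuity_2d_pt_swap g x y : continuity_2d_pt g x y ->
    continuity_2d_pt (fun u v => g v u) y x.
Proof.
  intros H eps. destruct (H eps) as [d Hd]. exists d. intros u v Hu Hv. now apply Hd.
Qed.

(** As functions of the upper limit b, both iterated integrals have the derivative
    [RInt (fun y => g b y) c d], and both vanish at b = a. *)
Lemma RInt_fubini (g : R -> R -> R) a b c d : a <= b -> (forall x y, continuity_2d_pt g x y) ->
  RInt (fun x => RInt (fun y => g x y) c d) a b = RInt (fun y => RInt (fun x => g x y) a b) c d.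
Proof.
  intros Hab Hg. destruct Hab as [Hab| <-].
  2:{ rewrite RInt_point. rewrite (RInt_ext _ (fun _ => 0)).
      - rewrite RInt_const. unfold scal; simpl; unfold mult; simpl. unfold zero; simpl. ring.
      - intros x _. apply (RInt_point (V := R_CompleteNormedModule)). }
  assert (D1 : forall t, is_derive (fun t => RInt (fun x => RInt (fun y => g x y) c d) a t) t
      (RInt (fun y => g t y) c d)).
  { assert (Cx : forall x, continuous (fun x => RInt (fun y => g x y) c d) x).
    { intros x. apply (RInt_param_continuous (fun y x => g x y)).
      intros; now apply continuity_2d_pt_swap. }
    intros t. apply (is_derive_RInt (V := R_NormedModule) (fun x => RInt (fun y => g x y) c d) _
        a); [|apply Cx].
    apply filter_forall. intros z. apply (RInt_correct (V := R_CompleteNormedModule)).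
    apply (ex_RInt_continuous (V := R_CompleteNormedModule)). intros; apply Cx. }
  set (F := fun t => RInt (fun x => RInt (fun y => g x y) c d) a t - RInt (fun y => RInt (fun x
      => g x y) a t) c d).
  assert (E : F a = F b).
  { apply (eq_is_derive (V := R_NormedModule) F); [|assumption].
    intros t _.
    assert (D := is_derive_minus (V := R_NormedModule) _ _ t _ _ (D1 t) (is_derive_iterated_l g
        Hg a c d t)).
    assert (Z : forall X : R, minus (G := R_NormedModule) X X = zero) by (intros X;
      apply (minus_eq_zero (G := R_NormedModule))).
    now rewrite Z in D. }
  assert (Ea : F a = 0).
  { unfold F. rewrite RInt_point.
    rewrite (RInt_ext (fun y => RInt (fun x => g x y) a a) (fun _ => 0)).
    - rewrite RInt_const. unfold scal, zero; simpl; unfold mult; simpl. ring.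
    - intros x _. apply (RInt_point (V := R_CompleteNormedModule)). }
  rewrite Ea in E. unfold F in E. lra.
Qed.

Definition continuity_2d_C (g : R -> R ->
    C) : Prop := forall x y, Ccontinuous (fun p : R * R => g (fst p) (snd p)) (x, y).

Lemma continuity_2d_C_Re g : continuity_2d_C g ->
    forall x y, continuity_2d_pt (fun u v => Re (g u v)) x y.
Proof. intros H x y. apply continuity_2d_pt_filterlim. exact (proj1 (H x y)). Qed.

Lemma continuity_2d_C_Im g : continuity_2d_C g ->
    forall x y, continuity_2d_pt (fun u v => Im (g u v)) x y.
Proof. intros H x y. apply continuity_2d_pt_filterlim. exact (proj2 (H x y)). Qed.

Lemma CInt_fubini (g : R -> R -> C) a b c d : a <= b -> continuity_2d_C g ->
  CInt (fun x => CInt (fun y => g x y) c d) a b = CInt (fun y => CInt (fun x => g x y) a b) c d.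
Proof.
  intros Hab Hg. unfold CInt. cbn [Re Im fst snd]. f_equal.
  - apply (RInt_fubini (fun x y => Re (g x y))); [assumption|]. now apply continuity_2d_C_Re.
  - apply (RInt_fubini (fun x y => Im (g x y))); [assumption|]. now apply continuity_2d_C_Im.
Qed.

Lemma continuity_2d_C_int g a b : continuity_2d_C g ->
    forall y, Ccontinuous (fun y => CInt (fun x => g x y) a b) y.
Proof.
  intros H y. split.
  - exact (RInt_param_continuous _ (continuity_2d_C_Re g H) a b y).
  - exact (RInt_param_continuous _ (continuity_2d_C_Im g H) a b y).
Qed.

Lemma path_deriv_cis (k t : R) : path_deriv (fun u => cis (k * u)) t (RtoC k * Ci * cis (k *
    t))%C.
Proof.
  unfold cis, Cexp. split; unfold Re, Im, Cmult, Ci, RtoC; cbn [fst snd]; auto_derive; auto;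
    rewrite exp_0; ring.
Qed.

(** The Taylor coefficients of e^(w z).  The case n = 0 is the mean value
    property, and integrating the derivative of exp(w e^(it)) e^(-i(n+1)t) over a
    period relates the n-th and the (n+1)-st coefficient. *)
Lemma exp_cis_coef (w : R) (n : nat) :
  CInt (fun t => Cexp (RtoC w * cis t) * cis (- INR n * t))%C 0 (2 * PI) =
  RtoC (2 * PI * (w ^ n / INR (fact n))).
Proof.
  assert (HP := PI_RGT_0).
  assert (Hc : forall m t, Ccontinuous (fun t => Cexp (RtoC w * cis t) * cis (- INR m * t))%C t).
  { intros m t. apply Ccontinuous_mult; [|apply Ccontinuous_cis]. apply Ccontinuous_Cexp.
    apply Ccontinuous_mult; [apply Ccontinuous_const|].
    unfold cis. apply Ccontinuous_Cexp. eapply path_deriv_Ccont, path_deriv_vertical. }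
  induction n as [|n IH].
  - assert (M := circle_mean_value (fun z => Cexp (RtoC w * z)%C) 0 1 2 ltac:(lra)).
    cbv beta in M. rewrite Cmult_0_r, Cexp_0, Cmult_1_r in M.
    simpl fact. simpl pow. simpl INR. replace (2 * PI * (1 / 1)) with (2 * PI) by field.
    rewrite <- M.
    + apply CInt_ext; [lra|]. intros t _. unfold circ. rewrite Cplus_0_l, Cmult_1_l.
      replace (- 0 * t) with 0 by ring. unfold cis at 2. change ((0, 0) : C) with (RtoC 0).
      rewrite Cexp_0. ring.
    + intros z _. apply (Cdiff_comp Cexp (fun z => RtoC w * z)%C); eexists;
        [apply Cderiv_Cexp|cderiv].
  - assert (F := CInt_FTC (fun t => Cexp (RtoC w * cis t) * cis (- INR (S n) * t))%C
      (fun t => Ci * (RtoC w * (Cexp (RtoC w * cis t) * cis (- INR n * t)) -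
                 RtoC (INR (S n)) * (Cexp (RtoC w * cis t) * cis (- INR (S n) * t))))%C 0 (2 *
                     PI) ltac:(lra)).
    assert (Hc2 : forall m c t, Ccontinuous (fun t => RtoC c * (Cexp (RtoC w * cis t) * cis (-
        INR m * t)))%C t).
    { intros m c t. apply Ccontinuous_mult; [apply Ccontinuous_const|apply Hc]. }
    rewrite CInt_Cmult in F; [|lra|intros t _; apply Ccontinuous_minus; apply Hc2].
    rewrite CInt_minus in F; [|lra|intros t _; apply Hc2|intros t _; apply Hc2].
    rewrite !CInt_Cmult in F; try lra; try (intros t _; apply Hc).
    rewrite IH in F.
    assert (P : (Cexp (RtoC w * cis (2 * PI)) * cis (- INR (S n) * (2 * PI)) - Cexp (RtoC w * cis
        0) * cis (- INR (S n) * 0) = 0)%C).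
    { assert (E1 : cis (2 * PI) = cis 0) by (unfold cis, Cexp, Re, Im; simpl;
        now rewrite cos_2PI, sin_2PI, cos_0, sin_0).
      assert (E2 : cis (- INR (S n) * (2 * PI)) = cis (- INR (S n) * 0)).
      { unfold cis. rewrite Cexp_2PI. do 2 f_equal. ring. }
      rewrite E1, E2. ring. }
    rewrite P in F. clear P.
    set (J := CInt (fun t => Cexp (RtoC w * cis t) * cis (- INR (S n) * t))%C 0 (2 * PI)) in *.
    assert (F1 : (RtoC w * RtoC (2 * PI * (w ^ n / INR (fact n))) - RtoC (INR (S n)) * J)%C
        = RtoC 0).
    { match goal with |- ?x = _ => replace x with (- Ci * (Ci * x))%C end.
      - rewrite F; [ring| |].
        + intros t _. eapply path_deriv_eq.
          * apply path_deriv_mult; [|apply path_deriv_cis].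
            apply (path_deriv_comp Cexp (fun t => RtoC w * cis t)%C); [apply Cderiv_Cexp|].
            apply path_deriv_mult; [|].
            -- apply path_deriv_const.
            -- assert (C1 := path_deriv_cis 1 t). rewrite Rmult_1_l in C1.
               destruct C1 as [C1 C2]. split; (eapply is_derive_ext; [|eassumption]); intros u;
                 cbv beta; now rewrite Rmult_1_l.
          * cbv beta. assert (E : cis (- INR n * t) = (cis t * cis (- INR (S n) * t))%C).
            { unfold cis. rewrite <- Cexp_plus. f_equal. rewrite S_INR. unfold Cplus; simpl.
              f_equal; ring. }
            rewrite E, RtoC_opp. change (Re 0) with 0. change (Im 0) with 0. ring.
        + intros t _. apply Ccontinuous_mult; [apply Ccontinuous_const|].
          apply Ccontinuous_minus; apply Hc2.
      - rewrite Cmult_assoc. replace (- Ci * Ci)%C with (RtoC 1)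
          by (unfold Ci, RtoC, Cmult, Copp; simpl; f_equal; ring). ring. }
    assert (NS : INR (S n) <> 0) by (apply not_0_INR; lia).
    assert (NSC : RtoC (INR (S n)) <> RtoC 0) by (intros E; now apply RtoC_inj in E).
    transitivity (/ RtoC (INR (S n)) * (RtoC w * RtoC (2 * PI * (w ^ n / INR (fact n)))))%C.
    + replace (RtoC w * RtoC (2 * PI * (w ^ n / INR (fact n))))%C with (RtoC (INR (S n)) * J)%C.
      * field. exact NSC.
      * replace (RtoC (INR (S n)) * J)%C with (RtoC w * RtoC (2 * PI * (w ^ n / INR (fact n))) -
            (RtoC w * RtoC (2 * PI * (w ^ n / INR (fact n))) - RtoC (INR (S n)) * J))%C by ring.
        rewrite F1. ring.
    + rewrite <- RtoC_inv, <- !RtoC_mult by assumption. f_equal.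
      rewrite fact_simpl, mult_INR. simpl pow. field. split; [apply INR_fact_neq_0|assumption].
Qed.

(** * Partial sums of the exponential series *)

Definition exp_sum (N : nat) (u : R) : R := sum_f_R0 (fun n => u ^ n / INR (fact n)) N.

Lemma exp_sum_derive N u : is_derive (exp_sum (S N)) u (exp_sum N u).
Proof.
  induction N as [|N IH].
  - unfold exp_sum. simpl. auto_derive; auto. field.
  - apply (is_derive_ext (fun u => exp_sum (S N) u + u ^ (S (S N)) / INR (fact (S (S N))))).
    { intros t. reflexivity. }
    change (exp_sum (S N) u) with (exp_sum N u + u ^ (S N) / INR (fact (S N))).
    apply (is_derive_plus (V := R_NormedModule) (exp_sum (S N)) (fun u => u ^ (S (S N)) / INR
        (fact (S (S N))))); [exact IH|].
    assert (F1 := INR_fact_neq_0 (S N)).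
    assert (F2 : INR (S (S N)) <> 0) by (apply not_0_INR; lia).
    apply (is_derive_ext (fun u => / INR (fact (S (S N))) * u ^ (S (S N)))); [intros t;
      apply Rmult_comm|].
    replace (u ^ S N / INR (fact (S N))) with (/ INR (fact (S (S N))) * (INR (S (S N)) * u ^ S
        N)).
    + apply is_derive_scal, is_derive_Reals. apply (derivable_pt_lim_pow u (S (S N))).
    + rewrite (fact_simpl (S N)), mult_INR. field. now split.
Qed.

(** Monotonicity of the remainder makes the convergence uniform on [0, U]. *)
Lemma exp_rem_mono N u v : 0 <= u -> u <= v -> 0 <= exp u - exp_sum N u <= exp v - exp_sum N v.
Proof.
  revert u v. induction N as [|N IH]; intros u v Hu Huv.
  - unfold exp_sum; simpl. assert (exp 0 <= exp u) by now apply exp_le_compat. rewrite exp_0 in H.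
    assert (exp u <= exp v) by now apply exp_le_compat. lra.
  - assert (K : forall u v, 0 <= u -> u <= v ->
        exp u - exp_sum (S N) u <= exp v - exp_sum (S N) v).
    { clear u v Hu Huv. intros u v Hu Huv.
      destruct (MVT_gen (fun u => exp u - exp_sum (S N) u) u v (fun u => exp u - exp_sum N u)) as
          [c [Hc E]].
      - intros x _. apply (is_derive_minus (V := R_NormedModule) exp (exp_sum (S N))).
        + apply is_derive_Reals, derivable_pt_lim_exp.
        + apply exp_sum_derive.
      - intros x _. apply continuity_pt_filterlim.
        apply (ex_derive_continuous (fun u => exp u - exp_sum (S N) u)). eexists.
        apply (is_derive_minus (V := R_NormedModule) exp (exp_sum (S N))).
        + apply is_derive_Reals, derivable_pt_lim_exp.
        + apply exp_sum_derive.
      - rewrite Rmin_left, Rmax_right in Hc by assumption.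
        destruct (IH c c ltac:(lra) ltac:(lra)) as [I _]. nra. }
    split; [|now apply K].
    assert (K0 := K 0 u ltac:(lra) Hu).
    assert (E0 : exp_sum (S N) 0 = 1).
    { clear. induction N as [|N IH].
      - unfold exp_sum. simpl. field.
      - change (exp_sum (S (S N)) 0) with (exp_sum (S N) 0 + 0 ^ (S (S N)) / INR (fact (S (S
            N)))).
        rewrite IH, pow_i by lia. unfold Rdiv. ring. }
    rewrite exp_0, E0 in K0. lra.
Qed.

Lemma exp_rem_small U eta : 0 < eta -> exists N, exp U - exp_sum N U <= eta.
Proof.
  intros He. assert (P := is_exp_Reals U). apply is_pseries_Reals in P.
  destruct (P eta He) as [N HN]. exists N. specialize (HN N (le_n N)).
  unfold Rdist in HN.
  replace (sum_f_R0 (fun n => / INR (fact n) * U ^ n) N) with (exp_sum N U) in HN.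
  - apply Rabs_lt_between in HN. lra.
  - apply sum_eq. intros i _. unfold Rdiv. ring.
Qed.

(** * Landau's theorem for Mellin transforms *)

(** [mellin_integrand] with the density abstracted: convergence, holomorphy and
    Landau's theorem depend on it only through its continuity and its sign. *)
Definition mellin_kernel (f : R -> R) (s : C) (x : R) : C := (RtoC (f x) * cpow x (- s))%C.

Lemma continuous_Rpower (b x : R) : 0 < x -> continuous (fun u => Rpower u b) x.
Proof.
  intros Hx. apply (ex_derive_continuous (fun u => Rpower u b)). unfold Rpower. auto_derive.
  assumption.
Qed.

Lemma mellin_kernel_cont f s x : continuous f x -> 0 < x -> Ccontinuous (mellin_kernel f s) x.
Proof.
  intros Hf Hx. apply Ccontinuous_mult; [now apply Ccontinuous_RtoC|].
  eapply path_deriv_Ccont, path_deriv_cpow, Hx.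
Qed.

Lemma Cmod_mellin_kernel f s x : 0 <= f x -> Cmod (mellin_kernel f s x) = f x * Rpower x (- Re s).
Proof.
  intros H. unfold mellin_kernel. rewrite Cmod_mult, Cmod_R, Cmod_cpow, Rabs_right by lra.
  reflexivity.
Qed.

Definition mellin_bounded (f : R -> R) (sigma : R) : Prop :=
  exists B, forall X, 1 <= X -> RInt (fun x => f x * Rpower x (- sigma)) 1 X <= B.

Lemma ln_nonneg x : 1 <= x -> 0 <= ln x.
Proof. intros H. rewrite <- ln_1. apply Rcomplements.ln_le; lra. Qed.

Lemma ln_le_Rpower (x eps : R) : 1 <= x -> 0 < eps -> ln x <= / eps * Rpower x eps.
Proof.
  intros Hx He. apply Rmult_le_reg_l with eps; [assumption|].
  rewrite <- Rmult_assoc, Rinv_r, Rmult_1_l by lra.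
  unfold Rpower. assert (H := exp_ineq1_le (eps * ln x)). lra.
Qed.

Lemma continuous_ln_clamped x : continuous (fun x => ln (Rmax 1 x)) x.
Proof.
  apply (continuous_comp (fun x => Rmax 1 x) ln).
  - apply Rcont_eps. intros eps He. exists eps. split; [assumption|].
    intros u Hu. apply Rle_lt_trans with (Rabs (u - x)); [|assumption].
    unfold Rmax. repeat destruct Rle_dec; unfold Rabs; repeat destruct Rcase_abs; lra.
  - apply continuous_ln. eapply Rlt_le_trans; [apply Rlt_0_1|apply Rmax_l].
Qed.

Section Landau.
Variable f : R -> R.
Hypothesis Hf : forall x, continuous f x.
Hypothesis Hf0 : forall x, 0 <= f x.

Lemma weight_cont sigma x : 0 < x -> continuous (fun x => f x * Rpower x (- sigma)) x.
Proof. intros Hx. apply continuous_Rmult; [apply Hf|now apply continuous_Rpower]. Qed.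

Lemma weight_nonneg sigma x : 0 <= f x * Rpower x (- sigma).
Proof. apply Rmult_le_pos; [apply Hf0|left; apply Rpower_pos]. Qed.

Lemma mellin_bounded_mono s1 s2 : s1 <= s2 -> mellin_bounded f s1 -> mellin_bounded f s2.
Proof.
  intros H [B HB]. exists B. intros X HX. eapply Rle_trans; [|now apply (HB X)].
  apply RInt_le; [assumption| | |].
  - apply ex_RInt_cont; [assumption|]. intros x Hx. apply weight_cont. lra.
  - apply ex_RInt_cont; [assumption|]. intros x Hx. apply weight_cont. lra.
  - intros x Hx. apply Rmult_le_compat_l; [apply Hf0|]. apply Rpower_le_exp; lra.
Qed.

(** Truncated at X, this is (-1)^n times the n-th Taylor coefficient at a of the
    transform. *)
Definition log_moment (a : R) (n : nat) (X : R) : R :=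
  RInt (fun x => f x * Rpower x (- a) * (ln x ^ n / INR (fact n))) 1 X.

Lemma log_weight_cont a n x : 0 < x ->
    continuous (fun x => f x * Rpower x (- a) * (ln x ^ n / INR (fact n))) x.
Proof.
  intros Hx. apply continuous_Rmult; [now apply weight_cont|].
  apply (ex_derive_continuous (fun x => ln x ^ n / INR (fact n))). auto_derive. assumption.
Qed.

Lemma log_weight_nonneg a n x : 1 <= x -> 0 <= f x * Rpower x (- a) * (ln x ^ n / INR (fact n)).
Proof.
  intros Hx. apply Rmult_le_pos; [apply weight_nonneg|]. apply Rmult_le_pos.
  - apply pow_le, ln_nonneg, Hx.
  - left. apply Rinv_0_lt_compat, INR_fact_lt_0.
Qed.

Lemma log_moment_mono a n X Y : 1 <= X -> X <= Y -> log_moment a n X <= log_moment a n Y.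
Proof.
  intros HX HY. apply RInt_nonneg_le; try assumption; intros x Hx.
  - apply log_weight_cont; lra.
  - apply log_weight_nonneg; lra.
Qed.

(** The integrand of the n-th Fourier coefficient of the truncated transform on the
    circle of radius 1/2 about a.  The logarithm is clamped to make it continuous
    on the whole plane, as Fubini's theorem requires. *)
Definition circle_integrand (a : R) (n : nat) (x t : R) : C :=
  (RtoC (f x) * Cexp (- RtoC (ln (Rmax 1 x)) * circ (RtoC a) (1 / 2) t) * cis (- INR n * t))%C.

Lemma circle_integrand_cont a n : continuity_2d_C (circle_integrand a n).
Proof.
  intros x y. unfold circle_integrand. apply Ccontinuous_mult; [apply Ccontinuous_mult|].
  - apply Ccontinuous_RtoC. apply (continuous_comp fst f); [apply continuous_fst|apply Hf].
  - apply Ccontinuous_Cexp, Ccontinuous_mult.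
    + apply Ccontinuous_opp, Ccontinuous_RtoC.
      apply (continuous_comp fst (fun x => ln (Rmax 1 x)));
        [apply continuous_fst|apply continuous_ln_clamped].
    + apply (Ccontinuous_comp_R (circ a (1 / 2)) snd);
        [apply Ccontinuous_circ|apply continuous_snd].
  - apply (Ccontinuous_comp_R (fun t => cis (- INR n * t)) snd);
      [apply Ccontinuous_cis|apply continuous_snd].
Qed.

Lemma circle_integrand_x a n x t : 1 <= x ->
  circle_integrand a n x t = (cis (- INR n * t) * mellin_kernel f (circ (RtoC a) (1 / 2) t) x)%C.
Proof.
  intros Hx. unfold circle_integrand, mellin_kernel. rewrite Rmax_right, cpow_Cexp by assumption.
  replace (RtoC (ln x) * - circ (RtoC a) (1 / 2) t)%C with (- RtoC (ln x) * circ (RtoC a) (1 / 2)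
      t)%C by ring.
  ring.
Qed.

Lemma circle_integrand_t a n x t : 1 <= x ->
  circle_integrand a n x t = (RtoC (f x * Rpower x (- a)) * (Cexp (RtoC (- (1 / 2) * ln x) * cis
      t) * cis (- INR n * t)))%C.
Proof.
  intros Hx. unfold circle_integrand. rewrite Rmax_right by assumption.
  assert (E : Cexp (- RtoC (ln x) * circ a (1 / 2) t)
      = (RtoC (Rpower x (- a)) * Cexp (RtoC (- (1 / 2) * ln x) * cis t))%C).
  { rewrite <- cpow_RtoC, cpow_Cexp, <- Cexp_plus. f_equal. unfold circ.
    rewrite RtoC_mult, !RtoC_opp. ring. }
  rewrite E, (RtoC_mult (f x)). ring.
Qed.

Lemma circle_integrand_moment a n X : 1 <= X ->
  Cmod (CInt (fun t => CInt (fun x => circle_integrand a n x t) 1 X) 0 (2 * PI)) =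
  2 * PI * (1 / 2) ^ n * log_moment a n X.
Proof.
  intros HX. assert (HP := PI_RGT_0).
  rewrite <- (CInt_fubini (circle_integrand a n)) by (assumption || apply circle_integrand_cont).
  rewrite (CInt_ext _ (fun x => RtoC (2 * PI * (- (1 / 2)) ^ n) * RtoC (f x * Rpower x (- a) *
      (ln x ^ n / INR (fact n))))%C).
  - rewrite CInt_Cmult; [|assumption|].
    + rewrite CInt_RtoC. fold (log_moment a n X). rewrite Cmod_mult, !Cmod_R.
      rewrite Rabs_mult, <- RPow_abs, Rabs_Ropp, (Rabs_right (1 / 2)), (Rabs_right (2 * PI))
        by lra.
      rewrite (Rabs_right (log_moment a n X)); [reflexivity|].
      apply Rle_ge. apply RInt_ge_0; [assumption| |].
      * apply ex_RInt_cont; [assumption|]. intros t Ht. apply log_weight_cont. lra.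
      * intros x Hx. apply log_weight_nonneg. lra.
    + intros t Ht. apply Ccontinuous_RtoC, log_weight_cont. lra.
  - assumption.
  - intros x Hx.
    rewrite (CInt_ext _ (fun t => RtoC (f x * Rpower x (- a)) * (Cexp (RtoC (- (1 / 2) * ln x) *
        cis t) * cis (- INR n * t)))%C);
      [|lra|intros t _; apply circle_integrand_t; lra].
    rewrite CInt_Cmult; [|lra|].
    + rewrite exp_cis_coef, <- !RtoC_mult. f_equal. rewrite Rpow_mult_distr. field.
      apply INR_fact_neq_0.
    + intros t _. apply Ccontinuous_mult; [|apply Ccontinuous_cis]. apply Ccontinuous_Cexp.
      apply Ccontinuous_mult; [apply Ccontinuous_const|]. unfold cis. apply Ccontinuous_Cexp.
      eapply path_deriv_Ccont, path_deriv_vertical.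
Qed.

Lemma Re_circ_ge a t : a - 1 <= Re (circ (RtoC a) (1 / 2) t).
Proof.
  assert (B := COS_bound t). unfold circ, cis, Cexp, Re, Im, Cplus, Cmult, RtoC; cbn [fst snd].
  rewrite exp_0. lra.
Qed.

(** Cauchy's estimate.  On the circle of radius 1/2 the transform is given by the
    integral, which identifies its Fourier coefficients with the logarithmic
    moments; [circle_coef_scaling] transports them to radius r, where the transform
    is only known to be holomorphic. *)
Lemma log_moment_bound (Z : C -> C) (a r rho : R) : mellin_bounded f (a - 1) -> 1 / 2 <= r ->
    r < rho ->
  (forall s, Cmod (s - RtoC a)%C < rho -> Cdiff Z s) ->
  (forall t, is_improper (mellin_kernel f (circ (RtoC a) (1 / 2) t)) (Z (circ (RtoC a) (1 / 2)
      t))) ->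
  exists M, 0 <= M /\ forall n X, 1 <= X -> log_moment a n X <= M / r ^ n.
Proof.
  intros Hb Hr Hrho HZ HI. assert (HP := PI_RGT_0).
  destruct (bounded_sup _ Hb) as [S [HS1 HS2]].
  destruct (circle_sup Z (RtoC a) r) as [M [HM0 HM]].
  { intros t. apply HZ. rewrite Cmod_circ; lra. }
  exists M. split; [assumption|]. intros n X HX.
  assert (HI2 : Cmod (circle_coef Z (RtoC a) n (1 / 2)) <= 2 * PI * (1 / 2) ^ n * (M / r ^ n)).
  { assert (Sc := circle_coef_scaling Z (RtoC a) n (1 / 2) r rho ltac:(lra) Hr Hrho HZ).
    apply (f_equal Cmod) in Sc. rewrite !Cmod_mult, !Cmod_R in Sc.
    assert (P1 : 0 < (1 / 2) ^ n) by (apply pow_lt; lra).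
    assert (P2 : 0 < r ^ n) by (apply pow_lt; lra).
    rewrite !Rabs_right in Sc by lra.
    assert (Bd := circle_coef_bound Z (RtoC a) n r M ltac:(lra) ltac:(intros t; apply HZ;
      rewrite Cmod_circ; lra) HM).
    apply Rmult_le_reg_l with (r ^ n); [assumption|]. rewrite <- Sc.
    replace (r ^ n * (2 * PI * (1 / 2) ^ n * (M / r ^ n))) with ((1 / 2) ^ n * (M * (2 * PI)))
      by (field; lra).
    apply Rmult_le_compat_l; lra. }
  assert (Hclose : forall Y, 1 <= Y ->
    Cmod (circle_coef Z (RtoC a) n (1 / 2) - CInt (fun t => CInt (fun x => circle_integrand a n x
        t) 1 Y) 0 (2 * PI))%C
     <= (S - RInt (fun x => f x * Rpower x (- (a - 1))) 1 Y) * (2 * PI - 0)).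
  { intros Y HY. unfold circle_coef.
    assert (C1 : Ccontinuous_on (fun t => Z (circ a (1 / 2) t) * cis (- INR n * t))%C 0 (2 * PI)).
    { intros t _. apply Ccontinuous_mult; [|apply Ccontinuous_cis].
      apply Ccontinuous_comp; [|apply Ccontinuous_circ].
      apply HZ. rewrite Cmod_circ; lra. }
    assert (C2 : Ccontinuous_on (fun t => CInt (fun x => circle_integrand a n x t) 1 Y) 0 (2 *
        PI)).
    { intros t _. apply continuity_2d_C_int, circle_integrand_cont. }
    rewrite <- CInt_minus by (assumption || lra).
    apply CInt_bound; [lra| |].
    - intros t Ht. apply Ccontinuous_minus; [now apply C1|now apply C2].
    - intros t _.
      rewrite (CInt_ext (fun x => circle_integrand a n x t) (fun x => cis (- INR n * t) *
          mellin_kernel f (circ (RtoC a) (1 / 2) t) x)%C);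
        [|assumption|intros x Hx; apply circle_integrand_x; lra].
      rewrite CInt_Cmult; [|assumption|intros x Hx; apply mellin_kernel_cont; [apply Hf|lra]].
      replace (Z (circ a (1 / 2) t) * cis (- INR n * t) - cis (- INR n * t) * CInt (mellin_kernel
          f (circ a (1 / 2) t)) 1 Y)%C
        with (cis (- INR n * t) * (Z (circ a (1 / 2) t) - CInt (mellin_kernel f (circ a (1 / 2)
            t)) 1 Y))%C by ring.
      rewrite Cmod_mult, Cmod_cis, Rmult_1_l.
      assert (HC : forall x, 1 <= x -> Ccontinuous (mellin_kernel f (circ a (1 / 2) t)) x).
      { intros x Hx. apply mellin_kernel_cont; [apply Hf|lra]. }
      destruct (improper_dominated (mellin_kernel f (circ a (1 / 2) t)) (fun x => f x * Rpower x
          (- (a - 1))) S) as [l [Hl1 Hl2]].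
      + exact HC.
      + intros x Hx. apply weight_cont. lra.
      + intros x Hx. rewrite Cmod_mellin_kernel by apply Hf0.
        apply Rmult_le_compat_l; [apply Hf0|]. apply Rpower_le_exp; [assumption|].
        assert (B := Re_circ_ge a t). lra.
      + exact HS1.
      + rewrite (improper_unique _ _ l HC (HI t) Hl1). now apply Hl2. }
  assert (P1 : 0 < (1 / 2) ^ n) by (apply pow_lt; lra).
  apply Rnot_lt_le. intros Hlt.
  set (eta := (log_moment a n X - M / r ^ n) * (1 / 2) ^ n / 2).
  assert (Heta : 0 < eta) by (unfold eta; apply Rdiv_lt_0_compat; [apply Rmult_lt_0_compat|];
    lra).
  destruct (HS2 eta Heta) as [X0 [HX0 HX0']].
  set (Y := Rmax X X0). assert (HY1 : X <= Y) by apply Rmax_l.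
  assert (HY2 : X0 <= Y) by apply Rmax_r.
  assert (G1 : RInt (fun x => f x * Rpower x (- (a - 1))) 1 X0
      <= RInt (fun x => f x * Rpower x (- (a - 1))) 1 Y).
  { apply RInt_nonneg_le; try assumption; intros x Hx; [apply weight_cont;
      lra|apply weight_nonneg]. }
  specialize (Hclose Y ltac:(lra)).
  assert (T := Cmod_triangle (- (circle_coef Z a n (1 / 2) - CInt (fun t => CInt (fun x =>
      circle_integrand a n x t) 1 Y) 0 (2 * PI))) (circle_coef Z a n (1 / 2))).
  assert (EC : forall A B : C, (- (A - B) + A)%C = B) by (intros; ring).
  rewrite EC in T.
  rewrite Cmod_opp, circle_integrand_moment in T by lra.
  assert (Mo := log_moment_mono a n X Y HX HY1).
  assert (T2 : 2 * PI * (1 / 2) ^ n * log_moment a n X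
      <= 2 * PI * (eta + (1 / 2) ^ n * (M / r ^ n))).
  { apply Rle_trans with (2 * PI * (1 / 2) ^ n * log_moment a n Y).
    - apply Rmult_le_compat_l; [nra|assumption].
    - eapply Rle_trans; [exact T|].
      assert ((S - RInt (fun x => f x * Rpower x (- (a - 1))) 1 Y) * (2 * PI - 0)
          <= eta * (2 * PI)).
      { rewrite Rminus_0_r. apply Rmult_le_compat_r; lra. }
      lra. }
  assert (T3 : (1 / 2) ^ n * log_moment a n X <= eta + (1 / 2) ^ n * (M / r ^ n)).
  { apply Rmult_le_reg_l with (2 * PI); lra. }
  unfold eta in T3, Heta. lra.
Qed.

Lemma exp_sum_integral a y M r N X : 0 <= y -> 0 < r -> 1 <= X ->
  (forall n, log_moment a n X <= M / r ^ n) ->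
  RInt (fun x => f x * Rpower x (- a) * exp_sum N (y * ln x)) 1 X
      <= M * sum_f_R0 (fun n => (y / r) ^ n) N.
Proof.
  intros Hy Hr HX Hb.
  assert (St : forall n, ex_RInt (fun x => f x * Rpower x (- a) * ((y * ln x) ^ n / INR (fact
      n))) 1 X /\
     RInt (fun x => f x * Rpower x (- a) * ((y * ln x) ^ n / INR (fact n))) 1 X
         <= M * (y / r) ^ n).
  { intros n.
    assert (Ex : ex_RInt (fun x => f x * Rpower x (- a) * (ln x ^ n / INR (fact n))) 1 X).
    { apply ex_RInt_cont; [assumption|]. intros t Ht. apply log_weight_cont. lra. }
    assert (Is := is_RInt_scal (V := R_NormedModule) _ 1 X (y ^ n) _ (RInt_correct (V :=
        R_CompleteNormedModule) _ 1 X Ex)).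
    assert (Is2 : is_RInt (fun x => f x * Rpower x (- a) * ((y * ln x) ^ n / INR (fact n))) 1 X
        (y ^ n * log_moment a n X)).
    { eapply is_RInt_ext; [|exact Is]. intros x _. unfold scal; simpl; unfold mult; simpl.
      rewrite Rpow_mult_distr. unfold Rdiv. ring. }
    split; [eexists; exact Is2|].
    rewrite (is_RInt_unique _ _ _ _ Is2).
    apply Rle_trans with (y ^ n * (M / r ^ n)); [apply Rmult_le_compat_l;
      [now apply pow_le|apply Hb]|].
    right. unfold Rdiv. rewrite Rpow_mult_distr, pow_inv. ring. }
  assert (K : ex_RInt (fun x => f x * Rpower x (- a) * exp_sum N (y * ln x)) 1 X /\
   RInt (fun x => f x * Rpower x (- a) * exp_sum N (y * ln x)) 1 X
       <= M * sum_f_R0 (fun n => (y / r) ^ n) N).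
  { induction N as [|N [IH1 IH2]].
    - exact (St 0%nat).
    - destruct (St (S N)) as [S1 S2].
      assert (Is := is_RInt_plus (V := R_NormedModule) _ _ 1 X _ _ (RInt_correct (V :=
          R_CompleteNormedModule) _ 1 X IH1) (RInt_correct (V := R_CompleteNormedModule) _ 1 X
          S1)).
      assert (Is2 : is_RInt (fun x => f x * Rpower x (- a) * exp_sum (S N) (y * ln x)) 1 X
        (RInt (fun x => f x * Rpower x (- a) * exp_sum N (y * ln x)) 1 X +
         RInt (fun x => f x * Rpower x (- a) * ((y * ln x) ^ S N / INR (fact (S N)))) 1 X)).
      { eapply is_RInt_ext; [|exact Is]. intros x _.
        change (exp_sum (S N) (y * ln x)) with (exp_sum N (y * ln x) + (y * ln x) ^ S N / INR
            (fact (S N))).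
        unfold plus; simpl. ring. }
      split; [eexists; exact Is2|]. rewrite (is_RInt_unique _ _ _ _ Is2).
      rewrite tech5. lra. }
  apply K.
Qed.

(** Expand x^y = exp(y ln x).  All terms are nonnegative, so the partial sums are
    bounded by the geometric series M / (1 - y/r), uniformly in X; the remainder is
    small on [1, X] if enough terms are taken. *)
Lemma mellin_bounded_of_log_moments a y M r : 0 <= M -> 0 <= y < r ->
  (forall n X, 1 <= X -> log_moment a n X <= M / r ^ n) -> mellin_bounded f (a - y).
Proof.
  intros HM Hy Hb. exists (M / (1 - y / r) + 1). intros X HX.
  assert (Hyr : 0 <= y / r < 1).
  { split; [apply Rmult_le_pos; [lra|left; apply Rinv_0_lt_compat; lra]|].
    apply Rmult_lt_reg_r with r; [lra|]. unfold Rdiv. rewrite Rmult_assoc, Rinv_l by lra. lra. }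
  set (U := y * ln X).
  destruct (exp_rem_small U (/ (M + 1))) as [N HN]; [apply Rinv_0_lt_compat; lra|].
  set (e := exp U - exp_sum N U) in *.
  assert (H0 : RInt (fun x => f x * Rpower x (- a)) 1 X <= M).
  { assert (H := Hb 0%nat X HX). unfold log_moment in H. simpl pow in H. simpl fact in H.
    rewrite !Rdiv_1_r in H. eapply Rle_trans; [|exact H]. right. apply RInt_ext. intros x _.
    simpl. field. }
  assert (Hc1 : forall x, 1 <= x <= X ->
      continuous (fun x => f x * Rpower x (- a) * exp_sum N (y * ln x)) x).
  { intros x Hx. apply continuous_Rmult; [apply weight_cont; lra|].
    apply (continuous_comp (fun x => y * ln x) (exp_sum N)).
    - apply continuous_Rmult; [apply continuous_const|apply continuous_ln; lra].
    - destruct N as [|N].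
      + apply (continuous_ext (fun _ => 1)); [intros t; unfold exp_sum; simpl;
          field|apply continuous_const].
      + apply (ex_derive_continuous (exp_sum (S N))). eexists. apply exp_sum_derive. }
  assert (Hc2 : forall x, 1 <= x <= X -> continuous (fun x => e * (f x * Rpower x (- a))) x).
  { intros x Hx. apply continuous_Rmult; [apply continuous_const|apply weight_cont; lra]. }
  assert (E1 := exp_sum_integral a y M r N X ltac:(lra) ltac:(lra) HX (fun n => Hb n X HX)).
  apply Rle_trans with (RInt (fun x => f x * Rpower x (- a) * exp_sum N (y * ln x) + e * (f x *
      Rpower x (- a))) 1 X).
  - apply RInt_le; [assumption| | |].
    + apply ex_RInt_cont; [assumption|]. intros x Hx. apply weight_cont. lra.
    + apply ex_RInt_cont; [assumption|]. intros x Hx.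
      apply (continuous_plus (fun x => f x * Rpower x (- a) * exp_sum N (y * ln x)) (fun x => e *
          (f x * Rpower x (- a)))); [now apply Hc1|now apply Hc2].
    + intros x Hx.
      assert (E2 : Rpower x (- (a - y)) = Rpower x (- a) * exp (y * ln x)).
      { unfold Rpower. rewrite <- exp_plus. f_equal. ring. }
      assert (Lx := ln_nonneg x ltac:(lra)).
      assert (LX : ln x <= ln X) by (apply Rcomplements.ln_le; lra).
      destruct (exp_rem_mono N (y * ln x) U) as [R1 R2].
      { apply Rmult_le_pos; lra. }
      { unfold U. apply Rmult_le_compat_l; lra. }
      fold e in R2. rewrite E2.
      assert (W := weight_nonneg a x).
      replace (f x * (Rpower x (- a) * exp (y * ln x))) with (f x * Rpower x (- a) * exp (y * ln
          x)) by ring.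
      nra.
  - assert (P := RInt_plus (V := R_CompleteNormedModule) (fun x => f x * Rpower x (- a) * exp_sum
        N (y * ln x)) (fun x => e * (f x * Rpower x (- a))) 1 X
      (ex_RInt_cont _ 1 X HX Hc1) (ex_RInt_cont _ 1 X HX Hc2)).
    assert (P2 := RInt_scal (V := R_CompleteNormedModule) (fun x => f x * Rpower x (- a)) 1 X e
      (ex_RInt_cont _ 1 X HX (fun x Hx => weight_cont a x ltac:(lra)))).
    unfold plus, scal in P, P2; simpl in P, P2. unfold mult in P2; simpl in P2.
    rewrite P, P2.
    assert (E3 : M * sum_f_R0 (fun n => (y / r) ^ n) N <= M / (1 - y / r)).
    { unfold Rdiv at 2. apply Rmult_le_compat_l; [assumption|].
      rewrite tech3 by lra. apply Rmult_le_reg_r with (1 - y / r); [lra|].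
      unfold Rdiv at 1. rewrite Rmult_assoc, !Rinv_l by lra.
      assert (0 <= (y / r) ^ S N) by (apply pow_le; lra). lra. }
    assert (E4 : e * RInt (fun x => f x * Rpower x (- a)) 1 X <= 1).
    { assert (0 <= RInt (fun x => f x * Rpower x (- a)) 1 X).
      { apply RInt_ge_0; [assumption| |].
        - apply ex_RInt_cont; [assumption|]. intros x Hx. apply weight_cont. lra.
        - intros x Hx. apply weight_nonneg. }
      apply Rle_trans with (/ (M + 1) * RInt (fun x => f x * Rpower x (- a)) 1 X).
      - apply Rmult_le_compat_r; assumption.
      - apply Rmult_le_reg_l with (M + 1); [lra|]. rewrite <- Rmult_assoc, Rinv_r by lra. lra. }
    lra.
Qed.

(** The centre a is taken so far to the right that the circle of radius 1/2 lies
    where the transform is given by the integral; the disc about a of radius a - c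
    then reaches every real point sigma > c. *)
Theorem landau_mellin (Z : C -> C) (c b sigma : R) :
  (forall s, c < Re s -> Cdiff Z s) -> mellin_bounded f b ->
  (forall s, c < Re s -> b <= Re s -> is_improper (mellin_kernel f s) (Z s)) ->
  c < sigma -> mellin_bounded f sigma.
Proof.
  intros HZ Hb HI Hs.
  set (a := Rmax (Rmax (c + 2) (b + 1)) (sigma + 1)).
  assert (A1 : c + 2 <= a) by (eapply Rle_trans; [|apply Rmax_l]; apply Rmax_l).
  assert (A2 : b + 1 <= a) by (eapply Rle_trans; [|apply Rmax_l]; apply Rmax_r).
  assert (A3 : sigma + 1 <= a) by apply Rmax_r.
  set (y := a - sigma). set (r := a - (sigma + c) / 2). set (rho := a - c).
  destruct (log_moment_bound Z a r rho) as [M [HM0 HM]].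
  - apply (mellin_bounded_mono b); [lra|assumption].
  - unfold r. lra.
  - unfold r, rho. lra.
  - intros s Hs'. apply HZ. assert (B := Re_le_Cmod (s - a)%C).
    change (Re (s - a)%C) with (Re s - a) in B.
    apply Rabs_le_between in B. unfold rho in Hs'. lra.
  - intros t. assert (B := Re_circ_ge a t). apply HI; lra.
  - replace sigma with (a - y) by (unfold y; ring).
    apply (mellin_bounded_of_log_moments a y M r HM0); [unfold y, r; lra|assumption].
Qed.

End Landau.

(** * The transform of a density with bounded moments *)

Lemma is_derive_weight_RInt (g : R -> R) (x : R) : 0 < x -> (forall u, 0 < u -> continuous g u) ->
  is_derive (fun X => RInt g 1 X) x (g x).
Proof.
  intros Hx Hg. apply (is_derive_RInt (V := R_NormedModule) g (fun X => RInt g 1 X) 1);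
    [|now apply Hg].
  exists (mkposreal x Hx). intros z Hz. change (Rabs (z - x) < x) in Hz.
  apply Rabs_lt_between in Hz.
  apply (RInt_correct (V := R_CompleteNormedModule)).
  apply (ex_RInt_continuous (V := R_CompleteNormedModule)). intros u Hu. apply Hg.
  eapply Rlt_le_trans; [|apply Hu]. apply Rmin_pos; lra.
Qed.

Lemma is_derive_Rpower (b x : R) : 0 < x ->
    is_derive (fun u => Rpower u b) x (b * Rpower x (b - 1)).
Proof. intros Hx. apply is_derive_Reals. now apply derivable_pt_lim_power. Qed.

(** With F the integral of f, the function
    [Psi X = (integral of f x^(-sigma)) - F X X^(-sigma) + K X^(-delta)]
    is nonincreasing for K = |sigma| A / delta, by the bound on F; this is partial
    summation in a form that covers both signs of sigma. *)
Lemma moment_mellin_bounded (f : R -> R) (A sigma delta : R) :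
  (forall x, continuous f x) -> (forall x, 0 <= f x) -> 0 < delta ->
  (forall X, 1 <= X -> RInt f 1 X <= A * Rpower X (sigma - delta)) ->
  mellin_bounded f sigma.
Proof.
  intros Hf Hf0 Hd HF.
  assert (HA : 0 <= A).
  { specialize (HF 1 (Rle_refl 1)). rewrite RInt_point in HF. unfold Rpower in HF.
    rewrite ln_1, Rmult_0_r, exp_0 in HF. unfold zero in HF; simpl in HF. lra. }
  exists (A + Rabs sigma * A / delta). intros X HX.
  set (G := fun X => RInt (fun x => f x * Rpower x (- sigma)) 1 X).
  set (F := fun X => RInt f 1 X).
  set (Psi := fun x => G x - F x * Rpower x (- sigma) + Rabs sigma * A / delta * Rpower x (-
      delta)).
  set (dPsi := fun x => f x * Rpower x (- sigma) - (f x * Rpower x (- sigma) + F x * (- sigma *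
      Rpower x (- sigma - 1)))
     + Rabs sigma * A / delta * (- delta * Rpower x (- delta - 1))).
  assert (D : forall x, 0 < x -> is_derive Psi x (dPsi x)).
  { intros x Hx. unfold Psi, dPsi.
    apply (is_derive_plus (V := R_NormedModule) (fun x => G x - F x * Rpower x (- sigma)) (fun x
        => Rabs sigma * A / delta * Rpower x (- delta))).
    - apply (is_derive_minus (V := R_NormedModule) G (fun x => F x * Rpower x (- sigma))).
      + apply (is_derive_weight_RInt (fun x => f x * Rpower x (- sigma))); [assumption|].
        intros u Hu. now apply weight_cont.
      + apply (is_derive_mult (K := R_AbsRing) F (fun x => Rpower x (- sigma))).
        * apply is_derive_weight_RInt; auto.
        * now apply is_derive_Rpower.
        * intros; apply Rmult_comm.
    - apply is_derive_scal. now apply is_derive_Rpower. }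
  assert (N : forall x, 1 <= x -> dPsi x <= 0).
  { intros x Hx. unfold dPsi. specialize (HF x Hx). fold (F x) in HF.
    assert (F0 : 0 <= F x). { apply RInt_ge_0; [assumption| |auto]. apply ex_RInt_cont; auto. }
    assert (P1 := Rpower_pos x (- sigma - 1)).
    assert (E : Rpower x (sigma - delta) * Rpower x (- sigma - 1) = Rpower x (- delta - 1)).
    { rewrite <- Rpower_plus. f_equal. ring. }
    assert (K : F x * Rpower x (- sigma - 1) <= A * Rpower x (- delta - 1)).
    { rewrite <- E, <- Rmult_assoc. apply Rmult_le_compat_r; [lra|assumption]. }
    assert (K2 : sigma * (F x * Rpower x (- sigma - 1))
        <= Rabs sigma * (A * Rpower x (- delta - 1))).
    { apply Rle_trans with (Rabs sigma * (F x * Rpower x (- sigma - 1))).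
      - apply Rmult_le_compat_r; [apply Rmult_le_pos; lra|apply Rle_abs].
      - apply Rmult_le_compat_l; [apply Rabs_pos|assumption]. }
    replace (Rabs sigma * A / delta * (- delta * Rpower x (- delta - 1))) with (- (Rabs sigma *
        (A * Rpower x (- delta - 1)))) by (field; lra).
    lra. }
  assert (M : Psi X <= Psi 1).
  { destruct (MVT_gen Psi 1 X dPsi) as [c [Hc E]].
    - rewrite Rmin_left, Rmax_right by assumption. intros x Hx. apply D. lra.
    - rewrite Rmin_left, Rmax_right by assumption. intros x Hx. apply continuity_pt_filterlim.
      apply (ex_derive_continuous Psi). eexists. apply D. lra.
    - rewrite Rmin_left, Rmax_right in Hc by assumption. assert (N' := N c ltac:(lra)). nra. }
  assert (P1 : Psi 1 = Rabs sigma * A / delta).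
  { unfold Psi, G, F. rewrite !RInt_point. unfold Rpower. rewrite ln_1, !Rmult_0_r, exp_0.
    unfold zero; simpl. ring. }
  rewrite P1 in M. unfold Psi in M.
  assert (K1 : F X * Rpower X (- sigma) <= A).
  { apply Rle_trans with (A * Rpower X (sigma - delta) * Rpower X (- sigma)).
    - apply Rmult_le_compat_r; [left; apply Rpower_pos|now apply HF].
    - rewrite Rmult_assoc, <- Rpower_plus. rewrite <- (Rmult_1_r A) at 2.
      apply Rmult_le_compat_l; [assumption|].
      rewrite <- (Rpower_O X) by lra. apply Rpower_le_exp; lra. }
  assert (K2 : 0 <= Rabs sigma * A / delta * Rpower X (- delta)).
  { apply Rmult_le_pos; [|left; apply Rpower_pos].
    apply Rmult_le_pos; [apply Rmult_le_pos; [apply Rabs_pos|assumption]|].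
    left; now apply Rinv_0_lt_compat. }
  fold (G X). lra.
Qed.

Section Holomorphy.
Variable f : R -> R.
Hypothesis Hf : forall x, continuous f x.
Hypothesis Hf0 : forall x, 0 <= f x.

Definition mellin_transform (s : C) : C :=
  RInt_gen (V := C_R_CompleteNormedModule) (mellin_kernel f s) (at_point 1) (Rbar_locally
      p_infty).

Lemma mellin_kernel_cont_on s x : 1 <= x -> Ccontinuous (mellin_kernel f s) x.
Proof. intros Hx. apply mellin_kernel_cont; [apply Hf|lra]. Qed.

Lemma mellin_transform_spec (s : C) (B : R) :
  (forall X, 1 <= X -> RInt (fun x => f x * Rpower x (- Re s)) 1 X <= B) ->
  is_improper (mellin_kernel f s) (mellin_transform s) /\ Cmod (mellin_transform s) <= B.
Proof.
  intros HB.
  destruct (improper_dominated (mellin_kernel f s) (fun x => f x * Rpower x (- Re s)) B) as [l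
      [Hl Hl2]].
  - apply mellin_kernel_cont_on.
  - intros x Hx. apply weight_cont; [assumption|lra].
  - intros x Hx. rewrite Cmod_mellin_kernel by apply Hf0. lra.
  - assumption.
  - assert (E : mellin_transform s = l).
    { unfold mellin_transform. refine (is_RInt_gen_unique (V := C_R_CompleteNormedModule) (Fa :=
          at_point 1) (Fb := Rbar_locally p_infty) (mellin_kernel f s) l _). exact Hl. }
    rewrite E. split; [assumption|]. specialize (Hl2 1 (Rle_refl 1)).
    unfold CInt in Hl2. rewrite !RInt_point in Hl2. unfold zero in Hl2; simpl in Hl2.
    change ((0, 0) : C) with (RtoC 0) in Hl2.
    assert (L0 : forall z : C, (z - 0)%C = z) by (intros; ring).
    rewrite L0 in Hl2. lra.
Qed.

(** The derivative is the integral of - ln x f(x) x^(-s).  The error of the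
    difference quotient is bounded by [Cexp_taylor1] with w = - h ln x, where each
    factor ln x and the factor e^|w| cost x^e; a quarter e of the distance from
    Re s to c leaves room for all three. *)
Lemma mellin_transform_derive (c : R) (s : C) : (forall sigma, c < sigma ->
    mellin_bounded f sigma) ->
  c < Re s -> Cdiff mellin_transform s.
Proof.
  intros Hb Hs. set (sigma := Re s) in *. set (e := (sigma - c) / 4).
  assert (He : 0 < e) by (unfold e; lra).
  assert (Hspec : forall z, c < Re z -> is_improper (mellin_kernel f z) (mellin_transform z)).
  { intros z Hz. destruct (Hb (Re z) Hz) as [B HB]. now apply (mellin_transform_spec z B). }
  set (K := fun x => (RtoC (- ln x) * mellin_kernel f s x)%C).
  assert (HKc : forall x, 1 <= x -> Ccontinuous K x).
  { intros x Hx. apply Ccontinuous_mult; [|now apply mellin_kernel_cont_on].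
    apply Ccontinuous_RtoC, (continuous_opp ln), continuous_ln. lra. }
  destruct (Hb (sigma - e)) as [B1 HB1]; [unfold e; lra|].
  destruct (improper_dominated K (fun x => / e * (f x * Rpower x (- (sigma - e)))) (/ e * B1)) as
      [D [HD _]].
  { exact HKc. }
  { intros x Hx. apply continuous_Rmult; [apply continuous_const|apply weight_cont;
      [assumption|lra]]. }
  { intros x Hx. unfold K. rewrite Cmod_mult, Cmod_R, Rabs_Ropp, Cmod_mellin_kernel by apply Hf0.
    assert (L := ln_nonneg x Hx). rewrite Rabs_right by lra.
    replace (- (sigma - e)) with (e + - sigma) by ring. rewrite Rpower_plus. fold sigma.
    replace (/ e * (f x * (Rpower x e * Rpower x (- sigma)))) with (/ e * Rpower x e * (f x *
        Rpower x (- sigma))) by ring.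
    apply Rmult_le_compat_r; [now apply weight_nonneg|now apply ln_le_Rpower]. }
  { intros X HX.
    assert (P2 := RInt_scal (V := R_CompleteNormedModule) (fun x => f x * Rpower x (- (sigma -
        e))) 1 X (/ e)
      (ex_RInt_cont _ 1 X HX (fun x Hx => weight_cont f Hf (sigma - e) x ltac:(lra)))).
    unfold scal in P2; simpl in P2. unfold mult in P2; simpl in P2. rewrite P2.
    apply Rmult_le_compat_l; [left; now apply Rinv_0_lt_compat|now apply HB1]. }
  destruct (Hb (sigma - 3 * e)) as [B3 HB3]; [unfold e; lra|].
  assert (HB30 : 0 <= B3).
  { specialize (HB3 1 (Rle_refl 1)). rewrite RInt_point in HB3. unfold zero in HB3; simpl in HB3.
    lra. }
  exists D. apply Cderiv_eps. intros eps Heps.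
  assert (Hee : 0 < e * e) by nra.
  exists (Rmin e (eps * (e * e) / (B3 + 1))). split.
  { apply Rmin_pos; [assumption|]. apply Rdiv_lt_0_compat; nra. }
  intros h Hh.
  assert (Hh1 := Rlt_le_trans _ _ _ Hh (Rmin_l _ _)).
  assert (Hh2 := Rlt_le_trans _ _ _ Hh (Rmin_r _ _)).
  assert (Hh0 := Cmod_ge_0 h).
  assert (Hre : c < Re (s + h)%C).
  { assert (R1 := Re_le_Cmod h). apply Rabs_le_between in R1.
    change (Re (s + h)%C) with (sigma + Re h). unfold e in *. lra. }
  apply Rle_trans with (Cmod h ^ 2 / (e * e) * B3).
  - apply (improper_comb_le (mellin_kernel f (s + h)%C) (mellin_kernel f s) K); try assumption.
    + apply mellin_kernel_cont_on.
    + apply mellin_kernel_cont_on.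
    + now apply Hspec.
    + now apply Hspec.
    + intros X HX.
      assert (Cn1 : Ccontinuous_on (mellin_kernel f (s + h)%C) 1 X) by (intros t Ht;
        apply mellin_kernel_cont_on; lra).
      assert (Cn2 : Ccontinuous_on (mellin_kernel f s) 1 X) by (intros t Ht;
        apply mellin_kernel_cont_on; lra).
      assert (Cn3 : Ccontinuous_on K 1 X) by (intros t Ht; apply HKc; lra).
      assert (Cn4 : Ccontinuous_on (fun x => h * K x)%C 1 X) by (intros t Ht;
        apply Ccontinuous_mult; [apply Ccontinuous_const|apply HKc; lra]).
      assert (Cn5 : Ccontinuous_on (fun x => mellin_kernel f (s + h)%C x - mellin_kernel f s x)%C
          1 X).
      { intros t Ht. apply Ccontinuous_minus; [now apply Cn1|now apply Cn2]. }
      rewrite (Cmult_comm (CInt K 1 X) h), <- CInt_Cmult, <- CInt_minus, <- CInt_minus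
        by assumption.
      assert (ExW : ex_RInt (fun x => f x * Rpower x (- (sigma - 3 * e))) 1 X).
      { apply ex_RInt_cont; [assumption|]. intros x Hx. apply weight_cont; [assumption|lra]. }
      assert (P2 := is_RInt_scal (V := R_NormedModule) _ 1 X (Cmod h ^ 2 / (e * e)) _
        (RInt_correct (V := R_CompleteNormedModule) _ 1 X ExW)).
      apply Rle_trans with (RInt (fun x => Cmod h ^ 2 / (e * e) * (f x * Rpower x (- (sigma - 3 *
          e)))) 1 X).
      * apply CInt_norm_le; [assumption| | |].
        -- intros t Ht. apply Ccontinuous_minus; [now apply Cn5|now apply Cn4].
        -- eexists. exact P2.
        -- intros x Hx.
           assert (L := ln_nonneg x ltac:(lra)). assert (LR := ln_le_Rpower x e ltac:(lra) He).
           set (w := (- RtoC (ln x) * h)%C).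
           replace (mellin_kernel f (s + h)%C x - mellin_kernel f s x - h * K x)%C
             with (mellin_kernel f s x * (Cexp w - 1 - w))%C.
           2:{ unfold K, mellin_kernel, w.
           rewrite Copp_plus_distr, cpow_plus, (cpow_Cexp x (- h)%C).
               replace (RtoC (ln x) * - h)%C with (- RtoC (ln x) * h)%C by ring.
               rewrite RtoC_opp. ring. }
           rewrite Cmod_mult, Cmod_mellin_kernel by apply Hf0. fold sigma.
           assert (Hw : Cmod w = ln x * Cmod h).
           { unfold w. rewrite Cmod_mult, Cmod_opp, Cmod_R, Rabs_right by lra. reflexivity. }
           assert (T := Cexp_taylor1 w). rewrite Hw in T.
           assert (Ex : exp (ln x * Cmod h) <= Rpower x e).
           { unfold Rpower. apply exp_le_compat. rewrite (Rmult_comm e).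
             apply Rmult_le_compat_l; lra. }
           assert (Sq : (ln x * Cmod h) ^ 2 <= Cmod h ^ 2 / (e * e) * (Rpower x e * Rpower x e)).
           { replace ((ln x * Cmod h) ^ 2) with (Cmod h ^ 2 * (ln x * ln x)) by ring.
             replace (Cmod h ^ 2 / (e * e) * (Rpower x e * Rpower x e)) with
               (Cmod h ^ 2 * ((/ e * Rpower x e) * (/ e * Rpower x e))) by (field; lra).
             apply Rmult_le_compat_l; [apply pow2_ge_0|]. apply Rmult_le_compat; assumption. }
           replace (- (sigma - 3 * e)) with (- sigma + (e + e + e)) by ring.
           rewrite !Rpower_plus.
           apply Rle_trans with (f x * Rpower x (- sigma) * (Cmod h ^ 2 / (e * e) * (Rpower x e *
               Rpower x e) * Rpower x e)).
           ++ apply Rmult_le_compat_l; [now apply weight_nonneg|].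
              eapply Rle_trans; [exact T|].
              apply Rmult_le_compat; [apply pow2_ge_0|left; apply exp_pos|assumption|assumption].
           ++ right. ring.
      * apply Rle_trans with (Cmod h ^ 2 / (e * e) * RInt (fun x => f x * Rpower x (- (sigma - 3
            * e))) 1 X).
        { right. exact (is_RInt_unique (V := R_CompleteNormedModule) _ _ _ _ P2). }
        apply Rmult_le_compat_l; [|now apply HB3].
        apply Rmult_le_pos; [apply pow2_ge_0|]. left. now apply Rinv_0_lt_compat.
  - replace (Cmod h ^ 2 / (e * e) * B3) with (Cmod h * (Cmod h * B3 / (e * e))) by (field; lra).
    rewrite (Rmult_comm eps). apply Rmult_le_compat_l; [assumption|].
    apply Rmult_le_reg_r with (e * e); [assumption|].
    unfold Rdiv. rewrite Rmult_assoc, Rinv_l by lra. rewrite Rmult_1_r.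
    apply Rle_trans with (eps * (e * e) / (B3 + 1) * (B3 + 1)).
    + apply Rmult_le_compat; lra.
    + right. field. lra.
Qed.

End Holomorphy.

(** * Moments of the zeta function *)

Lemma zeta_path_continuous zeta t : is_riemann_zeta zeta ->
    Ccontinuous (fun u => zeta (1 / 2, u)) t.
Proof.
  intros Hz. apply Ccontinuous_vertical. apply Cdiff_zeta; [assumption|].
  intros E. apply (f_equal fst) in E. simpl in E. lra.
Qed.

(** Goursat's theorem for zeta(s)(s - s2) on [1/2, 3] x [1, 1 + H] with s2 the upper
    left corner.  The right side contributes at least H^2/4 - 5H/4, since there
    Re zeta >= 1/2; the lower and the upper side contribute O(H), and on the left
    side |s - s2| <= H. *)
Lemma zeta_first_moment_lower zeta H : is_riemann_zeta zeta -> 1 <= H ->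
  H / 4 - 290 <= RInt (fun y => Cmod (zeta (1 / 2, y))) 1 (1 + H).
Proof.
  intros Hz HH.
  set (s2 := (1 / 2, 1 + H) : C).
  set (F := fun s => (zeta s * (s - s2))%C).
  assert (HF : Cdiff_rect F (1 / 2) 3 1 (1 + H)).
  { intros x y Hx Hy. unfold F. apply Cdiff_mult; [|eexists; cderiv].
    apply Cdiff_zeta; [assumption|]. intros E. apply (f_equal snd) in E. simpl in E. lra. }
  assert (G := goursat_rectangle F (1 / 2) 3 1 (1 + H) ltac:(lra) ltac:(lra) HF).
  unfold rect_int in G.
  assert (Hsub : forall x y, ((x, y) - s2)%C = ((x - 1 / 2, y - (1 + H)) : C)) by reflexivity.
  assert (Hgr : forall x y, 1 / 2 <= x <= 3 -> 1 <= y -> Cmod (zeta (x, y)) <= 4 * (3 + y)).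
  { intros x y Hx Hy. eapply Rle_trans; [apply zeta_growth; [assumption|cbn; lra|cbn; lra]|].
    apply Rmult_le_compat_l; [lra|]. eapply Rle_trans; [apply Cmod_le_Re_Im|].
    cbn [Re Im fst snd].
    rewrite !Rabs_right; lra. }
  assert (Hbot : Cmod (CInt (fun x => F (x, 1)) (1 / 2) 3) <= 16 * (3 + H) * (3 - 1 / 2)).
  { apply CInt_bound; [lra|apply (Cdiff_rect_h _ _ _ _ _ _ HF); lra|].
    intros x Hx. unfold F. rewrite Cmod_mult, Hsub.
    assert (Z1 := Hgr x 1 Hx ltac:(lra)).
    assert (Z2 : Cmod (x - 1 / 2, 1 - (1 + H)) <= 3 + H).
    { eapply Rle_trans; [apply Cmod_le_Re_Im|]. cbn [Re Im fst snd].
      rewrite Rabs_right, Rabs_left by lra. lra. }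
    replace (16 * (3 + H)) with (4 * (3 + 1) * (3 + H)) by ring.
    apply Rmult_le_compat; try apply Cmod_ge_0; assumption. }
  assert (Htop : Cmod (CInt (fun x => F (x,
      1 + H)) (1 / 2) 3) <= 4 * (3 + (1 + H)) * (5 / 2) * (3 - 1 / 2)).
  { apply CInt_bound; [lra|apply (Cdiff_rect_h _ _ _ _ _ _ HF); lra|].
    intros x Hx. unfold F. rewrite Cmod_mult, Hsub.
    assert (Z1 := Hgr x (1 + H) Hx ltac:(lra)).
    assert (Z2 : Cmod (x - 1 / 2, 1 + H - (1 + H)) <= 5 / 2).
    { eapply Rle_trans; [apply Cmod_le_Re_Im|]. cbn [Re Im fst snd].
      rewrite Rminus_eq_0, Rabs_R0, Rabs_right by lra. lra. }
    apply Rmult_le_compat; try apply Cmod_ge_0; assumption. }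
  assert (Cabs : forall y, continuous (fun y => Cmod (zeta (1 / 2, y))) y).
  { intros y. now apply continuous_Cmod, zeta_path_continuous. }
  assert (Exl : ex_RInt (fun y => Cmod (zeta (1 / 2, y))) 1 (1 + H)) by (apply ex_RInt_cont;
    [lra|auto]).
  assert (Hleft : Cmod (Ci * CInt (fun y => F ((1 / 2)%R,
      y)) 1 (1 + H))%C <= H * RInt (fun y => Cmod (zeta (1 / 2, y))) 1 (1 + H)).
  { rewrite Cmod_mult, Cmod_Ci, Rmult_1_l.
    assert (P := is_RInt_scal (V := R_NormedModule) _ 1 (1 + H) H _ (RInt_correct (V :=
        R_CompleteNormedModule) _ 1 (1 + H) Exl)).
    apply Rle_trans with (RInt (fun y => H * Cmod (zeta (1 / 2, y))) 1 (1 + H)).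
    - apply CInt_norm_le; [lra|apply (Cdiff_rect_v _ _ _ _ _ _ HF); lra|eexists; exact P|].
      intros y Hy. unfold F. rewrite Cmod_mult, Hsub, Rmult_comm.
      apply Rmult_le_compat_r; [apply Cmod_ge_0|].
      eapply Rle_trans; [apply Cmod_le_Re_Im|]. cbn [Re Im fst snd].
      rewrite Rminus_eq_0, Rabs_R0, Rabs_left1 by lra. lra.
    - right. exact (is_RInt_unique (V := R_CompleteNormedModule) _ _ _ _ P). }
  assert (Hright : H ^ 2 / 4 - 5 / 4 * H <= Cmod (Ci * CInt (fun y => F (3, y)) 1 (1 + H))%C).
  { assert (CF : Ccontinuous_on (fun y => F (3, y)) 1 (1 + H))
      by (apply (Cdiff_rect_v _ _ _ _ _ _ HF); lra).
    rewrite <- CInt_Cmult by (assumption || lra).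
    assert (CF2 : Ccontinuous_on (fun y => Ci * F (3%R, y))%C 1 (1 + H)).
    { intros y Hy. apply Ccontinuous_mult; [apply Ccontinuous_const|now apply CF]. }
    eapply Rle_trans; [|apply Re_le_Cmod]. eapply Rle_trans; [|apply Rle_abs].
    unfold CInt. cbn [Re fst].
    assert (D : is_RInt (fun y => 1 / 2 * (1 + H - y) - 5 / 4) 1 (1 + H)
      ((- (1 + H - (1 + H)) ^ 2 / 4 - 5 / 4 * (1 + H)) - (- (1 + H - 1) ^ 2 / 4 - 5 / 4 * 1))).
    { apply (is_RInt_derive (fun y => - (1 + H - y) ^ 2 / 4 - 5 / 4 * y)).
      - intros x _. auto_derive; auto. field.
      - intros x _. apply (ex_derive_continuous (fun y => 1 / 2 * (1 + H - y) - 5 / 4)).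
        auto_derive. auto. }
    apply Rle_trans with (RInt (fun y => 1 / 2 * (1 + H - y) - 5 / 4) 1 (1 + H)).
    - rewrite (is_RInt_unique _ _ _ _ D). right. field.
    - apply RInt_le; [lra|eexists; exact D|apply (ex_CInt_Re (fun y => Ci * F (3%R, y))%C);
        [lra|exact CF2]|].
      intros y Hy. unfold F. rewrite Hsub.
      assert (N := zeta_near_1 zeta (3, y) Hz eq_refl).
      set (z := zeta (3, y)) in *.
      assert (N1 := Rle_trans _ _ _ (Re_le_Cmod (z - 1)%C) N).
      assert (N2 := Rle_trans _ _ _ (Im_le_Cmod (z - 1)%C) N).
      change (Re (z - 1)%C) with (Re z - 1) in N1.
      replace (Im (z - 1)%C) with (Im z) in N2 by (unfold Im, Cminus, Cplus, Copp, RtoC; simpl;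
        ring).
      apply Rabs_le_between in N1. apply Rabs_le_between in N2.
      replace (Re (Ci * (z * (3 - 1 / 2, y - (1 + H))%R))%C)
        with (Re z * (1 + H - y) - 5 / 2 * Im z)
        by (unfold Re, Im, Ci, Cmult; simpl; field).
      assert (1 / 2 * (1 + H - y) <= Re z * (1 + H - y)) by (apply Rmult_le_compat_r; lra).
      lra. }
  set (b := CInt (fun x => F (x, 1)) (1 / 2) 3) in *.
  set (rr := (Ci * CInt (fun y => F (3, y)) 1 (1 + H))%C) in *.
  set (tt := CInt (fun x => F (x, 1 + H)) (1 / 2) 3) in *.
  set (ll := (Ci * CInt (fun y => F ((1 / 2)%R, y)) 1 (1 + H))%C) in *.
  assert (Er : rr = (- b + (tt + ll))%C).
  { replace rr with ((b + rr - tt - ll) + (- b + (tt + ll)))%C by ring.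
    rewrite G. ring. }
  rewrite Er in Hright.
  assert (T1 := Cmod_triangle (- b) (tt + ll)). assert (T2 := Cmod_triangle tt ll).
  rewrite Cmod_opp in T1.
  set (I := RInt (fun y => Cmod (zeta (1 / 2, y))) 1 (1 + H)) in *.
  apply Rmult_le_reg_l with H; [lra|]. nra.
Qed.

Lemma zeta_moment_density_cont zeta k x : is_riemann_zeta zeta ->
    continuous (zeta_moment_density zeta k) x.
Proof.
  intros Hz. unfold zeta_moment_density.
  apply (continuous_comp (fun t => Cmod (zeta (1 / 2, t))) (fun u => u ^ (2 * k))).
  - now apply continuous_Cmod, zeta_path_continuous.
  - apply (ex_derive_continuous (fun u => u ^ (2 * k))). auto_derive. auto.
Qed.

Lemma zeta_moment_density_nonneg zeta k x : 0 <= zeta_moment_density zeta k x.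
Proof. apply pow_le, Cmod_ge_0. Qed.

(** The inequality u <= 1/8 + (8u)^(2k) for u >= 0, k >= 1 turns the lower bound for the first
    moment into one for the 2k-th. *)
Lemma zeta_moment_unbounded zeta k B : is_riemann_zeta zeta -> (1 <= k)%nat ->
  ~ (forall X, 1 <= X -> RInt (zeta_moment_density zeta k) 1 X <= B).
Proof.
  intros Hz Hk HB.
  set (c := 8 ^ (2 * k)).
  assert (Hc : 0 < c) by (apply pow_lt; lra).
  assert (HB0 : 0 <= B).
  { specialize (HB 1 (Rle_refl 1)). rewrite RInt_point in HB. exact HB. }
  set (H := 1 + 8 * (291 + c * B)).
  assert (HH : 1 <= H) by (unfold H; nra).
  assert (L := zeta_first_moment_lower zeta H Hz HH).
  assert (Pt : forall y, Cmod (zeta (1 / 2, y)) <= 1 / 8 + c * zeta_moment_density zeta k y).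
  { intros y. unfold zeta_moment_density, c. set (u := Cmod (zeta (1 / 2, y))).
    assert (Hu : 0 <= u) by apply Cmod_ge_0.
    rewrite <- Rpow_mult_distr.
    destruct (Rle_lt_dec u (1 / 8)) as [H1|H1].
    - assert (0 <= (8 * u) ^ (2 * k)) by (apply pow_le; lra). lra.
    - assert (K : (8 * u) ^ 1 <= (8 * u) ^ (2 * k)) by (apply Rle_pow; [lra|lia]).
      rewrite pow_1 in K. lra. }
  assert (Cd := zeta_moment_density_cont zeta k).
  assert (Ex : ex_RInt (zeta_moment_density zeta k) 1 (1 + H)) by (apply ex_RInt_cont;
    [lra|auto]).
  assert (P1 := is_RInt_scal (V := R_NormedModule) _ 1 (1 + H) c _ (RInt_correct (V :=
      R_CompleteNormedModule) _ 1 (1 + H) Ex)).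
  assert (P2 := is_RInt_plus (V := R_NormedModule) _ _ 1 (1 + H) _ _ (is_RInt_const (V :=
      R_NormedModule) 1 (1 + H) (1 / 8)) P1).
  assert (U : RInt (fun y => Cmod (zeta (1 / 2,
      y))) 1 (1 + H) <= (1 + H - 1) * (1 / 8) + c * RInt (zeta_moment_density zeta k) 1 (1 + H)).
  { apply Rle_trans with (RInt (fun y => 1 / 8 + c * zeta_moment_density zeta k y) 1 (1 + H)).
    - apply RInt_le; [lra| |eexists; exact P2|intros; apply Pt].
      apply ex_RInt_cont; [lra|]. intros y _. now apply continuous_Cmod, zeta_path_continuous.
    - right. exact (is_RInt_unique (V := R_CompleteNormedModule) _ _ _ _ P2). }
  assert (HB2 := HB (1 + H) ltac:(lra)).
  assert (c * RInt (zeta_moment_density zeta k) 1 (1 + H) <= c * B) by (apply Rmult_le_compat_l;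
    lra).
  unfold H in *. lra.
Qed.

Lemma zeta_mellin_bounded_far zeta k : is_riemann_zeta zeta ->
  mellin_bounded (zeta_moment_density zeta k) (2 * INR k + 2).
Proof.
  intros Hz.
  apply (moment_mellin_bounded _ (8 ^ (2 * k)) _ 1).
  - intros x. now apply zeta_moment_density_cont.
  - intros x. apply zeta_moment_density_nonneg.
  - lra.
  - intros X HX.
    assert (Pt : forall x, 1 <= x <= X ->
        Rabs (zeta_moment_density zeta k x) <= (8 * X) ^ (2 * k)).
    { intros x Hx. rewrite Rabs_right by (apply Rle_ge, zeta_moment_density_nonneg).
      apply pow_incr. split; [apply Cmod_ge_0|].
      eapply Rle_trans; [apply zeta_growth; [assumption|cbn; lra|cbn; lra]|].
      assert (Cmod (1 / 2, x) <= 1 / 2 + x).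
      { eapply Rle_trans; [apply Cmod_le_Re_Im|]. cbn [Re Im fst snd]. rewrite !Rabs_right; lra. }
      lra. }
    eapply Rle_trans; [apply Rle_abs|].
    eapply Rle_trans; [apply RInt_bound with (M := (8 * X) ^ (2 * k)); [assumption| |exact Pt]|].
    + intros t _. now apply zeta_moment_density_cont.
    + rewrite Rpow_mult_distr, Rmult_assoc. apply Rmult_le_compat_l; [apply pow_le; lra|].
      replace (2 * INR k + 2 - 1) with (INR (2 * k) + 1) by (rewrite mult_INR; simpl; ring).
      rewrite Rpower_plus, Rpower_pow, Rpower_1 by lra.
      apply Rmult_le_compat_l; [apply pow_le; lra|lra].
Qed.

Lemma mellin_abs_cv_iff zeta k s : is_riemann_zeta zeta ->
  mellin_abs_cv zeta k s <-> mellin_bounded (zeta_moment_density zeta k) (Re s).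
Proof.
  intros Hz. unfold mellin_abs_cv, mellin_bounded.
  assert (Cd : forall x, continuous (zeta_moment_density zeta k) x) by (intros;
    now apply zeta_moment_density_cont).
  rewrite nonneg_improper_bounded.
  - assert (E : forall X, RInt (fun x => Cmod (mellin_integrand zeta k s x)) 1 X =
      RInt (fun x => zeta_moment_density zeta k x * Rpower x (- Re s)) 1 X).
    { intros X. apply RInt_ext. intros x _.
      apply (Cmod_mellin_kernel (zeta_moment_density zeta k)).
      apply zeta_moment_density_nonneg. }
    split; intros [B HB]; exists B; intros X HX; [rewrite <- E|rewrite E]; now apply HB.
  - intros x Hx. apply continuous_Cmod.
    apply (mellin_kernel_cont (zeta_moment_density zeta k)); [apply Cd|lra].
  - intros; apply Cmod_ge_0.
Qed.

(** * The equivalence *)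

Theorem theorem1 (zeta : C -> C) (Hzeta : is_riemann_zeta zeta)
    (k : nat) (Hk : (1 <= k)%nat) (c : R) :
  (forall eps : R, 0 < eps ->
     exists A : R, forall T : R, 1 <= T ->
       RInt (zeta_moment_density zeta k) 0 T <= A * Rpower T (c + eps))
  <->
  (exists Z : C -> C,
     is_regular_mellin zeta k c Z /\
     forall eps : R, 0 < eps ->
       exists A : R, forall t : R, Cmod (Z (c + eps, t)) <= A).
Proof.
  set (f := zeta_moment_density zeta k).
  assert (Hf : forall x, continuous f x) by (intros; now apply zeta_moment_density_cont).
  assert (Hf0 : forall x, 0 <= f x) by (intros; apply zeta_moment_density_nonneg).
  split.
  - intros HM.
    assert (Hb : forall sigma, c < sigma -> mellin_bounded f sigma).
    { intros sigma Hs. destruct (HM ((sigma - c) / 2)) as [A HA]; [lra|].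
      apply (moment_mellin_bounded f A sigma ((sigma - c) / 2)); auto; [lra|].
      intros X HX. specialize (HA X HX).
      replace (c + (sigma - c) / 2) with (sigma - (sigma - c) / 2) in HA by field.
      eapply Rle_trans; [|exact HA].
      rewrite <- (RInt_split f 0 1 X) by (lra || auto).
      assert (0 <= RInt f 0 1); [|lra].
      apply RInt_ge_0; [lra|apply ex_RInt_cont; [lra|auto]|auto]. }
    exists (mellin_transform f). split; [split|].
    + intros s Hs. destruct (mellin_transform_derive f Hf Hf0 c s Hb Hs) as [l Hl].
      exists l. now apply Cderiv_C_NormedModule.
    + intros s Hs _. destruct (Hb (Re s) Hs) as [B HB].
      exact (proj1 (mellin_transform_spec f Hf Hf0 s B HB)).
    + intros eps He. destruct (Hb (c + eps)) as [B HB]; [lra|].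
      exists B. intros t. exact (proj2 (mellin_transform_spec f Hf Hf0 (c + eps, t) B HB)).
  - intros [Z [[HZ HI] _]].
    assert (Hb : forall sigma, c < sigma -> mellin_bounded f sigma).
    { intros sigma Hs. apply (landau_mellin f Hf Hf0 Z c (2 * INR k + 2)); try assumption.
      - intros s Hs'. destruct (HZ s Hs') as [l Hl]. exists l. now apply Cderiv_C_NormedModule.
      - now apply zeta_mellin_bounded_far.
      - intros s Hs1 Hs2. apply HI; [assumption|]. apply mellin_abs_cv_iff; [assumption|].
        apply (mellin_bounded_mono f Hf Hf0 _ _ Hs2). now apply zeta_mellin_bounded_far. }
    destruct (Rlt_le_dec c 0) as [Hc|Hc].
    + (* Convergence at 0 would bound the moments. *)
      exfalso. destruct (Hb 0 Hc) as [B HB].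
      apply (zeta_moment_unbounded zeta k B Hzeta Hk). intros X HX.
      eapply Rle_trans; [|apply (HB X HX)]. right. apply RInt_ext.
      rewrite Rmin_left, Rmax_right by assumption. intros x Hx.
      rewrite Ropp_0, Rpower_O by lra. symmetry. apply Rmult_1_r.
    + intros eps He. destruct (Hb (c + eps)) as [B HB]; [lra|].
      set (K0 := RInt f 0 1).
      assert (HK0 : 0 <= K0) by (apply RInt_ge_0; [lra|apply ex_RInt_cont; [lra|auto]|auto]).
      exists (K0 + B). intros T HT.
      rewrite <- (RInt_split f 0 1 T) by (lra || auto). fold K0.
      assert (P1 : 1 <= Rpower T (c + eps)).
      { rewrite <- (Rpower_O T) by lra. apply Rpower_le_exp; lra. }
      assert (Exw : ex_RInt (fun x => f x * Rpower x (- (c + eps))) 1 T).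
      { apply ex_RInt_cont; [assumption|]. intros x Hx. apply weight_cont; [assumption|lra]. }
      assert (Sc := is_RInt_scal (V := R_NormedModule) _ 1 T (Rpower T (c + eps)) _ (RInt_correct
          (V := R_CompleteNormedModule) _ 1 T Exw)).
      assert (K1 : RInt f 1 T <= Rpower T (c + eps) * RInt (fun x => f x * Rpower x (- (c +
          eps))) 1 T).
      { apply Rle_trans with (RInt (fun x => Rpower T (c + eps) * (f x * Rpower x (- (c + eps))))
            1 T).
        - apply RInt_le; [assumption|apply ex_RInt_cont; auto|eexists; exact Sc|].
          intros x Hx.
          assert (Q : 1 <= Rpower T (c + eps) * Rpower x (- (c + eps))).
          { rewrite Rpower_Ropp. assert (Px := Rpower_pos x (c + eps)).
            assert (Mx : Rpower x (c + eps) <= Rpower T (c + eps)) by (apply Rle_Rpower_l; lra).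
            apply Rmult_le_reg_r with (Rpower x (c + eps)); [assumption|].
            rewrite Rmult_assoc, Rinv_l by lra. lra. }
          assert (F0 := Hf0 x). nra.
        - right. exact (is_RInt_unique (V := R_CompleteNormedModule) _ _ _ _ Sc). }
      assert (K2 : Rpower T (c + eps) * RInt (fun x => f x * Rpower x (- (c + eps))) 1 T
          <= Rpower T (c + eps) * B).
      { apply Rmult_le_compat_l; [lra|now apply HB]. }
      nra.
Qed.
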